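(* Let $\mathfrak g$ be an indecomposable, completely $X$-coupled QKM algebra with more than one simple root, without any assumptions on growth conditions. Then $\mathfrak g$ is of finite growth with Gelfand--Kirillov dimension $1$, and is one of three possible superalgebras, with the following Dynkin diagrams (each with two vertices $1,2$ joined by one edge labelled $a_{12},a_{21}$): (1) $\mathfrak q^X(A_1^{(1)})$: both vertices of type $Tak(\mathfrak{sl}(2))$, edge labelled $-2,-2$; (2) $\mathfrak q^X(A_2^{(2)})$: both vertices of type $Tak(\mathfrak{sl}(2))$, edge labelled $-4,-1$; (3) $\mathfrak q^X_{\bullet}(A_2^{(2)})$: vertex $1$ of type $Tak(\mathfrak{sl}(2))$, vertex $2$ of type $Tak(\mathfrak{osp}(1|2))$, edge labelled $-2,-1$.
   Context: Everything is over $\mathbb C$; $\bar v$ is the parity of a homogeneous $v$. **Quasi-toral algebras.** A finite-dimensional Lie superalgebra $\mathfrak h$ is quasi-toral if $[\mathfrak h_{\bar 0},\mathfrak h]=0$; put $\mathfrak t=\mathfrak h_{\bar 0}$. All $\mathfrak h$-modules considered are finite-dimensional with $\mathfrak t$ acting semisimply. For $\lambda\in\mathfrak t^*$, $\operatorname{rk}\lambda$ is the rank of the symmetric form $(x,y)\mapsto\lambda([x,y])$ on $\mathfrak h_{\bar 1}$. Let $\omega_{\mathfrak h}$ be the automorphism of $\mathfrak h$ equal to $-1$ on $\mathfrak h_{\bar 0}$ and $\sqrt{-1}$ on $\mathfrak h_{\bar 1}$. For an $\mathfrak h$-module $V$, $V^\vee=\{v^\vee: v\in V\}$ is the same superspace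 with action $x\cdot v^\vee=(\omega_{\mathfrak h}^{-1}(x)v)^\vee$. **Cartan datum.** A Cartan datum $\mathcal A$ consists of: a finite-dimensional quasi-toral $\mathfrak h$; a linearly independent set $\Pi=\{\alpha_1,\dots,\alpha_n\}\subseteq\mathfrak t^*$ (simple roots); for each $\alpha\in\pm\Pi$ an $\mathfrak h$-module $\mathfrak g_\alpha$ on which $\mathfrak t$ acts by $\alpha$; for each $\alpha\in\Pi$ an $\mathfrak h$-module morphism $[-,-]_\alpha:\mathfrak g_\alpha\otimes\mathfrak g_{-\alpha}\to\mathfrak h$ which is nondegenerate (nonzero on $U\otimes\mathfrak g_{-\alpha}$ and on $\mathfrak g_\alpha\otimes U'$ for all nonzero submodules $U,U'$). $\tilde{\mathfrak g}(\mathcal A)$ is the Lie superalgebra generated by $\bigoplus_i\mathfrak g_{-\alpha_i}\oplus\mathfrak h\oplus\bigoplus_i\mathfrak g_{\alpha_i}$ with relations: brackets inside $\mathfrak h$ are those of $\mathfrak h$; $[h,x]=h\cdot x$ for $h\in\mathfrak h$, $x\in\mathfrak g_{\pm\alpha_i}$; $[x,y]=\delta_{\alpha\beta}[x,y]_\alpha$ for $x\in\mathfrak g_\alpha$, $y\in\mathfrak g_{-\beta}$, $\alpha,\beta\in\Pi$. $\mathfrak g(\mathcal A)$ is the quotient of $\tilde{\mathfrak g}(\mathcal A)$ by its unique maximal ideal meeting $\mathfrak h$ trivially. Put $\mathfrak h_\alpha=[\mathfrak g_\alpha,\mathfrak g_{-\alpha}]\subseteq\mathfrak h$; $\mathfrak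 g\langle\alpha\rangle$ is the subalgebra generated by $\mathfrak g_{\alpha}$ and $\mathfrak g_{-\alpha}$. **QKM.** $\mathfrak g=\mathfrak g(\mathcal A)$ (or $\mathcal A$) is QKM (type Q Kac--Moody) if: (KM1) for all $\alpha,\beta\in\pm\Pi$ one has $(\operatorname{ad}\mathfrak g_\alpha)^N\mathfrak g_\beta=0$ for some $N$, computed in $\mathfrak g(\mathcal A)$; (KM2) for $\alpha,\beta\in\Pi$, $[\mathfrak h_\alpha,\mathfrak g_\beta]=0$ implies $[\mathfrak h_\beta,\mathfrak g_\alpha]=0$; (KM3) $\operatorname{rk}\alpha=2$ for all $\alpha\in\Pi$; (KM4) each $\mathfrak g_\alpha$, $\alpha\in\Pi$, is irreducible and $\mathfrak g_{-\alpha}\simeq\mathfrak g_\alpha^\vee$; (KM5) $\mathfrak h_\alpha\not\subseteq\sum_{\beta\in\Pi\setminus\{\alpha\}}\mathfrak h_\beta$ for all $\alpha\in\Pi$. It is indecomposable if there is no nontrivial partition $\Pi=\Pi_1\sqcup\Pi_2$ with $[\mathfrak h_\alpha,\mathfrak g_\beta]=[\mathfrak h_\beta,\mathfrak g_\alpha]=0$ for all $\alpha\in\Pi_1,\beta\in\Pi_2$. **Types.** For $\mathfrak s=\mathfrak{sl}(2),\mathfrak{osp}(1|2),\mathfrak{sl}(1|1)$ with invariant (supertrace) form $(-,-)$, $\mathfrak{ts}=\mathfrak s\otimes\mathbb C[\xi]\oplus\mathbb C c$ with $\xi$ odd, $\xi^2=0$, $c$ even central, and $[x\otimes p,y\otimes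 q]=(-1)^{\bar p\bar y}[x,y]\otimes pq+(-1)^{\bar y}(x,y)\operatorname{Res}(p'q)c$, where $p'=\partial_\xi p$, $\operatorname{Res}(a+b\xi)=b$. In a QKM algebra each simple root $\alpha$ has one type $Tak(\mathfrak s)$, meaning that $\mathfrak g\langle\alpha\rangle$ is a central quotient of $\mathfrak{ts}$. **Generators.** Each $\mathfrak g_{\alpha_i}$ is $(1|1)$-dimensional; identify $\mathfrak g_{-\alpha_i}=\mathfrak g_{\alpha_i}^\vee$. If $\alpha_i$ has type $Tak(\mathfrak{sl}(2))$: $e_i$ even, $E_i$ odd nonzero in $\mathfrak g_{\alpha_i}$, $f_i=e_i^\vee$, $F_i=\sqrt{-1}E_i^\vee$, scaled so $\alpha_i([e_i,f_i])=2$. If $\alpha_i$ has type $Tak(\mathfrak{osp}(1|2))$ or $Tak(\mathfrak{sl}(1|1))$: $E_i$ even, $e_i$ odd nonzero, $f_i=\sqrt{-1}e_i^\vee$, $F_i=E_i^\vee$, scaled in the $\mathfrak{osp}(1|2)$ case so $\alpha_i([e_i,f_i])=1$. Put $h_i=[e_i,f_i]$, $c_i=[E_i,F_i]$, $H_i=[E_i,f_i]=[e_i,F_i]$. Matrices $X=(x_{ij})$, $Y=(y_{ij})$ are defined by $[H_i,e_j]=x_{ij}E_j$, $[H_i,E_j]=y_{ij}e_j$. $\mathcal A$ and $\mathfrak g(\mathcal A)$ are completely $X$-coupled if $x_{ij}=0$ for all $i\ne j$. **Dynkin diagram.** The Cartan matrix is $A=(a_{ij})=(\alpha_j(h_i))$.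 The Dynkin diagram has one vertex for each simple root, marked by its type, and distinct vertices $i,j$ are joined by an edge labelled $a_{ij},a_{ji}$ iff $a_{ij}a_{ji}\ne0$. **Growth.** $\mathfrak g(\mathcal A)$ is $\mathbb Z$-graded with $\mathfrak h$ in degree $0$ and $\mathfrak g_{\pm\alpha_i}$ in degree $\pm1$; writing $\mathfrak g_{(j)}$ for the degree-$j$ part, it has finite growth if $\dim\mathfrak g_{(j)}$ is bounded by a polynomial in $|j|$, and its Gelfand--Kirillov dimension is $\limsup_{N\to\infty}\log\big(\sum_{|j|\le N}\dim\mathfrak g_{(j)}\big)/\log N$. The symbols $\mathfrak q^X(A_1^{(1)})$, $\mathfrak q^X(A_2^{(2)})$, $\mathfrak q^X_\bullet(A_2^{(2)})$ are names for the completely $X$-coupled algebras with the respective diagrams. *)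

(* Defs.v *)
From HB Require Import structures.
From mathcomp Require Import all_boot all_order all_algebra.
From mathcomp Require Import all_classical all_reals all_analysis.
From mathcomp Require Export complex.

Set Implicit Arguments.
Unset Strict Implicit.
Unset Printing Implicit Defensive.

Import Order.TTheory GRing.Theory Num.Theory.
Local Open Scope classical_set_scope.
Local Open Scope ring_scope.

(* Parities are booleans: [false] is even and [true] is odd; the sum of two
   parities is [p (+) q]. *)

Section LinearAlgebra.
Variables (K : fieldType) (V : lmodType K).

Definition subspace (W : set V) : Prop :=
  W 0 /\ forall (a : K) u v, W u -> W v -> W (a *: u + v).

Definition lspan (S : set V) : set V :=
  [set v | forall W, subspace W -> S `<=` W -> W v].

Definition has_dim (W : set V) (d : nat) : Prop :=
  exists b : 'I_d -> V,
    (forall c : 'I_d -> K, \sum_i c i *: b i = 0 -> forall i, c i = 0) /\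
    W = lspan (range b).

Definition is_superspace (par : bool -> set V) : Prop :=
  [/\ forall p, subspace (par p),
      forall v, exists v0 v1, [/\ par false v0, par true v1 & v = v0 + v1]
    & forall v, par false v -> par true v -> v = 0].

Definition graded_subspace (par : bool -> set V) (W : set V) : Prop :=
  subspace W /\
  forall v, W v -> exists v0 v1,
    [/\ par false v0, par true v1, W v0, W v1 & v = v0 + v1].

End LinearAlgebra.

Definition is_linear (K : fieldType) (U V : lmodType K) (f : U -> V) : Prop :=
  forall (a : K) x y, f (a *: x + y) = a *: f x + f y.

Definition is_bilinear (K : fieldType) (U V W : lmodType K)
    (f : U -> V -> W) : Prop :=
  (forall y, is_linear (f^~ y)) /\ (forall x, is_linear (f x)).

Definition koszul (K : fieldType) (p q : bool) : K := (-1) ^+ (p && q).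

Section LieSuperalgebras.
Variables (K : fieldType) (L : lmodType K).
Variables (par : bool -> set L) (br : L -> L -> L).

Record is_lie_super : Prop := IsLieSuper {
  lie_superspace : is_superspace par;
  lie_bilinear : is_bilinear br;
  lie_parity : forall p q x y, par p x -> par q y -> par (p (+) q) (br x y);
  lie_skew : forall p q x y, par p x -> par q y ->
    br x y = - koszul K p q *: br y x;
  lie_jacobi : forall p q x y z, par p x -> par q y ->
    br x (br y z) = br (br x y) z + koszul K p q *: br y (br x z) }.

Definition is_ideal (I : set L) : Prop :=
  graded_subspace par I /\ forall x y, I y -> I (br x y).

Definition subalgebra_gen (S : set L) : set L :=
  [set v | forall W, subspace W -> (forall x y, W x -> W y -> W (br x y)) ->
    S `<=` W -> W v].

End LieSuperalgebras.

Record superspace (K : fieldType) :=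
  SuperSpace { even_part : vectType K; odd_part : vectType K }.

Definition sv_sort (K : fieldType) (V : superspace K) : vectType K :=
  (even_part V * odd_part V)%type.
Coercion sv_sort : superspace >-> Vector.type.

Definition svpar (K : fieldType) (V : superspace K) (p : bool) : set V :=
  [set v | if p then v.1 = 0 else v.2 = 0].

Record quasi_toral (K : fieldType) := QuasiToral {
  qt_space :> superspace K;
  qt_br : qt_space -> qt_space -> qt_space;
  qt_lie : is_lie_super (@svpar K qt_space) qt_br;
  qt_central : forall x y, svpar false x -> qt_br x y = 0 }.

Section Modules.
Variables (K : fieldType) (h : quasi_toral K).

Definition is_module (M : superspace K) (act : h -> M -> M) : Prop :=
  [/\ is_bilinear act,
      forall p q (x : h) (v : M),
        svpar p x -> svpar q v -> svpar (p (+) q) (act x v)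
    & forall p q (x y : h) (v : M), svpar p x -> svpar q y ->
        act (qt_br x y) v = act x (act y v) - koszul K p q *: act y (act x v)].

Record hmodule := HModule {
  hm_space :> superspace K;
  hm_act : h -> hm_space -> hm_space;
  hm_module : is_module hm_act }.

Definition is_submodule (M : hmodule) (U : set M) : Prop :=
  graded_subspace (@svpar K M) U /\ forall x v, U v -> U (hm_act x v).

Definition irreducible_module (M : hmodule) : Prop :=
  (exists v : M, v != 0) /\
  forall U : set M, is_submodule U -> (forall v, U v -> v = 0) \/ U = setT.

Definition is_pairing (M N : hmodule) (b : M -> N -> h) : Prop :=
  [/\ is_bilinear b,
      forall p q (u : M) (v : N),
        svpar p u -> svpar q v -> svpar (p (+) q) (b u v)
    & forall p q (x : h) (u : M) (v : N), svpar p x -> svpar q u ->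
        qt_br x (b u v) = b (hm_act x u) v + koszul K p q *: b u (hm_act x v)].

Definition nondegenerate_pairing (M N : hmodule) (b : M -> N -> h) : Prop :=
  (forall U : set M, is_submodule U -> (exists2 u, U u & u != 0) ->
     exists u v, U u /\ b u v != 0) /\
  (forall U : set N, is_submodule U -> (exists2 v, U v & v != 0) ->
     exists u v, U v /\ b u v != 0).

Definition form_rank (lam : 'Hom(even_part h, K^o)) : nat :=
  let b := vbasis {: odd_part h} in
  \rank (\matrix_(i, j) lam (qt_br ((0, tnth b i) : h) ((0, tnth b j) : h)).1).

(* An even isomorphism from [M] with the action [act] to [N]. *)
Definition is_module_iso (M : superspace K) (act : h -> M -> M) (N : hmodule)
    (phi : M -> N) : Prop :=
  [/\ is_linear phi, bijective phi,
      forall p v, svpar p v -> svpar p (phi v)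
    & forall x v, phi (act x v) = hm_act x (phi v)].

End Modules.

Section Vee.
Variables (K : numClosedFieldType) (h : quasi_toral K).

Definition omega (x : h) : h := (- x.1, 'i *: x.2).
Definition omega_inv (x : h) : h := (- x.1, - 'i *: x.2).

Lemma omegaK : cancel omega omega_inv.
Proof.
by case=> x y; rewrite /omega /omega_inv /= opprK scalerA mulNr -expr2 sqrCi opprK scale1r.
Qed.

Lemma omega_invK : cancel omega_inv omega.
Proof.
by case=> x y; rewrite /omega /omega_inv /= opprK scalerA mulrN -expr2 sqrCi opprK scale1r.
Qed.

(* The action on the superspace underlying M that turns it into M^vee. *)
Definition vee_act (M : hmodule h) (x : h) (v : M) : M :=
  hm_act (omega_inv x) v.

End Vee.

(* The Booleans indexing the root modules are signs: [cd_g false i] is the root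
   module of [cd_root i] and [cd_g true i] the one of [- cd_root i]. *)
Record cartan_datum (K : fieldType) := CartanDatum {
  cd_h : quasi_toral K;
  cd_n : nat;
  cd_root : 'I_cd_n -> 'Hom(even_part cd_h, K^o);
  cd_root_free : free [seq cd_root i | i <- enum 'I_cd_n];
  cd_g : bool -> 'I_cd_n -> hmodule cd_h;
  cd_weight : forall s i (t : even_part cd_h) (v : cd_g s i),
    hm_act ((t, 0) : cd_h) v = ((-1) ^+ s * cd_root i t) *: v;
  cd_br : forall i, cd_g false i -> cd_g true i -> cd_h;
  cd_pairing : forall i, is_pairing (@cd_br i);
  cd_nondeg : forall i, nondegenerate_pairing (@cd_br i) }.

Arguments cd_g {K} _ _ _.
Arguments cd_root {K} _ _.

(* Quotient of a type with operations by a congruence modulo which the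
   operations satisfy the axioms of a vector space. *)
Section VectorQuotient.
Variable K : fieldType.

Record pre_lmod := PreLmod {
  pl_sort : Type;
  pl_eq : pl_sort -> pl_sort -> Prop;
  pl_zero : pl_sort;
  pl_add : pl_sort -> pl_sort -> pl_sort;
  pl_scale : K -> pl_sort -> pl_sort;
  pl_refl : forall x, pl_eq x x;
  pl_sym : forall x y, pl_eq x y -> pl_eq y x;
  pl_trans : forall x y z, pl_eq x y -> pl_eq y z -> pl_eq x z;
  pl_congD : forall x x' y y',
    pl_eq x x' -> pl_eq y y' -> pl_eq (pl_add x y) (pl_add x' y');
  pl_congZ : forall a x x', pl_eq x x' -> pl_eq (pl_scale a x) (pl_scale a x');
  pl_addA : forall x y z,
    pl_eq (pl_add x (pl_add y z)) (pl_add (pl_add x y) z);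
  pl_addC : forall x y, pl_eq (pl_add x y) (pl_add y x);
  pl_add0 : forall x, pl_eq (pl_add pl_zero x) x;
  pl_addN : forall x, pl_eq (pl_add (pl_scale (-1) x) x) pl_zero;
  pl_scaleA : forall a b x,
    pl_eq (pl_scale a (pl_scale b x)) (pl_scale (a * b) x);
  pl_scale1 : forall x, pl_eq (pl_scale 1 x) x;
  pl_scaleDr : forall a x y,
    pl_eq (pl_scale a (pl_add x y)) (pl_add (pl_scale a x) (pl_scale a y));
  pl_scaleDl : forall a b x,
    pl_eq (pl_scale (a + b) x) (pl_add (pl_scale a x) (pl_scale b x)) }.

Variable P : pre_lmod.

Record vquot : Type := VQuot {
  vclass : set (pl_sort P);
  vclassP : exists x, vclass = pl_eq x }.

HB.instance Definition _ := gen_eqMixin vquot.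
HB.instance Definition _ := gen_choiceMixin vquot.

Definition vpi (x : pl_sort P) : vquot :=
  VQuot (ex_intro _ x erefl).

Definition vrepr (q : vquot) : pl_sort P := projT1 (cid (vclassP q)).

Lemma vclass_inj : injective vclass.
Proof.
move=> [C Cx] [D Dx] /= CD; subst D.
by congr VQuot; exact: Prop_irrelevance.
Qed.

Lemma vreprK : cancel vrepr vpi.
Proof.
move=> q; apply: vclass_inj; rewrite /vrepr.
by case: (cid _) => x /= ->.
Qed.

Lemma vpiP (x y : pl_sort P) : vpi x = vpi y <-> pl_eq x y.
Proof.
split=> [[e]|xy]; first by rewrite e; exact: pl_refl.
apply: vclass_inj; apply/funext => z; apply/propext; split=> h.
  exact: pl_trans (pl_sym xy) h.
exact: pl_trans xy h.
Qed.

Lemma vrepr_pi (x : pl_sort P) : pl_eq (vrepr (vpi x)) x.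
Proof. by apply/vpiP; rewrite vreprK. Qed.

Definition vq_add (x y : vquot) : vquot := vpi (pl_add (vrepr x) (vrepr y)).
Definition vq_scale (a : K) (x : vquot) : vquot := vpi (pl_scale a (vrepr x)).
Definition vq_zero : vquot := vpi (pl_zero P).
Definition vq_opp (x : vquot) : vquot := vq_scale (-1) x.

Lemma vpi_add x y : vpi (pl_add x y) = vq_add (vpi x) (vpi y).
Proof. by apply/vpiP/pl_congD; apply/pl_sym/vrepr_pi. Qed.

Lemma vpi_scale a x : vpi (pl_scale a x) = vq_scale a (vpi x).
Proof. by apply/vpiP/pl_congZ; apply/pl_sym/vrepr_pi. Qed.

Lemma vq_addA : associative vq_add.
Proof.
move=> x y z; rewrite -(vreprK x) -(vreprK y) -(vreprK z) -!vpi_add.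
exact/vpiP/pl_addA.
Qed.

Lemma vq_addC : commutative vq_add.
Proof.
by move=> x y; rewrite -(vreprK x) -(vreprK y) -!vpi_add; apply/vpiP/pl_addC.
Qed.

Lemma vq_add0 : left_id vq_zero vq_add.
Proof. by move=> x; rewrite -(vreprK x) -!vpi_add; apply/vpiP/pl_add0. Qed.

Lemma vq_addN : left_inverse vq_zero vq_opp vq_add.
Proof.
move=> x; rewrite -(vreprK x) /vq_opp -vpi_scale -vpi_add.
exact/vpiP/pl_addN.
Qed.

HB.instance Definition _ :=
  GRing.isZmodule.Build vquot vq_addA vq_addC vq_add0 vq_addN.

Lemma vq_scaleA a b (x : vquot) :
  vq_scale a (vq_scale b x) = vq_scale (a * b) x.
Proof. by rewrite -(vreprK x) -!vpi_scale; apply/vpiP/pl_scaleA. Qed.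

Lemma vq_scale1 : left_id 1 vq_scale.
Proof. by move=> x; rewrite -(vreprK x) -!vpi_scale; apply/vpiP/pl_scale1. Qed.

Lemma vq_scaleDr : right_distributive vq_scale +%R.
Proof.
move=> a x y; rewrite -(vreprK x) -(vreprK y).
rewrite -[_ + _]vpi_add -!vpi_scale -[_ + _]vpi_add.
exact/vpiP/pl_scaleDr.
Qed.

Lemma vq_scaleDl (x : vquot) : {morph vq_scale^~ x : a b / a + b}.
Proof.
move=> a b; rewrite -(vreprK x) -!vpi_scale -[RHS]vpi_add.
exact/vpiP/pl_scaleDl.
Qed.

HB.instance Definition _ := GRing.Zmodule_isLmodule.Build K vquot
  vq_scaleA vq_scale1 vq_scaleDr vq_scaleDl.

Lemma vpiD x y : vpi (pl_add x y) = vpi x + vpi y.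
Proof. exact: vpi_add. Qed.

Lemma vpiZ a x : vpi (pl_scale a x) = a *: vpi x.
Proof. exact: vpi_scale. Qed.

End VectorQuotient.

Section Presentation.
Variables (K : fieldType) (A : cartan_datum K).

Record realizes (L : lmodType K) (par : bool -> set L) (br : L -> L -> L)
    (ih : cd_h A -> L) (ig : forall s i, cd_g A s i -> L) : Prop := Realizes {
  rz_lie : is_lie_super par br;
  rz_h_linear : is_linear ih;
  rz_h_parity : forall p x, svpar p x -> par p (ih x);
  rz_g_linear : forall s i, is_linear (ig s i);
  rz_g_parity : forall s i p (x : cd_g A s i), svpar p x -> par p (ig s i x);
  rz_hh : forall x y, br (ih x) (ih y) = ih (qt_br x y);
  rz_hg : forall x s i (v : cd_g A s i),
    br (ih x) (ig s i v) = ig s i (hm_act x v);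
  rz_gg : forall i (u : cd_g A false i) (v : cd_g A true i),
    br (ig false i u) (ig true i v) = ih (cd_br u v);
  rz_gg0 : forall i j (u : cd_g A false i) (v : cd_g A true j),
    i != j -> br (ig false i u) (ig true j v) = 0 }.

Inductive term : Type :=
| Th of cd_h A
| Tg s i of cd_g A s i
| Tzero
| Tadd of term & term
| Tscale of K & term
| Tbr of term & term.

Inductive term_parity : bool -> term -> Prop :=
| TPh p x : svpar p x -> term_parity p (Th x)
| TPg p s i (x : cd_g A s i) : svpar p x -> term_parity p (Tg x)
| TPzero p : term_parity p Tzero
| TPadd p x y : term_parity p x -> term_parity p y -> term_parity p (Tadd x y)
| TPscale p a x : term_parity p x -> term_parity p (Tscale a x)
| TPbr p q x y : term_parity p x -> term_parity q y ->
    term_parity (p (+) q) (Tbr x y).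

Section Eval.
Variables (L : lmodType K) (br : L -> L -> L).
Variables (ih : cd_h A -> L) (ig : forall s i, cd_g A s i -> L).

Fixpoint eval (t : term) : L :=
  match t with
  | Th x => ih x
  | Tg s i x => ig x
  | Tzero => 0
  | Tadd x y => eval x + eval y
  | Tscale a x => a *: eval x
  | Tbr x y => br (eval x) (eval y)
  end.

End Eval.

(* Two terms are identified when they agree in every Lie superalgebra in which
   the generators satisfy the defining relations; [gt_realizes] and
   [gt_universal] below say that the quotient has the universal property of the
   presentation. *)
Definition term_eq (s t : term) : Prop :=
  forall (L : lmodType K) (par : bool -> set L) (br : L -> L -> L) ih ig,
    realizes par br ih ig -> eval br ih ig s = eval br ih ig t.

Fact term_eq_refl x : term_eq x x.
Proof. by []. Qed.
Fact term_eq_sym x y : term_eq x y -> term_eq y x.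
Proof. by move=> h L par br ih ig /h. Qed.
Fact term_eq_trans x y z : term_eq x y -> term_eq y z -> term_eq x z.
Proof. by move=> h k L par br ih ig r; rewrite (h _ _ _ _ _ r) (k _ _ _ _ _ r). Qed.
Fact term_eq_congD x x' y y' :
  term_eq x x' -> term_eq y y' -> term_eq (Tadd x y) (Tadd x' y').
Proof. by move=> h k L par br ih ig r /=; rewrite (h _ _ _ _ _ r) (k _ _ _ _ _ r). Qed.
Fact term_eq_congZ a x x' : term_eq x x' -> term_eq (Tscale a x) (Tscale a x').
Proof. by move=> h L par br ih ig r /=; rewrite (h _ _ _ _ _ r). Qed.
Fact term_eq_congB x x' y y' :
  term_eq x x' -> term_eq y y' -> term_eq (Tbr x y) (Tbr x' y').
Proof. by move=> h k L par br ih ig r /=; rewrite (h _ _ _ _ _ r) (k _ _ _ _ _ r). Qed.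
Fact term_eq_addA x y z : term_eq (Tadd x (Tadd y z)) (Tadd (Tadd x y) z).
Proof. by move=> L par br ih ig r /=; rewrite addrA. Qed.
Fact term_eq_addC x y : term_eq (Tadd x y) (Tadd y x).
Proof. by move=> L par br ih ig r /=; rewrite addrC. Qed.
Fact term_eq_add0 x : term_eq (Tadd Tzero x) x.
Proof. by move=> L par br ih ig r /=; rewrite add0r. Qed.
Fact term_eq_addN x : term_eq (Tadd (Tscale (-1) x) x) Tzero.
Proof. by move=> L par br ih ig r /=; rewrite scaleN1r addNr. Qed.
Fact term_eq_scaleA a b x : term_eq (Tscale a (Tscale b x)) (Tscale (a * b) x).
Proof. by move=> L par br ih ig r /=; rewrite scalerA. Qed.
Fact term_eq_scale1 x : term_eq (Tscale 1 x) x.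
Proof. by move=> L par br ih ig r /=; rewrite scale1r. Qed.
Fact term_eq_scaleDr a x y :
  term_eq (Tscale a (Tadd x y)) (Tadd (Tscale a x) (Tscale a y)).
Proof. by move=> L par br ih ig r /=; rewrite scalerDr. Qed.
Fact term_eq_scaleDl a b x :
  term_eq (Tscale (a + b) x) (Tadd (Tscale a x) (Tscale b x)).
Proof. by move=> L par br ih ig r /=; rewrite scalerDl. Qed.

Definition term_pre_lmod : pre_lmod K :=
  PreLmod term_eq_refl term_eq_sym term_eq_trans term_eq_congD term_eq_congZ
    term_eq_addA term_eq_addC term_eq_add0 term_eq_addN term_eq_scaleA
    term_eq_scale1 term_eq_scaleDr term_eq_scaleDl.

Definition gtilde : lmodType K := vquot term_pre_lmod.

Definition gt_pi (t : term) : gtilde := vpi (t : pl_sort term_pre_lmod).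
Definition gt_repr (x : gtilde) : term := vrepr x.

Definition gt_br (x y : gtilde) : gtilde := gt_pi (Tbr (gt_repr x) (gt_repr y)).

Definition gt_par (p : bool) : set gtilde :=
  [set x | exists2 t, term_parity p t & x = gt_pi t].

Definition gt_h (x : cd_h A) : gtilde := gt_pi (Th x).
Definition gt_g s i (x : cd_g A s i) : gtilde := gt_pi (Tg x).

Lemma gt_reprK : cancel gt_repr gt_pi.
Proof. exact: vreprK. Qed.

Lemma gt_piP s t : gt_pi s = gt_pi t <-> term_eq s t.
Proof. exact: (@vpiP _ term_pre_lmod). Qed.

Lemma gt_piD s t : gt_pi (Tadd s t) = gt_pi s + gt_pi t.
Proof. exact: (@vpiD _ term_pre_lmod). Qed.

Lemma gt_piZ a t : gt_pi (Tscale a t) = a *: gt_pi t.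
Proof. exact: (@vpiZ _ term_pre_lmod). Qed.

Lemma gt_pi0 : gt_pi Tzero = 0.
Proof. by []. Qed.

Lemma gt_piB s t : gt_pi (Tbr s t) = gt_br (gt_pi s) (gt_pi t).
Proof.
by apply/gt_piP/term_eq_congB; apply/gt_piP; rewrite gt_reprK.
Qed.

Lemma eval_parity (L : lmodType K) (par : bool -> set L) (br : L -> L -> L)
    ih ig p t :
  realizes par br ih ig -> term_parity p t -> par p (eval br ih ig t).
Proof.
move=> r; have [[sub _ _] _ brP _ _] := rz_lie r.
elim=> {p t} /=.
- by move=> p x /(rz_h_parity r).
- by move=> p s i x /(rz_g_parity r).
- by move=> p; case: (sub p).
- move=> p x y _ hx _ hy; case: (sub p) => _ /(_ 1 _ _ hx hy).
  by rewrite scale1r.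
- move=> p a x _ hx; case: (sub p) => h0 /(_ a _ _ hx h0).
  by rewrite addr0.
- by move=> p q x y _ hx _ hy; exact: brP.
Qed.

Lemma term_parity_decomp t : exists t0 t1,
  [/\ term_parity false t0, term_parity true t1 & term_eq t (Tadd t0 t1)].
Proof.
elim: t => [x|s i x||x [x0 [x1 [x0P x1P xE]]] y [y0 [y1 [y0P y1P yE]]]|a x [x0 [x1 [x0P x1P xE]]]|x [x0 [x1 [x0P x1P xE]]] y [y0 [y1 [y0P y1P yE]]]].
- exists (Th ((x.1, 0) : cd_h A)), (Th ((0, x.2) : cd_h A)); split; try exact: TPh.
  move=> L par br ih ig r /=.
  have := rz_h_linear r 1 ((x.1, 0) : cd_h A) ((0, x.2) : cd_h A).
  rewrite !scale1r => <-; congr (ih _).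
  by case: x => x1 x2; congr (_, _); rewrite /= ?addr0 ?add0r.
- exists (Tg ((x.1, 0) : cd_g A s i)), (Tg ((0, x.2) : cd_g A s i)); split; try exact: TPg.
  move=> L par br ih ig r /=.
  have := rz_g_linear r 1 ((x.1, 0) : cd_g A s i) ((0, x.2) : cd_g A s i).
  rewrite !scale1r => <-; congr (ig _ _ _).
  by case: x => x1 x2; congr (_, _); rewrite /= ?addr0 ?add0r.
- by exists Tzero, Tzero; split; try exact: TPzero; move=> L par br ih ig r /=; rewrite addr0.
- exists (Tadd x0 y0), (Tadd x1 y1); split; try exact: TPadd.
  move=> L par br ih ig r /=; rewrite (xE _ _ _ _ _ r) (yE _ _ _ _ _ r) /=.
  by rewrite addrACA.
- exists (Tscale a x0), (Tscale a x1); split; try exact: TPscale.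
  by move=> L par br ih ig r /=; rewrite (xE _ _ _ _ _ r) /= scalerDr.
- exists (Tadd (Tbr x0 y0) (Tbr x1 y1)), (Tadd (Tbr x0 y1) (Tbr x1 y0)); split.
  + by apply: TPadd; [exact: (TPbr x0P y0P)|exact: (TPbr x1P y1P)].
  + by apply: TPadd; [exact: (TPbr x0P y1P)|exact: (TPbr x1P y0P)].
  move=> L par br ih ig r /=; rewrite (xE _ _ _ _ _ r) (yE _ _ _ _ _ r) /=.
  have [_ [bl br'] _ _ _] := rz_lie r.
  have bD1 u v w : br (u + v) w = br u w + br v w.
    by have := bl w 1 u v; rewrite !scale1r.
  have bD2 u v w : br u (v + w) = br u v + br u w.
    by have := br' u 1 v w; rewrite !scale1r.
  by rewrite bD1 !bD2 -!addrA; congr (_ + _); rewrite addrA addrC.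
Qed.

Lemma gt_realizes : realizes gt_par gt_br gt_h gt_g.
Proof.
split.
- split.
  + split.
    * move=> p; split; first by exists Tzero; [exact: TPzero|].
      move=> a _ _ [t tP ->] [u uP ->]; exists (Tadd (Tscale a t) u).
        by apply: TPadd => //; exact: TPscale.
      by rewrite gt_piD gt_piZ.
    * move=> v; have [t0 [t1 [t0P t1P tE]]] := term_parity_decomp (gt_repr v).
      exists (gt_pi t0), (gt_pi t1); split; [by exists t0|by exists t1|].
      by rewrite -gt_piD -[LHS]gt_reprK; apply/gt_piP.
    * move=> _ [t tP ->] [u uP /gt_piP tu]; rewrite -gt_pi0; apply/gt_piP.
      move=> L par br ih ig r /=.
      have [[_ _ par0] _ _ _ _] := rz_lie r; apply: par0.
        exact: (eval_parity r tP).
      by rewrite (tu _ _ _ _ _ r); exact: (eval_parity r uP).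
  + split=> [y a x x'|x a y y'] /=.
      rewrite -(gt_reprK x) -(gt_reprK x') -(gt_reprK y) -gt_piZ -gt_piD -!gt_piB.
      rewrite -gt_piZ -gt_piD; apply/gt_piP => L par br ih ig r /=.
      by have [_ [bl _] _ _ _] := rz_lie r; exact: bl.
    rewrite -(gt_reprK x) -(gt_reprK y') -(gt_reprK y) -gt_piZ -gt_piD -!gt_piB.
    rewrite -gt_piZ -gt_piD; apply/gt_piP => L par br ih ig r /=.
    by have [_ [_ bl] _ _ _] := rz_lie r; exact: bl.
  + move=> p q _ _ [t tP ->] [u uP ->]; exists (Tbr t u); last by rewrite gt_piB.
    exact: TPbr.
  + move=> p q _ _ [t tP ->] [u uP ->]; rewrite -!gt_piB -gt_piZ.
    apply/gt_piP => L par br ih ig r /=.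
    by apply: (lie_skew (rz_lie r)); exact: (eval_parity r).
  + move=> p q _ _ z [t tP ->] [u uP ->]; rewrite -(gt_reprK z) -!gt_piB.
    rewrite -gt_piZ -gt_piD.
    apply/gt_piP => L par br ih ig r /=.
    by apply: (lie_jacobi (rz_lie r)); exact: (eval_parity r).
- move=> a x y; rewrite /gt_h -gt_piZ -gt_piD.
  by apply/gt_piP => L par br ih ig r /=; exact: (rz_h_linear r).
- by move=> p x xP; exists (Th x) => //; exact: TPh.
- move=> s i a x y; rewrite /gt_g -gt_piZ -gt_piD.
  by apply/gt_piP => L par br ih ig r /=; exact: (rz_g_linear r).
- by move=> s i p x xP; exists (Tg x) => //; exact: TPg.
- move=> x y; rewrite /gt_h -gt_piB.
  by apply/gt_piP => L par br ih ig r /=; exact: (rz_hh r).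
- move=> x s i v; rewrite /gt_h /gt_g -gt_piB.
  by apply/gt_piP => L par br ih ig r /=; exact: (rz_hg r).
- move=> i u v; rewrite /gt_h /gt_g -gt_piB.
  by apply/gt_piP => L par br ih ig r /=; exact: (rz_gg r).
- move=> i j u v ij; rewrite /gt_g -gt_piB -gt_pi0.
  by apply/gt_piP => L par br ih ig r /=; exact: (rz_gg0 r).
Qed.

Lemma gt_universal (L : lmodType K) (par : bool -> set L) (br : L -> L -> L)
    ih ig : realizes par br ih ig ->
  exists! phi : gtilde -> L,
    [/\ is_linear phi, forall x y, phi (gt_br x y) = br (phi x) (phi y),
        forall x, phi (gt_h x) = ih x
      & forall s i (v : cd_g A s i), phi (gt_g v) = ig s i v].
Proof.
move=> r; have piE t : eval br ih ig (gt_repr (gt_pi t)) = eval br ih ig t.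
  have: term_eq (gt_repr (gt_pi t)) t by apply/gt_piP; rewrite gt_reprK.
  by move/(_ _ _ _ _ _ r).
exists (fun x => eval br ih ig (gt_repr x)); split.
  split=> [a x y|x y|x|s i v].
  - rewrite -{1}(gt_reprK x) -{1}(gt_reprK y) -gt_piZ -gt_piD.
    exact: (piE (Tadd (Tscale a (gt_repr x)) (gt_repr y))).
  - exact: (piE (Tbr (gt_repr x) (gt_repr y))).
  - exact: (piE (Th x)).
  - exact: (piE (Tg v)).
move=> phi [phiD phiB phih phig]; apply/funext => x.
have phi0 : phi 0 = 0.
  have := phiD (-1) 0 0; rewrite scaler0 addr0 scaleN1r => ->.
  by rewrite addNr.
rewrite -{2}(gt_reprK x); elim: (gt_repr x) => //=.
- by move=> y; rewrite -phih.
- by move=> s i v; rewrite -phig.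
- by move=> t tE u uE; rewrite gt_piD -[gt_pi t]scale1r phiD !scale1r tE uE.
- by move=> a t tE; rewrite gt_piZ -[X in phi X]addr0 phiD phi0 addr0 tE.
- by move=> t tE u uE; rewrite gt_piB phiB tE uE.
Qed.

Definition trivial_on_h (I : set gtilde) : Prop :=
  forall x, I (gt_h x) -> gt_h x = 0.

(* The sum of all ideals meeting the image of [cd_h A] trivially; since it meets
   that image trivially itself, it is the unique maximal such ideal. *)
Definition max_ideal : set gtilde :=
  lspan (\bigcup_(I in [set I | is_ideal gt_par gt_br I /\ trivial_on_h I]) I).

Lemma lspan_subspace (V : lmodType K) (S : set V) : subspace (lspan S).
Proof.
split=> [W [W0 _] _ //|a u v hu hv W sW SW].
by case: (sW) => _; apply; [exact: hu|exact: hv].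
Qed.

Lemma max_ideal_ideal : is_ideal gt_par gt_br max_ideal.
Proof.
have sM : subspace max_ideal := lspan_subspace _.
have [_ [_ brr] _ _ _] := rz_lie gt_realizes.
split; last first.
  move=> x y My; apply: (My [set z | max_ideal (gt_br x z)]).
    split.
      have /= := brr x (-1) 0 0; rewrite scaler0 addr0 scaleN1r addNr => ->.
      by case: sM.
    by move=> a u v /= hu hv; rewrite brr; case: sM => _; exact.
  move=> z [I [iI tI] Iz] W sW SW; apply: SW.
  by exists I => //; case: iI => _; exact.
split=> // v Mv; apply: (Mv [set z | exists v0 v1, [/\ gt_par false v0,
  gt_par true v1, max_ideal v0, max_ideal v1 & z = v0 + v1]]).
  have [[sub _ _] _ _ _ _] := rz_lie gt_realizes.
  split.
    exists 0, 0; split; rewrite ?addr0 //; try by case: sM.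
      by case: (sub false).
    by case: (sub true).
  move=> a u w [u0 [u1 [u0P u1P Mu0 Mu1 ->]]] [w0 [w1 [w0P w1P Mw0 Mw1 ->]]].
  exists (a *: u0 + w0), (a *: u1 + w1); split.
  - by case: (sub false) => _; exact.
  - by case: (sub true) => _; exact.
  - by case: sM => _; exact.
  - by case: sM => _; exact.
  - by rewrite scalerDr addrACA.
move=> z [I [iI tI] Iz]; case: (iI) => -[_ /(_ _ Iz)].
move=> [z0 [z1 [z0P z1P Iz0 Iz1 zE]]] _; exists z0, z1; split=> //.
  by move=> W _; apply; exists I.
by move=> W _; apply; exists I.
Qed.

Definition max_eq (x y : gtilde) : Prop := max_ideal (x - y).

Let maxS : subspace max_ideal := lspan_subspace _.
Let max0 : max_ideal 0.
Proof. by case: maxS. Qed.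
Let maxD x y : max_ideal x -> max_ideal y -> max_ideal (x + y).
Proof. by case: maxS => _ h hx /(h 1 _ _ hx); rewrite scale1r. Qed.
Let maxZ a x : max_ideal x -> max_ideal (a *: x).
Proof. by case: maxS => _ h hx; have := h a _ _ hx max0; rewrite addr0. Qed.
Let maxE x y : x = y -> max_eq x y.
Proof. by move=> ->; rewrite /max_eq subrr. Qed.

Fact max_eq_refl x : max_eq x x.
Proof. exact: maxE. Qed.
Fact max_eq_sym x y : max_eq x y -> max_eq y x.
Proof. by move/(maxZ (-1)); rewrite scaleN1r opprB. Qed.
Fact max_eq_trans x y z : max_eq x y -> max_eq y z -> max_eq x z.
Proof. by move=> xy yz; have := maxD xy yz; rewrite addrA subrK. Qed.
Fact max_eq_congD x x' y y' :
  max_eq x x' -> max_eq y y' -> max_eq (x + y) (x' + y').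
Proof. by move=> xx yy; have := maxD xx yy; rewrite /max_eq opprD addrACA. Qed.
Fact max_eq_congZ a x x' : max_eq x x' -> max_eq (a *: x) (a *: x').
Proof. by move/(maxZ a); rewrite scalerBr. Qed.
Fact max_eq_addA x y z : max_eq (x + (y + z)) (x + y + z).
Proof. by apply: maxE; rewrite addrA. Qed.
Fact max_eq_addC x y : max_eq (x + y) (y + x).
Proof. by apply: maxE; rewrite addrC. Qed.
Fact max_eq_add0 x : max_eq (0 + x) x.
Proof. by apply: maxE; rewrite add0r. Qed.
Fact max_eq_addN x : max_eq (-1 *: x + x) 0.
Proof. by apply: maxE; rewrite scaleN1r addNr. Qed.
Fact max_eq_scaleA a b x : max_eq (a *: (b *: x)) ((a * b) *: x).
Proof. by apply: maxE; rewrite scalerA. Qed.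
Fact max_eq_scale1 x : max_eq (1 *: x) x.
Proof. by apply: maxE; rewrite scale1r. Qed.
Fact max_eq_scaleDr a x y : max_eq (a *: (x + y)) (a *: x + a *: y).
Proof. by apply: maxE; rewrite scalerDr. Qed.
Fact max_eq_scaleDl a b x : max_eq ((a + b) *: x) (a *: x + b *: x).
Proof. by apply: maxE; rewrite scalerDl. Qed.

Definition max_pre_lmod : pre_lmod K :=
  PreLmod max_eq_refl max_eq_sym max_eq_trans max_eq_congD max_eq_congZ
    max_eq_addA max_eq_addC max_eq_add0 max_eq_addN max_eq_scaleA
    max_eq_scale1 max_eq_scaleDr max_eq_scaleDl.

Definition galg : lmodType K := vquot max_pre_lmod.

Definition g_pi (x : gtilde) : galg := vpi (x : pl_sort max_pre_lmod).
Definition g_repr (x : galg) : gtilde := vrepr x.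

Definition g_br (x y : galg) : galg := g_pi (gt_br (g_repr x) (g_repr y)).
Definition g_par (p : bool) : set galg := g_pi @` gt_par p.
Definition g_h (x : cd_h A) : galg := g_pi (gt_h x).
Definition g_g s i (x : cd_g A s i) : galg := g_pi (gt_g x).

Lemma g_reprK : cancel g_repr g_pi.
Proof. exact: vreprK. Qed.

Lemma g_piP x y : g_pi x = g_pi y <-> max_ideal (x - y).
Proof. exact: (@vpiP _ max_pre_lmod). Qed.

Lemma g_pi_linear : is_linear g_pi.
Proof.
move=> a x y; rewrite -[a *: g_pi x](@vpiZ _ max_pre_lmod).
by rewrite -[RHS](@vpiD _ max_pre_lmod).
Qed.

Lemma g_piB x y : g_pi (gt_br x y) = g_br (g_pi x) (g_pi y).
Proof.
have [[_ [brl brr] brP skew _] _ _ _ _ _ _ _ _] := gt_realizes.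
have [[[M0 Ml] Mg] Mi] := max_ideal_ideal.
have brDl u v w : gt_br (u - v) w = gt_br u w - gt_br v w.
  by have /= := brl w (-1) v u; rewrite !scaleN1r ![- _ + _]addrC.
have brDr u v w : gt_br w (u - v) = gt_br w u - gt_br w v.
  by have /= := brr w (-1) v u; rewrite !scaleN1r ![- _ + _]addrC.
have rM z : max_ideal (z - g_repr (g_pi z)) by apply/g_piP; rewrite g_reprK.
have Mr u v : max_ideal u -> max_ideal (gt_br u v).
  move=> /Mg [u0 [u1 [u0P u1P Mu0 Mu1 ->]]].
  have [[_ dec _] _ _ _ _] := rz_lie gt_realizes.
  have [v0 [v1 [v0P v1P ->]]] := dec v.
  have bD1 a b c : gt_br (a + b) c = gt_br a c + gt_br b c.
    by have /= := brl c 1 a b; rewrite !scale1r.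
  have bD2 a b c : gt_br a (b + c) = gt_br a b + gt_br a c.
    by have /= := brr a 1 b c; rewrite !scale1r.
  rewrite bD1 !bD2 (skew _ _ _ _ u0P v0P) (skew _ _ _ _ u0P v1P).
  rewrite (skew _ _ _ _ u1P v0P) (skew _ _ _ _ u1P v1P).
  by do 2?apply: maxD; apply: maxZ; apply: Mi.
apply/g_piP.
have -> : gt_br x y - gt_br (g_repr (g_pi x)) (g_repr (g_pi y)) =
   gt_br (x - g_repr (g_pi x)) y + gt_br (g_repr (g_pi x)) (y - g_repr (g_pi y)).
  by rewrite brDl brDr addrA subrK.
by apply: maxD; [exact: Mr|exact: Mi].
Qed.

Lemma g_realizes : realizes g_par g_br g_h g_g.
Proof.
have [lie hl hp gl gp hh hg gg gg0] := gt_realizes.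
have [[sub dec dis] [brl brr] brP skew jac] := lie.
have piZ a x : g_pi (a *: x) = a *: g_pi x by exact: (@vpiZ _ max_pre_lmod).
have piD x y : g_pi (x + y) = g_pi x + g_pi y by exact: (@vpiD _ max_pre_lmod).
have pi0 : g_pi 0 = 0 by [].
split.
- split.
  + split.
    * move=> p; split; first by exists 0 => //; case: (sub p).
      move=> a _ _ [t tP <-] [u uP <-]; exists (a *: t + u).
        by case: (sub p) => _; exact.
      by rewrite g_pi_linear.
    * move=> v; have [t0 [t1 [t0P t1P tE]]] := dec (g_repr v).
      exists (g_pi t0), (g_pi t1); split; [by exists t0|by exists t1|].
      by rewrite -piD -tE g_reprK.
    * move=> _ [t tP <-] [u uP /g_piP]; have [[_ Mg] _] := max_ideal_ideal.
      move=> /Mg [w0 [w1 [w0P w1P Mw0 Mw1 utE]]].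
      rewrite -pi0; apply/g_piP; rewrite subr0.
      suff <- : - w0 = t by rewrite -scaleN1r; exact: maxZ.
      apply/eqP; rewrite -subr_eq0 -opprD oppr_eq0; apply/eqP; apply: dis.
        by case: (sub false) => _ /(_ 1 _ _ w0P tP); rewrite scale1r.
      have -> : w0 + t = -1 *: w1 + u.
        by rewrite scaleN1r -[u](subrK t) utE [RHS]addrA [- w1 + _]addrCA addNr addr0.
      by case: (sub true) => _; exact.
  + split=> [y a x x'|x a y y'] /=.
      rewrite -(g_reprK x) -(g_reprK x') -(g_reprK y) -g_pi_linear -!g_piB.
      by rewrite -g_pi_linear brl.
    rewrite -(g_reprK x) -(g_reprK y') -(g_reprK y) -g_pi_linear -!g_piB.
    by rewrite -g_pi_linear brr.
  + move=> p q _ _ [t tP <-] [u uP <-]; exists (gt_br t u); last by rewrite g_piB.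
    exact: brP.
  + move=> p q _ _ [t tP <-] [u uP <-]; rewrite -!g_piB -piZ.
    by rewrite (skew _ _ _ _ tP uP).
  + move=> p q _ _ z [t tP <-] [u uP <-]; rewrite -(g_reprK z) -!g_piB.
    by rewrite -piZ -piD -jac.
- by move=> a x y; rewrite /g_h hl g_pi_linear.
- by move=> p x /hp xP; exists (gt_h x).
- by move=> s i a x y; rewrite /g_g gl g_pi_linear.
- by move=> s i p x /gp xP; exists (gt_g x).
- by move=> x y; rewrite /g_h -g_piB hh.
- by move=> x s i v; rewrite /g_h /g_g -g_piB hg.
- by move=> i u v; rewrite /g_h /g_g -g_piB gg.
- by move=> i j u v ij; rewrite /g_g -g_piB gg0.
Qed.

Inductive monomial : int -> galg -> Prop :=
| mono_h x : monomial 0 (g_h x)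
| mono_g s i (x : cd_g A s i) : monomial ((-1) ^+ s) (g_g x)
| mono_br j k x y : monomial j x -> monomial k y -> monomial (j + k) (g_br x y).

Definition degree_part (j : int) : set galg := lspan (monomial j).

Definition g_sub (i : 'I_(cd_n A)) : set galg :=
  subalgebra_gen g_br (range (@g_g false i) `|` range (@g_g true i)).

End Presentation.

Section Takiff.
Variables (K : fieldType) (m n : nat).

(* gl(m|n): the first m basis vectors are even and the last n are odd. *)
Definition smx_part (p : bool) (x : 'M[K]_(m + n)) : 'M[K]_(m + n) :=
  if p then block_mx 0 (ursubmx x) (dlsubmx x) 0
  else block_mx (ulsubmx x) 0 0 (drsubmx x).

Definition smx_sign (x : 'M[K]_(m + n)) : 'M[K]_(m + n) :=
  smx_part false x - smx_part true x.

Definition supercomm (x y : 'M[K]_(m + n)) : 'M[K]_(m + n) :=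
  \sum_(p : bool) \sum_(q : bool)
    (smx_part p x *m smx_part q y
     - koszul K p q *: (smx_part q y *m smx_part p x)).

Definition supertrace (x : 'M[K]_(m + n)) : K :=
  \tr (ulsubmx x) - \tr (drsubmx x).

Definition sl_super : set 'M[K]_(m + n) := [set x | supertrace x = 0].

(* The triple (x, y, z) stands for x (x) 1 + y (x) xi + z c. *)
Definition takiff_space : lmodType K :=
  ('M[K]_(m + n) * 'M[K]_(m + n) * K^o)%type.

Definition takiff_par (p : bool) : set takiff_space :=
  [set u | [/\ smx_part p u.1.1 = u.1.1, smx_part (~~ p) u.1.2 = u.1.2
             & p -> u.2 = 0]].

(* The general formula gives [x (x) 1, y (x) xi] = [x, y] (x) xi,
   [x (x) xi, y (x) 1] = (-1)^y [x, y] (x) xi and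
   [x (x) xi, y (x) xi] = (-1)^y (x, y) c with (x, y) = str (x y). *)
Definition takiff_br (u v : takiff_space) : takiff_space :=
  (supercomm u.1.1 v.1.1,
   supercomm u.1.1 v.1.2 + supercomm u.1.2 (smx_sign v.1.1),
   supertrace (u.1.2 *m smx_sign v.1.2) : K^o).

Definition takiff (s : set 'M[K]_(m + n)) : set takiff_space :=
  [set u | s u.1.1 /\ s u.1.2].

Definition is_central_quotient (s : set 'M[K]_(m + n)) (L : lmodType K)
    (par : bool -> set L) (br : L -> L -> L) (W : set L) : Prop :=
  exists phi : takiff_space -> L,
    [/\ is_linear phi,
        forall p u, takiff s u -> takiff_par p u -> par p (phi u),
        forall u v, takiff s u -> takiff s v ->
          phi (takiff_br u v) = br (phi u) (phi v),
        phi @` takiff s = W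
      & forall u, takiff s u -> phi u = 0 ->
          forall v, takiff s v -> takiff_br u v = 0].

End Takiff.

(* osp(1|2) inside gl(1|2): the matrices preserving, in the super sense, the
   even form with Gram matrix [osp12_form]. *)
Definition osp12_form (K : fieldType) : 'M[K]_(1 + 2) :=
  block_mx 1%:M 0 0
    (\matrix_(i, j) (if (i < j)%N then 1 else if (j < i)%N then -1 else 0)).

Definition scol_part (K : fieldType) (p : bool) (u : 'cV[K]_(1 + 2)) :
    'cV[K]_(1 + 2) :=
  if p then col_mx 0 (dsubmx u) else col_mx (usubmx u) 0.

Definition osp12 (K : fieldType) : set 'M[K]_(1 + 2) :=
  [set x | forall p q (u v : 'cV[K]_(1 + 2)),
    (smx_part p x *m scol_part q u)^T *m osp12_form K *m v
    + koszul K p q *: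
        ((scol_part q u)^T *m osp12_form K *m (smx_part p x *m v)) = 0].

Inductive tak_type := Tak_sl2 | Tak_osp12 | Tak_sl11.

Section QKM.
Variables (K : numClosedFieldType) (A : cartan_datum K).
Local Notation n := (cd_n A).

Definition h_root (i : 'I_n) : set (cd_h A) :=
  lspan [set z | exists u v, z = @cd_br K A i u v].

(* [h_alpha, g_beta] = 0; brackets of h with a root module are the action. *)
Definition h_root_kills (i j : 'I_n) : Prop :=
  forall x (v : cd_g A false j), h_root i x -> hm_act x v = 0.

Definition KM1 : Prop :=
  forall s i s' j, exists N : nat,
    forall (xs : seq (cd_g A s i)) (y : cd_g A s' j), size xs = N ->
      foldr (fun x z => g_br (g_g x) z) (g_g y) xs = 0.

Definition KM2 : Prop := forall i j, h_root_kills i j -> h_root_kills j i.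

Definition KM3 : Prop := forall i, form_rank (cd_root A i) = 2%N.

Definition KM4 : Prop := forall i,
  irreducible_module (cd_g A false i) /\
  exists phi, is_module_iso (@vee_act K (cd_h A) (cd_g A false i))
                (N := cd_g A true i) phi.

Definition KM5 : Prop := forall i,
  ~ (h_root i `<=` lspan (\bigcup_(j in [set j | j != i]) h_root j)).

Definition QKM : Prop := [/\ KM1, KM2, KM3, KM4 & KM5].

Definition indecomposable : Prop :=
  ~ exists S : {set 'I_n}, [/\ S != finset.set0, S != finset.setT
    & forall i j, i \in S -> j \notin S ->
        h_root_kills i j /\ h_root_kills j i].

Definition has_type (i : 'I_n) (ty : tak_type) : Prop :=
  let quot_of m k s := @is_central_quotient K m k s (galg A) (@g_par K A)
                         (@g_br K A) (g_sub i) in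
  match ty with
  | Tak_sl2 => quot_of 2 0 (@sl_super K 2 0)
  | Tak_osp12 => quot_of 1 2 (@osp12 K)
  | Tak_sl11 => quot_of 1 1 (@sl_super K 1 1)
  end.

Definition e_parity (ty : tak_type) : bool :=
  if ty is Tak_sl2 then false else true.

Definition e_scale (ty : tak_type) : K := if e_parity ty then 'i else 1.
Definition E_scale (ty : tak_type) : K := if e_parity ty then 1 else 'i.

(* [gen_vee] is the identification of g_alpha^vee with g_{- alpha}. *)
Record generators := Generators {
  gen_type : 'I_n -> tak_type;
  gen_typeP : forall i, has_type i (gen_type i);
  gen_vee : forall i, cd_g A false i -> cd_g A true i;
  gen_veeP : forall i,
    is_module_iso (@vee_act K (cd_h A) (cd_g A false i)) (@gen_vee i);
  gen_e : forall i, cd_g A false i;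
  gen_E : forall i, cd_g A false i;
  gen_e_parity : forall i, svpar (e_parity (gen_type i)) (gen_e i);
  gen_E_parity : forall i, svpar (~~ e_parity (gen_type i)) (gen_E i);
  gen_e_neq0 : forall i, gen_e i != 0;
  gen_E_neq0 : forall i, gen_E i != 0;
  gen_scaled : forall i,
    let h := cd_br (gen_e i)
               (gen_vee (e_scale (gen_type i) *: gen_e i)) in
    match gen_type i with
    | Tak_sl2 => cd_root A i h.1 = 2
    | Tak_osp12 => cd_root A i h.1 = 1
    | Tak_sl11 => True
    end }.

Variable G : generators.

Definition gen_f i : cd_g A true i :=
  gen_vee G (e_scale (gen_type G i) *: gen_e G i).
Definition gen_F i : cd_g A true i :=
  gen_vee G (E_scale (gen_type G i) *: gen_E G i).

Definition gen_h i : cd_h A := cd_br (gen_e G i) (gen_f i).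
Definition gen_c i : cd_h A := cd_br (gen_E G i) (gen_F i).
(* This is also [cd_br (gen_e G i) (gen_F i)], by equivariance of the pairing. *)
Definition gen_H i : cd_h A := cd_br (gen_E G i) (gen_f i).

Definition is_X_matrix (X : 'M[K]_n) : Prop :=
  forall i j, hm_act (gen_H i) (gen_e G j) = X i j *: gen_E G j.

Definition completely_X_coupled : Prop :=
  exists2 X, is_X_matrix X & forall i j, i != j -> X i j = 0.

Definition cartan_matrix : 'M[K]_n :=
  \matrix_(i, j) cd_root A j (gen_h i).1.

End QKM.

(* [d_edge i j = Some (a, b)] is an edge between i and j with labels a_ij = a
   and a_ji = b; it is None when i and j are not joined. *)
Record diagram (K : Type) := Diagram {
  d_size : nat;
  d_type : 'I_d_size -> tak_type;
  d_edge : 'I_d_size -> 'I_d_size -> option (K * K) }.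

Definition diagram_iso (K : Type) (D D' : diagram K) : Prop :=
  exists f : 'I_(d_size D) -> 'I_(d_size D'),
    [/\ bijective f, forall i, d_type (f i) = d_type i
      & forall i j, d_edge (f i) (f j) = d_edge i j].

Definition dynkin_diagram (K : numClosedFieldType) (A : cartan_datum K)
    (G : generators A) : diagram K :=
  let a := cartan_matrix G in
  @Diagram K (cd_n A) (gen_type G)
    (fun i j => if (i != j) && (a i j * a j i != 0) then Some (a i j, a j i)
                else None).

(* Vertices 1 and 2 are [ord0] and [ord_max] of 'I_2. *)
Definition diagram2 (K : Type) (t1 t2 : tak_type) (a12 a21 : K) : diagram K :=
  @Diagram K 2 (fun i => if i == ord0 then t1 else t2)
    (fun i j => if i == j then None
                else if i == ord0 then Some (a12, a21) else Some (a21, a12)).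

Definition qX_A11 (K : fieldType) : diagram K :=
  diagram2 Tak_sl2 Tak_sl2 (-2) (-2).
Definition qX_A22 (K : fieldType) : diagram K :=
  diagram2 Tak_sl2 Tak_sl2 (-4) (-1).
Definition qX_bullet_A22 (K : fieldType) : diagram K :=
  diagram2 Tak_sl2 Tak_osp12 (-2) (-1).

Section Growth.
Variables (R : realType) (A : cartan_datum R[i]).

Definition finite_growth : Prop :=
  exists p : {poly R}, forall j : int,
    exists2 d : nat, has_dim (@degree_part _ A j) d & d%:R <= p.[`|j|%N%:R].

Definition has_GK_dim (x : \bar R) : Prop :=
  exists d : int -> nat,
    (forall j, has_dim (@degree_part _ A j) (d j)) /\
    limn_esup (fun N : nat =>
      (ln (\sum_(k < (2 * N).+1) d (k%:Z - N%:Z)%R)%N%:R / ln N%:R)%:E) = x.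

End Growth.

(* Main.v *)
From mathcomp Require Import all_boot all_order all_algebra.
From mathcomp Require Import all_classical all_reals all_analysis.
From mathcomp Require Import ring lra zify.
Require Import Defs.

Set Implicit Arguments.
Unset Strict Implicit.
Unset Printing Implicit Defensive.

Import Order.TTheory GRing.Theory Num.Theory.
Import numFieldNormedType.Exports.
Local Open Scope classical_set_scope.
Local Open Scope ring_scope.

(** Let h act on g_{alpha_i} = <e_i, E_i> by x e_i = r_i(x) E_i and
    x E_i = s_i(x) e_i for odd x, and put c_i = [E_i, F_i].  Equivariance of the
    pairings gives [x, H_i] = s_i(x) h_i + r_i(x) c_i, so evaluating alpha_j
      s_i a_ij + r_i alpha_j(c_i) = s_j x_ij + r_j y_ij
    on odd elements of h, where r_i and s_i are linearly independent because
    alpha_i has rank 2.  If x_ij = 0 for i <> j, evaluation at the H_k shows that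
    Tak(sl(1|1)) vertices are isolated (this also uses (KM2) and a Heisenberg
    argument), that a_ij a_ji = a_ii a_jj for coupled vertices, and that there are
    no three connected vertices.  The vector [E_i, e_j] is killed by f_i and is
    not killed by f_j, hence -(a_ii + a_ij) is a natural number by integrability;
    in type Tak(osp(1|2)) it even has to be positive, since
    [f_j, [e_i, [E_i, e_j]]] is a nonzero multiple of [e_i, E_i] <> 0.  Only two
    Tak(sl(2)) vertices with a_12 = a_21 = -2 satisfy these constraints, so the
    first diagram is the only one that occurs.

    For the growth, let G(k, l) be the component of degree k alpha_1 + l alpha_2.
    If k > l then ad(f_1)^(2(k - l)) embeds G(k, l) into the reflected component,
    so by descent G(k, l) is zero when k - l >= 2 and has dimension at most 2 when
    k - l = 1.  A vector of G(k, k) killed by f_1, F_1, f_2, F_2 generates an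
    ideal meeting h trivially, so dim G(k, k) <= 8.  No degree vanishes, because
    sl(2)-theory shows that a vector of top degree would be killed by all lowering
    operators. *)

(** * Linear algebra *)

(** Vanishing in g(A) is tested by one criterion: a combination of words of one sign that is killed
    by all generators of the opposite sign generates an ideal meeting h trivially. Degrees are
    eigenvalues of ad(t0), where alpha_i(t0) = 1 for all i; such a t0 exists because the simple
    roots are linearly independent. Nonvanishing needs a separate source, since the presentation
    alone does not show that a generator survives in the quotient: that e_i and E_i are nonzero is
    read off the type, because the odd part of ts stays at least two-dimensional in every central
    quotient. The relation a_ij a_ji = a_ii a_jj alone would admit the labels -4, -1 between two
    Tak(sl(2)) vertices, and -2, -1 from a Tak(sl(2)) vertex to a Tak(osp(1|2)) vertex. Both fail
    against the lowest weight vector [E_2, e_1] of weight a_22 + a_21: the weight is 2 - 1 > 0 in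
    the first case, and 1 - 1 = 0 in the second, where it has to be negative. *)

Section LinearAlgebra.
Variables (K : fieldType) (V : lmodType K).
Implicit Types (W S : set V) (s : seq V).

Lemma subspace0 W : subspace W -> W 0.
Proof. by case. Qed.

Lemma subspaceD W u v : subspace W -> W u -> W v -> W (u + v).
Proof. by case=> _ h hu /(h 1 _ _ hu); rewrite scale1r. Qed.

Lemma subspaceZ W a u : subspace W -> W u -> W (a *: u).
Proof. by case=> h0 h hu; have := h a _ _ hu h0; rewrite addr0. Qed.

Lemma subspaceN W u : subspace W -> W u -> W (- u).
Proof. by rewrite -scaleN1r; exact: subspaceZ. Qed.

Lemma subspaceB W u v : subspace W -> W u -> W v -> W (u - v).
Proof. by move=> sW Wu Wv; apply: subspaceD => //; exact: subspaceN. Qed.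

Lemma subspace_sum (I : Type) (r : seq I) (P : pred I) (F : I -> V) W :
  subspace W -> (forall i, P i -> W (F i)) -> W (\sum_(i <- r | P i) F i).
Proof.
move=> sW WF; elim/big_ind: _ => //; first exact: subspace0.
by move=> *; exact: subspaceD.
Qed.

Lemma subspace_zero : subspace [set (0 : V)].
Proof. by split=> // a u v /= -> ->; rewrite scaler0 addr0. Qed.

Lemma subspaceI W1 W2 : subspace W1 -> subspace W2 -> subspace (W1 `&` W2).
Proof.
move=> [h0 h] [k0 k]; split=> // a u v [u1 u2] [v1 v2].
by split; [exact: h|exact: k].
Qed.

Lemma sub_lspan S : S `<=` lspan S.
Proof. by move=> v Sv W _; exact. Qed.

Lemma lspan_sub S W : subspace W -> S `<=` W -> lspan S `<=` W.
Proof. by move=> sW SW v; exact. Qed.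

Lemma lspan_mono S1 S2 : S1 `<=` S2 -> lspan S1 `<=` lspan S2.
Proof.
move=> h; apply: lspan_sub; first exact: lspan_subspace.
exact: subset_trans h (@sub_lspan _).
Qed.

Lemma lspan_cons a s v : lspan [set` a :: s] v ->
  exists x u, lspan [set` s] u /\ v = x *: a + u.
Proof.
apply: (lspan_sub (W := [set v | exists x u, lspan [set` s] u /\ v = x *: a + u])).
  have sS := lspan_subspace [set` s]; split.
    by exists 0, 0; rewrite scale0r addr0; split=> //; exact: subspace0.
  move=> b _ _ [x [u [hu ->]]] [y [w [hw ->]]].
  exists (b * x + y), (b *: u + w); split; first by case: sS => _; exact.
  by rewrite scalerDl scalerDr scalerA addrACA.
move=> w /=; rewrite in_cons => /orP[/eqP ->|ws].
  exists 1, 0; rewrite scale1r addr0; split=> //.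
  by apply: subspace0; exact: lspan_subspace.
by exists 0, w; rewrite scale0r add0r; split=> //; apply: sub_lspan.
Qed.

Lemma lspan_nil v : lspan [set` ([::] : seq V)] v -> v = 0.
Proof. by apply: (lspan_sub subspace_zero). Qed.

Lemma lspan_range d (b : 'I_d -> V) v : lspan (range b) v ->
  exists c : 'I_d -> K, v = \sum_i c i *: b i.
Proof.
apply: (lspan_sub (W := [set v | exists c : 'I_d -> K, v = \sum_i c i *: b i])).
  split; first by exists (fun=> 0); rewrite big1 // => i _; rewrite scale0r.
  move=> a _ _ [c ->] [c' ->]; exists (fun i => a * c i + c' i).
  rewrite scaler_sumr -big_split; apply: eq_bigr => i _ /=.
  by rewrite scalerDl scalerA.
move=> _ [i _ <-]; exists (fun k => (k == i)%:R).
rewrite (bigD1 i) //= eqxx scale1r big1 ?addr0 // => k /negPf ->.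
by rewrite scale0r.
Qed.

(** Only an upper bound on the dimension, for an arbitrary set [W], so that bounds pass to subsets
    and add up without choosing bases; [spanned_has_dim] turns a bound into an actual dimension. *)
Definition spanned W d :=
  exists2 s : seq V, (size s <= d)%N & W `<=` lspan [set` s].

Lemma spanned_sub W1 W2 d : W1 `<=` W2 -> spanned W2 d -> spanned W1 d.
Proof. by move=> h [s ss hs]; exists s => //; exact: subset_trans h hs. Qed.

Lemma spanned_le W d d' : (d <= d')%N -> spanned W d -> spanned W d'.
Proof. by move=> le [s ss hs]; exists s => //; exact: leq_trans le. Qed.

Lemma spanned0 W : (forall v, W v -> v = 0) -> spanned W 0.
Proof.
move=> h; exists [::] => // v /h ->.
by apply: subspace0; exact: lspan_subspace.
Qed.

Lemma spanned_lspanU S1 S2 a b : spanned S1 a -> spanned S2 b ->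
  spanned (lspan (S1 `|` S2)) (a + b).
Proof.
move=> [s1 z1 h1] [s2 z2 h2]; exists (s1 ++ s2); first by rewrite size_cat leq_add.
apply: lspan_sub; first exact: lspan_subspace.
move=> v [/h1|/h2]; apply: lspan_mono => w /= ws; rewrite mem_cat ws ?orbT //.
Qed.

(** The line through [w] is a complement of [W1] in [W], so [w] extends any basis of [W1]; it is put
    in the last position to match [big_ord_recr]. *)
Lemma has_dim_add W W1 w d : subspace W -> W1 `<=` W -> W w -> ~ W1 w ->
  (forall v, W v -> exists x, W1 (v - x *: w)) ->
  has_dim W1 d -> has_dim W d.+1.
Proof.
move=> sW W1W Ww nW1w dec [b [bfree W1E]].
have sW1 : subspace W1 by rewrite W1E; exact: lspan_subspace.
pose b' (i : 'I_d.+1) := if unlift ord_max i is Some j then b j else w.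
have b'l j : b' (widen_ord (leqnSn d) j) = b j.
  rewrite /b'; have -> : widen_ord (leqnSn d) j = lift ord_max j.
    by apply: val_inj; rewrite /= /bump leqNgt ltn_ord.
  by rewrite liftK.
have b'm : b' ord_max = w by rewrite /b' unlift_none.
have W1b j : W1 (b j) by rewrite W1E; apply: sub_lspan; exists j.
exists b'; split.
  move=> c; rewrite big_ord_recr /= b'm => c0.
  have cm : c ord_max = 0.
    apply: contrapT => /eqP cn; apply: nW1w.
    have -> : w = - (c ord_max)^-1 *: \sum_(i < d) c (widen_ord (leqnSn d) i) *:
        b' (widen_ord (leqnSn d) i).
      rewrite (_ : \sum_(i < d) _ = - (c ord_max *: w)).
        by rewrite scalerN scaleNr opprK scalerA mulVf // scale1r.
      by apply/eqP; rewrite -addr_eq0 c0.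
    apply: subspaceZ => //; apply: subspace_sum => // i _.
    by rewrite b'l; apply: subspaceZ.
  move: c0; rewrite cm scale0r addr0.
  under eq_bigr do rewrite b'l.
  move=> /bfree cl i; case: (unliftP ord_max i) => [j ->|-> //].
  have <- : widen_ord (leqnSn d) j = lift ord_max j.
    by apply: val_inj; rewrite /= /bump leqNgt ltn_ord.
  exact: (cl j).
apply/seteqP; split.
  move=> v /dec [x]; rewrite W1E => vx.
  have sS := lspan_subspace (range b').
  rewrite -[v](subrK (x *: w)); apply: (subspaceD sS).
    apply: lspan_sub vx => // _ [j _ <-].
    by rewrite -b'l; apply: sub_lspan; exists (widen_ord (leqnSn d) j).
  by apply: (subspaceZ _ sS); rewrite -b'm; apply: sub_lspan; exists ord_max.
apply: lspan_sub => // _ [i _ <-]; rewrite /b'; case: unlift => [j|//].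
exact: W1W.
Qed.

(** Induction on the spanning list: cutting [W] with the span of the tail either changes nothing or
    removes exactly one dimension, which [has_dim_add] restores. *)
Lemma spanned_has_dim W d : subspace W -> spanned W d ->
  exists2 d', (d' <= d)%N & has_dim W d'.
Proof.
move=> sW [s ss]; suff : W `<=` lspan [set` s] ->
    exists2 d', (d' <= size s)%N & has_dim W d'.
  by move=> h /h [d' le hd]; exists d' => //; exact: leq_trans ss.
elim: s W sW {ss} => [|a s IH] W sW Ws.
  exists 0%N => //; exists (fun i : 'I_0 => 0); split; first by move=> c _ [].
  apply/seteqP; split=> v.
    by move=> /Ws/lspan_nil ->; apply: subspace0; exact: lspan_subspace.
  by apply: lspan_sub => // u [[]].
have sS := lspan_subspace [set` s].
have sW1 : subspace (W `&` lspan [set` s]) by exact: subspaceI.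
have [d' le hd] := IH _ sW1 (fun v h => h.2).
have [Wsub|/existsNP[w /not_implyP[Ww nw]]] := pselect (W `<=` lspan [set` s]).
  exists d'; first exact: leqW.
  by move: hd; rewrite (_ : W `&` _ = W) //; apply/setIidPl.
exists d'.+1 => //; apply: (has_dim_add sW _ Ww _ _ hd); first by move=> v [].
  by case.
have [xw [uw [hu wE]]] := lspan_cons (Ws _ Ww).
have xw0 : xw != 0 by apply: contra_notN nw => /eqP x0; rewrite wE x0 scale0r add0r.
move=> v Wv; have [x [u [hv vE]]] := lspan_cons (Ws _ Wv).
(* Both [v] and [w] have a coefficient along the head [a]; this multiple of [w] cancels it. *)
exists (x / xw); split; first by apply: subspaceB => //; exact: subspaceZ.
rewrite wE vE scalerDr scalerA divfK // opprD addrACA subrr add0r.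
by apply: (subspaceB sS) => //; exact: (subspaceZ _ sS).
Qed.

Lemma has_dim_gt0 W d v : has_dim W d -> W v -> v != 0 -> (0 < d)%N.
Proof.
case: d => // -[b [_ ->]] /lspan_range [c ->].
by rewrite big_ord0 eqxx.
Qed.

End LinearAlgebra.

Section LinearMaps.
Variables (K : fieldType) (U V : lmodType K) (f : U -> V).
Hypothesis lf : is_linear f.

Lemma is_linear0 : f 0 = 0.
Proof. by have := lf (-1) 0 0; rewrite scaler0 addr0 scaleN1r addNr. Qed.
Lemma is_linearD x y : f (x + y) = f x + f y.
Proof. by have := lf 1 x y; rewrite !scale1r. Qed.
Lemma is_linearZ a x : f (a *: x) = a *: f x.
Proof. by have := lf a x 0; rewrite is_linear0 !addr0. Qed.
Lemma is_linearN x : f (- x) = - f x.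
Proof. by rewrite -scaleN1r is_linearZ scaleN1r. Qed.
Lemma is_linearB x y : f (x - y) = f x - f y.
Proof. by rewrite is_linearD is_linearN. Qed.
Lemma is_linear_sum (I : Type) (r : seq I) (P : pred I) (F : I -> U) :
  f (\sum_(i <- r | P i) F i) = \sum_(i <- r | P i) f (F i).
Proof. exact: (big_morph f is_linearD is_linear0). Qed.

Lemma subspace_preim (W : set V) : subspace W -> subspace (f @^-1` W).
Proof.
move=> [h0 h]; split=> [|a u v] /=; first by rewrite is_linear0.
by rewrite lf; exact: h.
Qed.

Lemma subspace_image (W : set U) : subspace W -> subspace (f @` W).
Proof.
move=> [h0 h]; split; first by exists 0; rewrite ?is_linear0.
by move=> a _ _ [u Wu <-] [v Wv <-]; exists (a *: u + v); rewrite ?lf //; exact: h.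
Qed.

(** A basis of the image of [W] is lifted to [W] and completed by the list spanning the kernel. *)
Lemma spanned_rank_nullity (W : set U) (W' : set V) a b : subspace W ->
  (forall w, W w -> W' (f w)) -> spanned W' a ->
  spanned [set w | W w /\ f w = 0] b -> spanned W (a + b).
Proof.
move=> sW WW' W'a [s sb hs].
have fWa : spanned (f @` W) a.
  by apply: spanned_sub W'a => _ [w /WW' h <-].
have [d le [c [_ cE]]] := spanned_has_dim (subspace_image sW) fWa.
have cW i : exists w, W w /\ f w = c i.
  have : (f @` W) (c i) by rewrite cE; apply: sub_lspan; exists i.
  by case=> w; exists w.
have [w hw] := choice cW.
exists ([seq w i | i <- enum 'I_d] ++ s).
  by rewrite size_cat size_map size_enum_ord leq_add.
move=> v Wv; have : lspan (range c) (f v) by rewrite -cE; exists v.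
move=> /lspan_range [x xE].
have sS := lspan_subspace [set` [seq w i | i <- enum 'I_d] ++ s].
rewrite -[v](subrK (\sum_i x i *: w i)); apply: (subspaceD sS).
  apply: (lspan_mono (S1 := [set` s])).
    by move=> u /= us; rewrite mem_cat us orbT.
  apply: hs; split.
    apply: subspaceB => //; apply: subspace_sum => // i _.
    by apply: subspaceZ => //; case: (hw i).
  rewrite is_linearB is_linear_sum xE; apply/eqP; rewrite subr_eq0; apply/eqP.
  by apply: eq_bigr => i _; rewrite is_linearZ; case: (hw i) => _ ->.
apply: (subspace_sum _ sS) => i _; apply: (subspaceZ _ sS); apply: sub_lspan => /=.
by rewrite mem_cat map_f // mem_enum.
Qed.

Lemma spanned_inj (W : set U) (W' : set V) a : subspace W ->
  (forall w, W w -> W' (f w)) -> (forall w, W w -> f w = 0 -> w = 0) ->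
  spanned W' a -> spanned W a.
Proof.
move=> sW h inj hW'; rewrite -[a]addn0; apply: spanned_rank_nullity hW' _ => //.
by apply: spanned0 => w [Ww fw]; exact: inj.
Qed.

End LinearMaps.

(** * Separating eigenvectors of a linear operator *)

Section Eigen.
Variables (K : fieldType) (V : lmodType K) (D : V -> V).
Hypothesis lD : is_linear D.

Lemma eigen_subspace lam : subspace [set v | D v = lam *: v].
Proof.
split=> [|a u v /= Du Dv] /=; first by rewrite (is_linear0 lD) scaler0.
by rewrite lD Du Dv scalerDr !scalerA mulrC.
Qed.

(** Stands in for a complement of the [mu]-eigenspace: the space is arbitrary and [D] is not assumed
    diagonalizable, so only sums of eigenvectors are available. *)
Definition off_eigen (mu : K) : set V :=
  lspan [set v | exists2 lam, lam != mu & D v = lam *: v].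

Lemma off_eigen_sum mu v : off_eigen mu v -> exists s : seq (K * V),
  (forall x, x \in s -> x.1 != mu /\ D x.2 = x.1 *: x.2) /\
  v = \sum_(x <- s) x.2.
Proof.
apply: (lspan_sub (W := [set v | exists s : seq (K * V), (forall x, x \in s ->
   x.1 != mu /\ D x.2 = x.1 *: x.2) /\ v = \sum_(x <- s) x.2])).
  split; first by exists [::]; rewrite big_nil.
  move=> a _ _ [s [hs ->]] [t [ht ->]].
  exists ([seq (x.1, a *: x.2) | x <- s] ++ t); split; last first.
    by rewrite big_cat big_map /= scaler_sumr.
  move=> x; rewrite mem_cat => /orP[/mapP[y /hs [ym Dy] ->]|/ht //] /=.
  by split=> //; rewrite (is_linearZ lD) Dy !scalerA mulrC.
move=> u [lam lm Du]; exists [:: (lam, u)]; rewrite big_seq1; split=> // x.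
by rewrite inE => /eqP ->.
Qed.

(* Applying [D - lam] for each eigenvalue [lam] of [v] isolates [w]. *)
Lemma eigen_component mu (U : set V) w v : subspace U ->
  (forall u, U u -> U (D u)) -> D w = mu *: w -> off_eigen mu v ->
  U (w + v) -> U w.
Proof.
move=> sU UD + /off_eigen_sum[s [hs ->]].
elim: {s}(size s) {-2}s (leqnn (size s)) hs w => [|n IH] s.
  by case: s => // _ _ w _; rewrite big_nil addr0.
case: s => [|[lam u] s] /= ss hs w Dw; first by rewrite big_nil addr0.
have [lm Du] := hs _ (mem_head _ _); rewrite big_cons /= in lm Du * => Uw.
pose s' := [seq (x.1, (x.1 - lam) *: x.2) | x <- s].
have hs' x : x \in s' -> x.1 != mu /\ D x.2 = x.1 *: x.2.
  case/mapP=> y ys -> /=; have [|ym Dy] := hs y; first by rewrite inE ys orbT.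
  by split=> //; rewrite (is_linearZ lD) Dy !scalerA mulrC.
have ss' : (size s' <= n)%N by rewrite size_map.
have Dw' : D ((mu - lam) *: w) = mu *: ((mu - lam) *: w).
  by rewrite (is_linearZ lD) Dw !scalerA mulrC.
have := IH s' ss' hs' _ Dw'; set T := _ + _.
have TE : T = D (w + (u + \sum_(x <- s) x.2)) - lam *: (w + (u + \sum_(x <- s) x.2)).
  rewrite /T !(is_linearD lD) Dw Du big_map /= (is_linear_sum lD) !scalerDr.
  rewrite opprD addrACA scalerBl; congr (_ + _).
  rewrite opprD addrACA subrr add0r scaler_sumr -sumrB !big_seq.
  apply: eq_bigr => x xs; have [|_ ->] := hs x; first by rewrite inE xs orbT.
  by rewrite scalerBl.
move=> /(_ _); rewrite TE => /(_ (subspaceB sU (UD _ Uw) (subspaceZ lam sU Uw))) h.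
rewrite -[w]scale1r -(@mulVf _ (mu - lam)); last by rewrite subr_eq0 eq_sym.
by rewrite -scalerA; exact: subspaceZ.
Qed.

Lemma eigen_component0 mu w v : D w = mu *: w -> off_eigen mu v ->
  w + v = 0 -> w = 0.
Proof.
move=> Dw hv e; apply: (eigen_component (U := [set 0]) _ _ Dw hv) => //.
  exact: subspace_zero.
by move=> u ->; rewrite /= (is_linear0 lD).
Qed.

End Eigen.

(** * Lie superalgebras realizing a Cartan datum *)

Lemma svpar_split (K : fieldType) (V : superspace K) (x : V) :
  exists x0 x1, [/\ svpar false x0, svpar true x1 & x = x0 + x1].
Proof.
case: x => x0 x1; exists ((x0, 0) : V), ((0, x1) : V); split=> //.
by congr (_, _); rewrite /= ?addr0 ?add0r.
Qed.

Section LieSuper.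
Variables (K : fieldType) (L : lmodType K) (par : bool -> set L).
Variable br : L -> L -> L.
Hypothesis lieL : is_lie_super par br.

Lemma brl y : is_linear (br^~ y).
Proof. by case: (lie_bilinear lieL). Qed.
Lemma brr x : is_linear (br x).
Proof. by case: (lie_bilinear lieL). Qed.
Lemma brDl x y z : br (x + y) z = br x z + br y z.
Proof. exact: (is_linearD (brl z)). Qed.
Lemma brDr x y z : br x (y + z) = br x y + br x z.
Proof. exact: (is_linearD (brr x)). Qed.
Lemma brZl a x y : br (a *: x) y = a *: br x y.
Proof. exact: (is_linearZ (brl y)). Qed.
Lemma brZr a x y : br x (a *: y) = a *: br x y.
Proof. exact: (is_linearZ (brr x)). Qed.
Lemma br0l y : br 0 y = 0.
Proof. exact: (is_linear0 (brl y)). Qed.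
Lemma br0r x : br x 0 = 0.
Proof. exact: (is_linear0 (brr x)). Qed.
Lemma brNl x y : br (- x) y = - br x y.
Proof. exact: (is_linearN (brl y)). Qed.
Lemma brNr x y : br x (- y) = - br x y.
Proof. exact: (is_linearN (brr x)). Qed.

Lemma par_subspace p : subspace (par p).
Proof. by case: (lie_superspace lieL) => h _ _; exact: h. Qed.

Lemma par_split v : exists v0 v1, [/\ par false v0, par true v1 & v = v0 + v1].
Proof. by case: (lie_superspace lieL). Qed.

Lemma par_disj p v : par p v -> par (~~ p) v -> v = 0.
Proof. by case: (lie_superspace lieL) => _ _ h; case: p => a b; exact: h. Qed.

Lemma par_splitK u0 u1 v0 v1 : par false u0 -> par true u1 ->
  par false v0 -> par true v1 -> u0 + u1 = v0 + v1 -> u0 = v0 /\ u1 = v1.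
Proof.
move=> pu0 pu1 pv0 pv1 e.
have e' : u0 - v0 = v1 - u1.
  by apply/eqP; rewrite subr_eq addrAC [v1 + _]addrC -e addrK.
have z : u0 - v0 = 0.
  apply: (@par_disj false); first exact: (subspaceB (par_subspace _)).
  by rewrite e'; exact: (subspaceB (par_subspace _)).
split; apply/eqP; rewrite -subr_eq0; first by rewrite z.
by rewrite -oppr_eq0 opprB -e' z.
Qed.

Lemma br_br p q x y z : par p x -> par q y ->
  br (br x y) z = br x (br y z) - koszul K p q *: br y (br x z).
Proof. by move=> px py; rewrite (lie_jacobi lieL z px py) addrK. Qed.

Lemma jacobi_even x y z : par false x -> br x (br y z) = br (br x y) z + br y (br x z).
Proof.
move=> px; have [y0 [y1 [p0 p1 ->]]] := par_split y.
rewrite !brDl !brDr !brDl (lie_jacobi lieL z px p0) (lie_jacobi lieL z px p1).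
by rewrite /koszul /= expr0 !scale1r addrACA.
Qed.

Lemma weightD h a b x y : par false h -> br h x = a *: x -> br h y = b *: y ->
  br h (br x y) = (a + b) *: br x y.
Proof. by move=> ph hx hy; rewrite jacobi_even // hx hy brZl brZr -scalerDl. Qed.

Lemma skew_even x y : par false x -> br x y = - br y x.
Proof.
move=> px; have [y0 [y1 [p0 p1 ->]]] := par_split y.
rewrite !brDl !brDr (lie_skew lieL px p0) (lie_skew lieL px p1).
by rewrite /koszul /= expr0 !scaleN1r opprD.
Qed.

Lemma jacobi_odd x y z : par true x -> par true y ->
  br x (br y z) = br (br x y) z - br y (br x z).
Proof.
by move=> px py; rewrite (lie_jacobi lieL z px py) /koszul /= expr1 scaleN1r.
Qed.

Lemma skew_odd x y : par true x -> par true y -> br x y = br y x.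
Proof.
by move=> px py; rewrite (lie_skew lieL px py) /koszul /= expr1 opprK scale1r.
Qed.

End LieSuper.

(** * Words in the generators and the triangular decomposition *)

Section Realization.
Variables (K : numClosedFieldType) (A : cartan_datum K) (L : lmodType K).
Variables (par : bool -> set L) (br : L -> L -> L).
Variables (ih : cd_h A -> L) (ig : forall s i, cd_g A s i -> L).
Hypothesis rz : realizes par br ih ig.
Hypothesis gen : forall W : set L, subspace W ->
  (forall x y, W x -> W y -> W (br x y)) -> (forall x, W (ih x)) ->
  (forall s i (x : cd_g A s i), W (ig x)) -> forall v, W v.
Local Notation n := (cd_n A).
Let lieL := rz_lie rz.

Lemma ih0 : ih 0 = 0.
Proof. exact: (is_linear0 (rz_h_linear rz)). Qed.

Lemma gen_stable (W : set L) : subspace W ->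
  (forall p x, svpar p x -> forall v, W v -> W (br (ih x) v)) ->
  (forall p s i (x : cd_g A s i), svpar p x -> forall v, W v -> W (br (ig x) v)) ->
  forall y v, W v -> W (br y v).
Proof.
move=> sW Wh Wg.
(* Both homogeneous components are required to preserve [W], because the derivation rule for a
   bracket is available for homogeneous elements only. *)
pose Z : set L := [set x | exists x0 x1, [/\ par false x0, par true x1, x = x0 + x1,
  forall v, W v -> W (br x0 v) & forall v, W v -> W (br x1 v)]].
have ps := par_subspace lieL.
suff ZT y : Z y.
  move=> y v Wv; have [y0 [y1 [_ _ -> W0 W1]]] := ZT y.
  by rewrite (brDl lieL); apply: (subspaceD sW); [exact: W0|exact: W1].
apply: gen => {y}.
- split.
    exists 0, 0; split; rewrite ?addr0 //; try exact: (subspace0 (ps _)).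
      by move=> v _; rewrite (br0l lieL); exact: (subspace0 sW).
    by move=> v _; rewrite (br0l lieL); exact: (subspace0 sW).
  move=> a _ _ [x0 [x1 [px0 px1 -> Wx0 Wx1]]] [y0 [y1 [py0 py1 -> Wy0 Wy1]]].
  exists (a *: x0 + y0), (a *: x1 + y1); split.
  + by case: (ps false) => _; exact.
  + by case: (ps true) => _; exact.
  + by rewrite scalerDr addrACA.
  + move=> v Wv; rewrite (brDl lieL) (brZl lieL).
    by case: sW => _; apply; [exact: Wx0|exact: Wy0].
  + move=> v Wv; rewrite (brDl lieL) (brZl lieL).
    by case: sW => _; apply; [exact: Wx1|exact: Wy1].
- move=> _ _ [x0 [x1 [px0 px1 -> Wx0 Wx1]]] [y0 [y1 [py0 py1 -> Wy0 Wy1]]].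
  have bp := lie_parity lieL.
  exists (br x0 y0 + br x1 y1), (br x0 y1 + br x1 y0); split.
  + by apply: (subspaceD (ps _)); [exact: (bp _ _ _ _ px0 py0)|exact: (bp _ _ _ _ px1 py1)].
  + by apply: (subspaceD (ps _)); [exact: (bp _ _ _ _ px0 py1)|exact: (bp _ _ _ _ px1 py0)].
  + rewrite (brDl lieL) !(brDr lieL) -!addrA; congr (_ + _).
    by rewrite addrA addrC.
  + move=> v Wv; rewrite (brDl lieL) (br_br lieL _ px0 py0) (br_br lieL _ px1 py1).
    by apply: (subspaceD sW); apply: (subspaceB sW); try apply: (subspaceZ _ sW); auto.
  + move=> v Wv; rewrite (brDl lieL) (br_br lieL _ px0 py1) (br_br lieL _ px1 py0).
    by apply: (subspaceD sW); apply: (subspaceB sW); try apply: (subspaceZ _ sW); auto.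
- move=> x; have [x0 [x1 [p0 p1 ->]]] := svpar_split x.
  exists (ih x0), (ih x1); split.
  + exact: (rz_h_parity rz).
  + exact: (rz_h_parity rz).
  + exact: (is_linearD (rz_h_linear rz)).
  + exact: (Wh _ _ p0).
  + exact: (Wh _ _ p1).
- move=> s i x; have [x0 [x1 [p0 p1 ->]]] := svpar_split x.
  exists (ig x0), (ig x1); split.
  + exact: (rz_g_parity rz).
  + exact: (rz_g_parity rz).
  + exact: (is_linearD (@rz_g_linear _ _ _ _ _ _ _ rz _ _)).
  + exact: (Wg _ _ _ _ p0).
  + exact: (Wg _ _ _ _ p1).
Qed.

(** Right-nested brackets of homogeneous generators of a single sign. The index list records the
    weight: conditions on its size or its letter counts cut out degrees and weight components
    through [wspan]. *)
Inductive word (s : bool) : seq 'I_n -> L -> Prop :=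
| word1 p i (x : cd_g A s i) : svpar p x -> word s [:: i] (ig x)
| wordS p i (x : cd_g A s i) w v :
    svpar p x -> word s w v -> word s (i :: w) (br (ig x) v).

Definition wspan s (P : seq 'I_n -> Prop) : set L :=
  lspan [set v | exists2 w, word s w v & P w].

Lemma wspan_subspace s P : subspace (wspan s P).
Proof. exact: lspan_subspace. Qed.
Hint Resolve wspan_subspace : core.

Lemma wspan0 s P : wspan s P 0.
Proof. exact: subspace0. Qed.

Lemma wspanD s P u v : wspan s P u -> wspan s P v -> wspan s P (u + v).
Proof. exact: (subspaceD (wspan_subspace s P)). Qed.

Lemma wspanZ s P a u : wspan s P u -> wspan s P (a *: u).
Proof. exact: (subspaceZ _ (wspan_subspace s P)). Qed.

Lemma wspan_sub s (P Q : seq 'I_n -> Prop) :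
  (forall w, P w -> Q w) -> wspan s P `<=` wspan s Q.
Proof. by move=> PQ; apply: lspan_mono => v [w wv /PQ]; exists w. Qed.

Lemma wspan_word s w v (P : seq 'I_n -> Prop) : word s w v -> P w -> wspan s P v.
Proof. by move=> wv Pw; apply: sub_lspan; exists w. Qed.

Lemma word_size s w v : word s w v -> (0 < size w)%N.
Proof. by case. Qed.

Lemma word_par s w v : word s w v -> exists p, par p v.
Proof.
elim=> {w v} [p i x px|p i x w v px _ [q pv]].
  by exists p; exact: (rz_g_parity rz).
exists (p (+) q); apply: (lie_parity lieL) => //; exact: (rz_g_parity rz).
Qed.

(** An element of h acts by a superderivation and moves each letter within its own root module, so
    the index list does not change. *)
Lemma word_ih s w v x : word s w v -> wspan s (eq w) (br (ih x) v).
Proof.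
move=> wv; have [x0 [x1 [p0 p1 ->]]] := svpar_split x.
suff H p y : svpar p y -> wspan s (eq w) (br (ih y) v).
  rewrite (is_linearD (rz_h_linear rz)) (brDl lieL).
  by apply: wspanD; [exact: (H _ _ p0)|exact: (H _ _ p1)].
move=> {x x0 x1 p0 p1} py; elim: wv => {w v} [q i x qx|q i x w v qx wv IH].
  rewrite (rz_hg rz); apply: wspan_word => //; apply: word1.
  by case: (hm_module (cd_g A s i)) => _ h _; exact: (h _ _ _ _ py qx).
rewrite (lie_jacobi lieL v (rz_h_parity rz py) (rz_g_parity rz qx)) (rz_hg rz).
apply: wspanD.
  apply: wspan_word (erefl _); apply: wordS => //.
  by case: (hm_module (cd_g A s i)) => _ h _; exact: (h _ _ _ _ py qx).
apply: wspanZ.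
apply: (lspan_sub (W := [set u | wspan s (eq (i :: w)) (br (ig x) u)]) _ _ IH).
  exact: (subspace_preim (brr lieL _)).
by move=> u [w' wu we]; subst w'; apply: wspan_word (erefl _); exact: wordS qx wu.
Qed.

Lemma wspan_ih s P x v : wspan s P v -> wspan s P (br (ih x) v).
Proof.
apply: (lspan_sub (W := [set u | wspan s P (br (ih x) u)])).
  exact: (subspace_preim (brr lieL _)).
move=> u [w wu Pw]; apply: wspan_sub (word_ih x wu) => w' <- //.
Qed.

Lemma wspan_raise s i (x : cd_g A s i) (P Q : seq 'I_n -> Prop) v :
  (forall w, P w -> Q (i :: w)) -> wspan s P v -> wspan s Q (br (ig x) v).
Proof.
move=> PQ; apply: (lspan_sub (W := [set u | wspan s Q (br (ig x) u)])).
  exact: (subspace_preim (brr lieL _)).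
move=> u [w wu Pw] /=; have [x0 [x1 [p0 p1 ->]]] := svpar_split x.
rewrite (is_linearD (@rz_g_linear _ _ _ _ _ _ _ rz _ _)) (brDl lieL).
by apply: wspanD; (apply: wspan_word; last exact: (PQ _ Pw));
  [exact: wordS p0 wu|exact: wordS p1 wu].
Qed.

Lemma opp_br s i j (y : cd_g A (~~ s) i) (x : cd_g A s j) p q :
  svpar p y -> svpar q x ->
  exists z, [/\ svpar (p (+) q) z, br (ig y) (ig x) = ih z & i != j -> z = 0].
Proof.
move=> py qx; have [ij|ij] := eqVneq i j; last first.
  exists 0; split=> //; first by rewrite /svpar /=; case: (p (+) q).
  rewrite ih0; case: s y x py qx => /= y x py qx; first exact: (rz_gg0 rz).
  rewrite (lie_skew lieL (rz_g_parity rz py) (rz_g_parity rz qx)).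
  by rewrite (rz_gg0 rz) ?scaler0 // eq_sym.
subst j; have [_ bp _] := cd_pairing i.
have h0 (z : cd_h A) (a : K) (r : bool) : svpar r z -> svpar r (a *: z).
  by rewrite /svpar /=; case: r => /= ->; rewrite scaler0.
case: s y x py qx => /= y x py qx.
  by exists (cd_br y x); split=> //; [exact: bp|exact: (rz_gg rz)].
exists (- koszul K p q *: cd_br x y); split=> //.
  by apply: h0; rewrite addbC; exact: bp.
rewrite (lie_skew lieL (rz_g_parity rz py) (rz_g_parity rz qx)) (rz_gg rz).
by rewrite (is_linearZ (rz_h_linear rz)).
Qed.

(** Commuting an opposite generator of index [i] through the word replaces one letter [i] by an
    element of h, which [word_ih] absorbs. If [i] does not occur, no [w'] meets the count condition
    and the span is zero. Words of length one are excluded because they are lowered into h. *)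
Lemma word_lower s i (y : cd_g A (~~ s) i) w v p : svpar p y ->
  word s w v -> (1 < size w)%N ->
  wspan s (fun w' => forall k, count_mem k w = (count_mem k w' + (k == i))%N)
    (br (ig y) v).
Proof.
move=> py wv; have nw := wv; elim: wv nw => {w v} // q j x w v qx wv IH _ _.
rewrite (lie_jacobi lieL v (rz_g_parity rz py) (rz_g_parity rz qx)).
have [z [pz zE z0]] := opp_br py qx.
apply: wspanD.
  rewrite zE; have [ij|/z0 ->] := eqVneq i j; last first.
    by rewrite ih0 (br0l lieL); exact: wspan0.
  apply: wspan_sub (word_ih z wv) => w' <- k /=.
  by rewrite addnC ij eq_sym.
apply: wspanZ.
(* A one-letter tail is itself lowered into h; the element of h obtained then acts on the remaining
   letter [x]. *)
case: wv IH => {w v} [q' k x' qx' _|q' k x' w v qx' wv IH].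
  have [z' [pz' -> z0']] := opp_br py qx'.
  have [ik|/z0' ->] := eqVneq i k; last first.
    by rewrite ih0 (br0r lieL); exact: wspan0.
  rewrite (lie_skew lieL (rz_g_parity rz qx) (rz_h_parity rz pz')) (rz_hg rz).
  apply: wspanZ; apply: (wspan_word (w := [:: j])); last first.
    by move=> l /=; rewrite ik !addn0 [l == k]eq_sym.
  apply: word1; case: (hm_module (cd_g A s j)) => _ h _; exact: (h _ _ _ _ pz' qx).
have sw : (1 < size (k :: w))%N by rewrite ltnS; exact: word_size wv.
apply: wspan_raise (IH (wordS qx' wv) sw) => w' h l /=.
by rewrite -addnA -h.
Qed.

Lemma wspan_lower s i (y : cd_g A (~~ s) i) (P Q : seq 'I_n -> Prop) v :
  (forall w, P w -> (1 < size w)%N) ->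
  (forall w w', P w ->
     (forall k, count_mem k w = (count_mem k w' + (k == i))%N) -> Q w') ->
  wspan s P v -> wspan s Q (br (ig y) v).
Proof.
move=> P1 PQ; apply: (lspan_sub (W := [set u | wspan s Q (br (ig y) u)])).
  exact: (subspace_preim (brr lieL _)).
move=> u [w wu Pw] /=; have [y0 [y1 [p0 p1 ->]]] := svpar_split y.
rewrite (is_linearD (@rz_g_linear _ _ _ _ _ _ _ rz _ _)) (brDl lieL).
apply: wspanD.
  by apply: wspan_sub (word_lower p0 wu (P1 _ Pw)) => w'; exact: PQ.
by apply: wspan_sub (word_lower p1 wu (P1 _ Pw)) => w'; exact: PQ.
Qed.

Definition all_words : set L := [set v | exists s w, word s w v].

(** The span [T] of h and of the words of both signs contains the generators and is stable under
    them, so by [gen_stable] it is stable under all of [L]. *)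
Lemma triangular v : lspan (range ih `|` all_words) v.
Proof.
set T := lspan _; have sT : subspace T by exact: lspan_subspace.
have Th x : T (ih x) by apply: sub_lspan; left; exists x.
have Tw s P u : wspan s P u -> T u.
  by apply: lspan_mono => u' [w wu _]; right; exists s, w.
have Tst : forall y u, T u -> T (br y u).
  apply: gen_stable => // [p x px|p s i x px] u; move: u.
    apply: (lspan_sub (W := [set u | T (br (ih x) u)])).
      exact: (subspace_preim (brr lieL _)).
    move=> u [[z _ <-]|[s [w wu]]] /=; first by rewrite (rz_hh rz).
    exact: Tw (word_ih _ wu).
  apply: (lspan_sub (W := [set u | T (br (ig x) u)])).
    exact: (subspace_preim (brr lieL _)).
  move=> u [[z _ <-]|[s' [w wu]]] /=.
    have [z0 [z1 [pz0 pz1 ->]]] := svpar_split z.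
    rewrite (is_linearD (rz_h_linear rz)) (brDr lieL).
    rewrite (lie_skew lieL (rz_g_parity rz px) (rz_h_parity rz pz0)).
    rewrite (lie_skew lieL (rz_g_parity rz px) (rz_h_parity rz pz1)) !(rz_hg rz).
    have hp q t : svpar q t -> T (ig (hm_act t x)).
      move=> qt; apply: (Tw s (fun=> True)); apply: wspan_word => //.
      apply: word1.
      by case: (hm_module (cd_g A s i)) => _ h _; exact: (h _ _ _ _ qt px).
    by apply: (subspaceD sT); apply: (subspaceZ _ sT); [exact: hp pz0|exact: hp pz1].
  have [ss|ss] := eqVneq s s'.
    subst s'; apply: (Tw s (fun=> True)).
    have H : wspan s (fun=> True) u by exact: wspan_word wu _.
    by apply: wspan_raise H.
  have {}ss : s = ~~ s' by case: s s' ss {x px wu} => [] [].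
  subst s; case: wu => {w u} [q j x' qx'|q j x' w u qx' wu].
    by have [z [_ -> _]] := opp_br px qx'.
  by apply: Tw (word_lower px (wordS qx' wu) _); rewrite ltnS (word_size wu).
apply: (gen sT) => // [x y _ Ty|s i x]; first exact: Tst.
have [x0 [x1 [p0 p1 ->]]] := svpar_split x.
rewrite (is_linearD (@rz_g_linear _ _ _ _ _ _ _ rz _ _)).
by apply: (subspaceD sT); apply: (Tw s (fun=> True)); apply: wspan_word => //;
  [exact: word1 p0|exact: word1 p1].
Qed.

Lemma word_weight (t : even_part (cd_h A)) s w v : word s w v ->
  br (ih ((t, 0) : cd_h A)) v = ((-1) ^+ s * \sum_(i <- w) cd_root A i t) *: v.
Proof.
have t0 : par false (ih ((t, 0) : cd_h A)) by exact: (rz_h_parity rz).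
elim=> {w v} [p i x px|p i x w v px wv IH].
  by rewrite (rz_hg rz) cd_weight big_seq1 (is_linearZ (@rz_g_linear _ _ _ _ _ _ _ rz _ _)).
rewrite (jacobi_even lieL _ _ t0) IH (rz_hg rz) cd_weight.
rewrite (is_linearZ (@rz_g_linear _ _ _ _ _ _ _ rz _ _)) (brZl lieL) (brZr lieL).
by rewrite -scalerDl -mulrDr big_cons.
Qed.

(** * The grading by eigenvalues of ad(t0) *)

Section Grading.
Variable t0 : even_part (cd_h A).
Hypothesis t0P : forall i, cd_root A i t0 = 1.
Let D := br (ih ((t0, 0) : cd_h A)).

Lemma grading_linear : is_linear D.
Proof. exact: (brr lieL). Qed.

Lemma word_degree s w v : word s w v -> D v = ((-1) ^+ s * (size w)%:R) *: v.
Proof.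
move=> wv; rewrite /D (word_weight _ wv); congr (_ * _ *: _).
by under eq_bigr do rewrite t0P; rewrite big_const_seq count_predT iter_addr_0.
Qed.

Lemma ih_degree x : D (ih x) = 0.
Proof. by rewrite /D (rz_hh rz) qt_central ?ih0. Qed.

Lemma words_off : lspan all_words `<=` off_eigen D 0.
Proof.
apply: lspan_mono => v [s [w wv]]; exists ((-1) ^+ s * (size w)%:R).
  rewrite mulf_neq0 ?signr_eq0 // pnatr_eq0 -lt0n; exact: word_size wv.
exact: word_degree.
Qed.

Lemma triangular_sum v : exists x u, lspan all_words u /\ v = ih x + u.
Proof.
apply: (lspan_sub (W := [set v | exists x u, lspan all_words u /\ v = ih x + u])
  _ _ (triangular v)).
  have sS := lspan_subspace all_words; split.
    by exists 0, 0; rewrite ih0 addr0; split=> //; exact: (subspace0 sS).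
  move=> a _ _ [x [u [uw ->]]] [y [u' [uw' ->]]].
  exists (a *: x + y), (a *: u + u'); split; first by case: sS => _; exact.
  by rewrite (rz_h_linear rz) scalerDr addrACA.
move=> u [[x _ <-]|wu].
  exists x, 0; rewrite addr0; split=> //.
  by apply: subspace0; exact: lspan_subspace.
exists 0, u; rewrite ih0 add0r; split=> //.
exact: sub_lspan.
Qed.

Lemma ih_component (U : set L) x u : subspace U -> (forall v, U v -> U (D v)) ->
  lspan all_words u -> U (ih x + u) -> U (ih x).
Proof.
move=> sU UD uw; apply: (eigen_component grading_linear sU UD (mu := 0)).
  by rewrite ih_degree scale0r.
exact: words_off.
Qed.

Lemma ih_words x : lspan all_words (ih x) -> ih x = 0.
Proof.
move=> xw; apply: (eigen_component0 grading_linear (mu := 0) (v := - ih x)).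
- by rewrite ih_degree scale0r.
- by apply: words_off; apply: (subspaceN _ xw); exact: lspan_subspace.
- exact: subrr.
Qed.

Lemma degree0_h v : D v = 0 -> exists x, v = ih x.
Proof.
move=> Dv; have [x [u [uw vE]]] := triangular_sum v; exists x.
apply/eqP; rewrite -subr_eq0; apply/eqP.
apply: (eigen_component0 grading_linear (mu := 0) (v := - u)).
- by rewrite (is_linearB grading_linear) Dv ih_degree subrr scale0r.
- by apply: words_off; apply: (subspaceN _ uw); exact: lspan_subspace.
- by rewrite vE [ih x + u]addrC addrK subrr.
Qed.

(** The triangular decomposition splits [v] into words of the right sign and length and a rest lying
    in [off_eigen]; comparing eigenvalues shows that the rest is zero. *)
Lemma degree_words (s : bool) d v : (0 < d)%N -> D v = ((-1) ^+ s * d%:R) *: v ->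
  wspan s (fun w => size w = d) v.
Proof.
move=> d0; set mu := _ * _ => Dv.
have sg (b : bool) : (-1) ^+ b != 0 :> K by rewrite signr_eq0.
have sw : subspace (wspan s (fun w => size w = d)) by [].
have so : subspace (off_eigen D mu) by exact: lspan_subspace.
have wD u : wspan s (fun w => size w = d) u -> D u = mu *: u.
  apply: (lspan_sub (eigen_subspace grading_linear mu)).
  by move=> u' [w wu sz] /=; rewrite (word_degree wu) sz.
have [u [oo [uw ho vE]]] : exists u oo, [/\ wspan s (fun w => size w = d) u,
    off_eigen D mu oo & v = u + oo].
  apply: (lspan_sub (W := [set v | exists u oo, [/\ wspan s (fun w => size w = d) u,
    off_eigen D mu oo & v = u + oo]]) _ _ (triangular v)).
    split; first by exists 0, 0; rewrite addr0; split=> //; [exact: wspan0|exact: (subspace0 so)].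
    move=> a _ _ [u [oo [hu ho ->]]] [u' [oo' [hu' ho' ->]]].
    exists (a *: u + u'), (a *: oo + oo'); split.
    - by case: sw => _; exact.
    - by case: so => _; exact.
    - by rewrite scalerDr addrACA.
  move=> u [[x _ <-]|[s' [w wu]]].
    exists 0, (ih x); split; rewrite ?add0r //; first exact: wspan0.
    apply: sub_lspan; exists 0; last by rewrite ih_degree scale0r.
    by rewrite eq_sym mulf_neq0 ?signr_eq0 // pnatr_eq0 -lt0n.
  have [e|e] := eqVneq ((-1) ^+ s' * (size w)%:R) mu.
    exists u, 0; split; rewrite ?addr0 //; last exact: (subspace0 so).
    move: e; rewrite /mu; have [<-|ss] := eqVneq s' s.
      move=> /(mulfI (sg _)) /eqP; rewrite eqr_nat => /eqP sz.
      exact: wspan_word wu sz.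
    (* A word of the opposite sign with this eigenvalue would force its length plus [d] to be
       zero. *)
    have -> : s' = ~~ s by case: s s' ss {mu Dv sw so wD wu} => [] [].
    rewrite signrN mulNr -mulrN => /(mulfI (sg _)) /eqP.
    rewrite eq_sym -addr_eq0 -natrD pnatr_eq0 addn_eq0 => /andP[/eqP dz _].
    by rewrite dz in d0.
  exists 0, u; split; rewrite ?add0r //; first exact: wspan0.
  apply: sub_lspan; exists ((-1) ^+ s' * (size w)%:R) => //.
  exact: word_degree.
suff -> : v = u by [].
apply/eqP; rewrite -subr_eq0; apply/eqP.
apply: (eigen_component0 grading_linear (mu := mu) (v := - oo)).
- by rewrite (is_linearB grading_linear) Dv (wD _ uw) scalerBr.
- exact: (subspaceN so).
- by rewrite vE [u + oo]addrC addrK subrr.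
Qed.

End Grading.

End Realization.

(** * Vectors killed by all generators of the opposite sign *)

Section Killed.
Variables (K : numClosedFieldType) (A : cartan_datum K) (L : lmodType K).
Variables (par : bool -> set L) (br : L -> L -> L).
Variables (ih : cd_h A -> L) (ig : forall s i, cd_g A s i -> L).
Hypothesis rz : realizes par br ih ig.
Hypothesis gen : forall W : set L, subspace W ->
  (forall x y, W x -> W y -> W (br x y)) -> (forall x, W (ih x)) ->
  (forall s i (x : cd_g A s i), W (ig x)) -> forall v, W v.
Hypothesis ideal0 : forall I : set L, is_ideal par br I ->
  (forall x, I (ih x) -> ih x = 0) -> forall v, I v -> v = 0.
Variable t0 : even_part (cd_h A).
Hypothesis t0P : forall i, cd_root A i t0 = 1.
Let lieL := rz_lie rz.

(** Acting on [v] by h and by the generators of sign [s] already produces an ideal [I]: an opposite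
    generator moves past these up to elements of h, and finally kills [v]. As [I] stays within the
    words of sign [s], it contains no nonzero element of h. *)
Lemma killed_homogeneous s p v : par p v -> (wspan br ig) s (fun=> True) v ->
  (forall i q (y : cd_g A (~~ s) i), svpar q y -> br (ig y) v = 0) -> v = 0.
Proof.
move=> pv wv kv.
pose stb (W : set L) := [/\ subspace W, W v,
  forall q x, svpar q x -> forall u, W u -> W (br (ih x) u) &
  forall i q (x : cd_g A s i), svpar q x -> forall u, W u -> W (br (ig x) u)].
pose I : set L := [set u | forall W, stb W -> W u].
have sI : subspace I.
  split; first by move=> W [[]].
  by move=> a x y Ix Iy W sW; case: (sW) => -[_ h] _ _ _; apply: h; [exact: Ix|exact: Iy].
have Iv : I v by move=> W [].
have Ih q x u : svpar q x -> I u -> I (br (ih x) u).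
  by move=> qx Iu W sW; case: (sW) => _ _ h _; apply: (h q) => //; exact: Iu.
have Ig i q (x : cd_g A s i) u : svpar q x -> I u -> I (br (ig x) u).
  by move=> qx Iu W sW; case: (sW) => _ _ _ h; apply: (h i q) => //; exact: Iu.
have Iopp i q (y : cd_g A (~~ s) i) u : svpar q y -> I u -> I (br (ig y) u).
  (* Minimality of [I] serves as an induction principle: intersect [I] with a property and check
     that the result is still stable. The same device gives the homogeneous components below. *)
  move=> qy Iu; suff [_ h] : (I `&` [set u | forall i q (y : cd_g A (~~ s) i),
    svpar q y -> I (br (ig y) u)]) u by exact: (h i q).
  apply: Iu; split.
  - apply: (subspaceI sI); split=> [j q' y' _|a x z hx hz j q' y' qy'] /=.
      by rewrite (br0r lieL); exact: (subspace0 sI).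
    rewrite (brr lieL); case: sI => _; apply; [exact: hx qy'|exact: hz qy'].
  - by split=> // j q' y' qy'; rewrite (kv _ _ _ qy'); exact: (subspace0 sI).
  - move=> q1 x qx z [Iz hz]; split; first exact: Ih qx Iz.
    move=> j q' y' qy'.
    rewrite (lie_jacobi lieL _ (rz_g_parity rz qy') (rz_h_parity rz qx)).
    rewrite (lie_skew lieL (rz_g_parity rz qy') (rz_h_parity rz qx)) (rz_hg rz).
    rewrite (brZl lieL).
    apply: (subspaceD sI); apply: (subspaceZ _ sI).
      apply: (hz _ (q1 (+) q')).
      by case: (hm_module (cd_g A (~~ s) j)) => _ h _; exact: h.
    by apply: (Ih _ _ _ qx); exact: hz qy'.
  - move=> k q1 x qx z [Iz hz]; split; first exact: Ig qx Iz.
    move=> j q' y' qy'.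
    rewrite (lie_jacobi lieL _ (rz_g_parity rz qy') (rz_g_parity rz qx)).
    have [x' [px' -> _]] := opp_br rz qy' qx.
    apply: (subspaceD sI); first exact: Ih px' Iz.
    by apply: (subspaceZ _ sI); apply: (Ig _ _ _ _ qx); exact: hz qy'.
have Iall : forall y u, I u -> I (br y u).
  apply: (gen_stable rz gen sI) => [q x qx u|q s' i x qx u Iu].
    exact: Ih qx.
  have [ss|ss] := eqVneq s' s; first by subst s'; exact: Ig qx Iu.
  have {}ss : s' = ~~ s by case: s' s ss {wv kv stb I sI Iv Ih Ig Iopp Iu x qx} => [] [].
  by subst s'; exact: Iopp qx Iu.
apply: (ideal0 (I := I)) => //.
  split=> //; split=> // u Iu.
  suff [_ h] : (I `&` [set u | exists v0 v1, [/\ par false v0, par true v1,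
     I v0, I v1 & u = v0 + v1]]) u by exact: h.
  have ps := par_subspace lieL.
  have act q x w : par q x -> (forall w, I w -> I (br x w)) ->
     (exists v0 v1, [/\ par false v0, par true v1, I v0, I v1 & w = v0 + v1]) ->
     exists v0 v1, [/\ par false v0, par true v1, I v0, I v1 & br x w = v0 + v1].
    move=> px Ix [v0 [v1 [p0 p1 I0 I1 ->]]]; rewrite (brDr lieL).
    case: q px => px.
      exists (br x v1), (br x v0); split; try exact: Ix.
      - exact: (lie_parity lieL px p1).
      - exact: (lie_parity lieL px p0).
      - by rewrite addrC.
    exists (br x v0), (br x v1); split; try exact: Ix.
    - exact: (lie_parity lieL px p0).
    - exact: (lie_parity lieL px p1).
    - by [].
  apply: Iu; split.
  - apply: (subspaceI sI); split.
      by exists 0, 0; split; rewrite ?addr0 //; first [exact: (subspace0 (ps _))|exact: (subspace0 sI)].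
    move=> a _ _ [x0 [x1 [px0 px1 Ix0 Ix1 ->]]] [y0 [y1 [py0 py1 Iy0 Iy1 ->]]].
    exists (a *: x0 + y0), (a *: x1 + y1); split.
    + by case: (ps false) => _; exact.
    + by case: (ps true) => _; exact.
    + by case: sI => _; exact.
    + by case: sI => _; exact.
    + by rewrite scalerDr addrACA.
  - split=> //; case: p pv => pv; [exists 0, v|exists v, 0]; split;
      rewrite ?addr0 ?add0r //; first [exact: (subspace0 (ps _))|exact: (subspace0 sI)].
  - move=> q x qx w [Iw hw]; split; first exact: Ih qx Iw.
    by apply: act hw; [exact: (rz_h_parity rz qx)|move=> w'; exact: Ih qx].
  - move=> i q x qx w [Iw hw]; split; first exact: Ig qx Iw.
    by apply: act hw; [exact: (rz_g_parity rz qx)|move=> w'; exact: Ig qx].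
move=> x Ix; apply: (ih_words rz t0P).
have : (wspan br ig) s (fun=> True) (ih x).
  apply: Ix; split=> //.
  - exact: wspan_subspace.
  - by move=> q y _ u; exact: (wspan_ih rz).
  - by move=> i q y _ u; apply: (wspan_raise rz).
by apply: lspan_mono => u [w wu _]; exists s, w.
Qed.

Lemma wspan_split s P v : (wspan br ig) s P v ->
  exists v0 v1, [/\ par false v0, par true v1, (wspan br ig) s P v0, (wspan br ig) s P v1
    & v = v0 + v1].
Proof.
have ps := par_subspace lieL; have sW := @wspan_subspace _ A _ br ig s P.
apply: (lspan_sub (W := [set v | exists v0 v1, [/\ par false v0, par true v1,
  (wspan br ig) s P v0, (wspan br ig) s P v1 & v = v0 + v1]])).
  split.
    by exists 0, 0; split; rewrite ?addr0 //;
      first [exact: (subspace0 (ps _))|exact: (subspace0 sW)].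
  move=> a _ _ [x0 [x1 [px0 px1 Ix0 Ix1 ->]]] [y0 [y1 [py0 py1 Iy0 Iy1 ->]]].
  exists (a *: x0 + y0), (a *: x1 + y1); split.
  + by case: (ps false) => _; exact.
  + by case: (ps true) => _; exact.
  + by case: sW => _; exact.
  + by case: sW => _; exact.
  + by rewrite scalerDr addrACA.
move=> u [w wu Pw]; have [p pu] := word_par rz wu.
have Wu : (wspan br ig) s P u by exact: wspan_word wu Pw.
by case: p pu => pu; [exists 0, u|exists u, 0]; split; rewrite ?addr0 ?add0r //;
  first [exact: (subspace0 (ps _))|exact: (subspace0 sW)].
Qed.

(* The ideal generated by such a [v] lies in the nonzero degrees. *)
Lemma killed_eq0 s v : (wspan br ig) s (fun=> True) v ->
  (forall i q (y : cd_g A (~~ s) i), svpar q y -> br (ig y) v = 0) -> v = 0.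
Proof.
move=> wv kv; have [v0 [v1 [p0 p1 w0 w1 vE]]] := wspan_split wv.
have k01 i q (y : cd_g A (~~ s) i) : svpar q y ->
    br (ig y) v0 = 0 /\ br (ig y) v1 = 0.
  move=> qy; have := kv _ _ _ qy; rewrite vE (brDr lieL).
  have py := rz_g_parity rz qy.
  have b0 := lie_parity lieL py p0; have b1 := lie_parity lieL py p1.
  have z p : par p (0 : L) by exact: (subspace0 (par_subspace lieL p)).
  rewrite -[X in _ = X]addr0; case: q qy py b0 b1 => _ _ b0 b1.
    rewrite addrC => /(par_splitK lieL b1 b0 (z _) (z _)) [-> ->] //.
  by move=> /(par_splitK lieL b0 b1 (z _) (z _)) [-> ->].
have v00 : v0 = 0.
  by apply: (killed_homogeneous p0 w0) => i q y /k01[].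
have v10 : v1 = 0.
  by apply: (killed_homogeneous p1 w1) => i q y /k01[].
by rewrite vE v00 v10 addr0.
Qed.

End Killed.

(** * Generation and ideals of g(A) *)

Section GAlg.
Variables (K : numClosedFieldType) (A : cartan_datum K).
Local Notation n := (cd_n A).

(** By linear independence the matrix of values of the roots on a basis has full row rank, hence a
    right inverse. With all values equal to 1 this yields the grading element. *)
Lemma roots_separate (c : 'I_n -> K) :
  exists t : even_part (cd_h A), forall i, cd_root A i t = c i.
Proof.
pose b := vbasis {: even_part (cd_h A)}.
pose M := \matrix_(i < n, k < \dim {: even_part (cd_h A)}) (cd_root A i (tnth b k) : K).
have /row_freeP[B MB] : row_free M.
  apply: inj_row_free => u uM.
  have := cd_root_free A; set X := map _ _ => frX.
  have sX : size X = n by rewrite size_map size_enum_ord.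
  have /freeP/(_ (fun i => u 0 (cast_ord sX i))) h : free (in_tuple X) by [].
  suff : forall i : 'I_(size X), u 0 (cast_ord sX i) = 0.
    move=> h'; apply/rowP => i; rewrite mxE.
    by have := h' (cast_ord (esym sX) i); rewrite cast_ordKV.
  apply: h.
  have -> : \sum_(i < size X) u 0 (cast_ord sX i) *: (in_tuple X)`_i =
      \sum_(i < n) u 0 i *: cd_root A i.
    rewrite (reindex (cast_ord (esym sX))); last first.
      by exists (cast_ord sX) => i _; rewrite ?cast_ordK ?cast_ordKV.
    apply: eq_bigr => i _; rewrite cast_ordKV; congr (_ *: _).
    by rewrite (nth_map i) ?size_enum_ord //= nth_ord_enum.
  apply/lfunP => t; rewrite (coord_vbasis (memvf t)) linear_sum /= zero_lfunE /=.
  rewrite big1 // => k _; rewrite linearZ /= sum_lfunE.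
  have := congr1 (fun m : 'rV[K]_(\dim {: even_part (cd_h A)}) => m 0 k) uM.
  rewrite !mxE => e; rewrite (_ : \sum_(i < n) _ = 0) ?scaler0 //.
  rewrite -[RHS]e; apply: eq_bigr => i _; rewrite scale_lfunE !mxE.
  by rewrite (tnth_nth 0).
exists (\sum_k (\sum_i B k i * c i) *: tnth b k) => j.
rewrite linear_sum /=.
transitivity (((M *m B) *m (\col_i c i)) j 0); last by rewrite MB mul1mx mxE.
rewrite -mulmxA mxE; apply: eq_bigr => k _; rewrite linearZ /= !mxE mulrC.
by congr (_ * _); apply: eq_bigr => i _; rewrite mxE.
Qed.

Lemma gtilde_gen (W : set (gtilde A)) : subspace W ->
  (forall x y, W x -> W y -> W (gt_br x y)) -> (forall x, W (gt_h x)) ->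
  (forall s i (x : cd_g A s i), W (gt_g x)) -> forall v, W v.
Proof.
move=> sW Wb Wh Wg v; rewrite -(gt_reprK v); elim: (gt_repr v) => //.
- exact: (subspace0 sW).
- by move=> x Wx y Wy; rewrite gt_piD; exact: (subspaceD sW).
- by move=> a x Wx; rewrite gt_piZ; exact: (subspaceZ _ sW).
- by move=> x Wx y Wy; rewrite gt_piB; exact: Wb.
Qed.

Lemma galg_gen (W : set (galg A)) : subspace W ->
  (forall x y, W x -> W y -> W (g_br x y)) -> (forall x, W (g_h x)) ->
  (forall s i (x : cd_g A s i), W (g_g x)) -> forall v, W v.
Proof.
move=> sW Wb Wh Wg v; rewrite -(g_reprK v).
apply: (gtilde_gen (W := [set u | W (g_pi u)])) => //.
  exact: (subspace_preim (@g_pi_linear _ A)).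
by move=> x y Wx Wy /=; rewrite g_piB; exact: Wb.
Qed.

Let rzt := gt_realizes A.
Let rzg := g_realizes A.
Let liet := rz_lie rzt.
Let lieg := rz_lie rzg.

(** [max_ideal] is a span of ideals, so triviality on h has to be carried over to the sum. Each of
    these ideals contains the h-component of each of its elements, as it is stable under ad(t0);
    hence all of them, and their sum, lie in the span of the words. *)
Lemma max_ideal_trivial : trivial_on_h (@max_ideal _ A).
Proof.
have [t0 t0P] := roots_separate (fun=> 1).
move=> x Mx; apply: (ih_words rzt t0P).
apply: (lspan_sub (lspan_subspace _) _ Mx) => u [I [[[sI gI] iI] tI] Iu].
have [y [w [ww uE]]] := triangular_sum rzt gtilde_gen u.
have : I (gt_h y).
  by apply: (ih_component rzt t0P sI _ ww); [move=> v; exact: iI|rewrite -uE].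
by move=> /tI y0; rewrite uE y0 add0r.
Qed.

(** The preimage of [I] in [gtilde] is an ideal trivial on h, so it is contained in [max_ideal],
    that is, [I] is zero. *)
Lemma galg_ideal_trivial (I : set (galg A)) : is_ideal (@g_par _ A) (@g_br _ A) I ->
  (forall x, I (g_h x) -> g_h (A := A) x = 0) -> forall v, I v -> v = 0.
Proof.
move=> [[sI gI] iI] tI v Iv; pose J : set (gtilde A) := [set u | I (g_pi u)].
have Jmax : J `<=` @max_ideal _ A.
  move=> u Ju; apply: sub_lspan; exists J => //; split.
    split; last by move=> x y Jy; rewrite /J /= g_piB; exact: iI.
    split; first exact: (subspace_preim (@g_pi_linear _ A)).
    move=> w Jw; have [w0 [w1 [p0 p1 wE]]] := par_split liet w.
    have [i0 [i1 [q0 q1 I0 I1 iE]]] := gI _ Jw.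
    have g0 : g_par false (g_pi w0) by exists w0.
    have g1 : g_par true (g_pi w1) by exists w1.
    have e : g_pi w0 + g_pi w1 = i0 + i1.
      by rewrite -iE wE (is_linearD (@g_pi_linear _ A)).
    have [e0 e1] := par_splitK lieg g0 g1 q0 q1 e.
    by exists w0, w1; split=> //; rewrite /J /= ?e0 ?e1.
  move=> x Jx; apply: max_ideal_trivial.
  have /tI : I (g_h x) by [].
  move=> x0; have : g_pi (gt_h x) = g_pi 0 by rewrite (is_linear0 (@g_pi_linear _ A)).
  by move/g_piP; rewrite subr0.
rewrite -(g_reprK v) -(is_linear0 (@g_pi_linear _ A)); apply/g_piP.
by rewrite subr0; apply: Jmax; rewrite /J /= g_reprK.
Qed.

End GAlg.

(** * Operators satisfying rank one relations *)

Section Sl2.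
Variables (K : numFieldType) (V : lmodType K) (e f h : V -> V).
Hypotheses (le : is_linear e) (lf : is_linear f).
Hypothesis ef : forall v, e (f v) = f (e v) + h v.
Hypothesis he : forall a v, h v = a *: v -> h (e v) = (a + 2) *: e v.
Hypothesis hf : forall a v, h v = a *: v -> h (f v) = (a - 2) *: f v.

Lemma sl2_weight_f a k v : h v = a *: v ->
  h (iter k f v) = (a - 2 * k%:R) *: iter k f v.
Proof.
move=> hv; elim: k => [|k IH] /=; first by rewrite mulr0 subr0.
by rewrite (hf IH); congr (_ *: _); rewrite -natr1; ring.
Qed.

Lemma iter_linear0 (g : V -> V) k : is_linear g -> iter k g 0 = 0.
Proof. by move=> lg; elim: k => //= k ->; exact: (is_linear0 lg). Qed.

Lemma sl2_e_iter_f a k v : h v = a *: v ->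
  e (iter k.+1 f v) = iter k.+1 f (e v) + (k.+1%:R * (a - k%:R)) *: iter k f v.
Proof.
move=> hv; elim: k => [|k IH]; first by rewrite /= ef hv mul1r subr0.
rewrite iterS ef IH (is_linearD lf) (is_linearZ lf) -addrA; congr (_ + _).
rewrite (sl2_weight_f k.+1 hv) -scalerDl; congr (_ *: _).
by rewrite -!natr1; ring.
Qed.

(** If f^N v is the last nonzero vector of the string, then 0 = e f^(N+1) v = (N+1)(a - N) f^N v. *)
Lemma sl2_highest_weight a v N : h v = a *: v -> e v = 0 -> v != 0 ->
  iter N f v = 0 -> exists2 k : nat, a = k%:R & iter k.+1 f v = 0.
Proof.
move=> hv ev v0; elim: N => [/= vz|N IH]; first by rewrite vz eqxx in v0.
have [//|nz fN] := eqVneq (iter N f v) 0; first by move=> z _; exact: IH.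
exists N => //; have := sl2_e_iter_f N hv.
rewrite fN (is_linear0 le) ev (iter_linear0 _ lf) add0r => /esym/eqP.
rewrite scaler_eq0 (negPf nz) orbF mulf_eq0 pnatr_eq0 /= subr_eq0.
by move/eqP.
Qed.

(** Induction on the nilpotency exponent of e: the vector e v has weight m + 2 and is killed by
    f^(k+1), so it vanishes. Then [v] is a highest weight vector, and for 0 < k <= m the vector e
    f^k v is a nonzero multiple of f^(k-1) v. *)
Lemma sl2_inj m k N v : h v = m%:R *: v -> iter N e v = 0 -> (k <= m)%N ->
  iter k f v = 0 -> v = 0.
Proof.
elim: N m k v => [//|N IH] m k v hv eN km fk.
have ev : e v = 0.
  apply: (IH m.+2 k.+1).
  - by rewrite (he hv) -natrD addn2.
  - by rewrite -iterSr.
  - lia.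
  - have := sl2_e_iter_f k hv; rewrite [iter k.+1 f v]iterS fk scaler0 addr0.
    by rewrite (is_linear0 lf) (is_linear0 le).
elim: k km fk => [//|k IHk] km fk; apply: IHk; first lia.
have := sl2_e_iter_f k hv.
rewrite fk (is_linear0 le) ev (iter_linear0 _ lf) add0r => /esym/eqP.
rewrite scaler_eq0 mulf_eq0 pnatr_eq0 /= subr_eq0 eqr_nat => /orP[/eqP mk|/eqP //].
lia.
Qed.

End Sl2.

Section Osp.
Variables (K : numFieldType) (V : lmodType K) (e f h : V -> V).
Hypotheses (le : is_linear e) (lf : is_linear f).
Hypothesis ef : forall v, e (f v) + f (e v) = h v.
Hypothesis he : forall a v, h v = a *: v -> h (e v) = (a + 1) *: e v.

Lemma osp_weight_e a k v : h v = a *: v -> h (iter k e v) = (a + k%:R) *: iter k e v.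
Proof.
move=> hv; elim: k => [|k IH] /=; first by rewrite addr0.
by rewrite (he IH) -natr1 addrA.
Qed.

Lemma osp_f_iter_e a k v : h v = a *: v -> f v = 0 ->
  f (iter k.*2.+1 e v) = (a + k%:R) *: iter k.*2 e v /\
  f (iter k.*2.+2 e v) = k.+1%:R *: iter k.*2.+1 e v.
Proof.
move=> hv fv.
have fe w : f (e w) = h w - e (f w) by rewrite -ef addrAC subrr add0r.
have step j : f (iter j.*2.+1 e v) = (a + j%:R) *: iter j.*2 e v ->
    f (iter j.*2.+2 e v) = j.+1%:R *: iter j.*2.+1 e v.
  move=> H; rewrite [iter j.*2.+2 e v]iterS fe H (is_linearZ le).
  rewrite (osp_weight_e j.*2.+1 hv) -iterS -scalerBl; congr (_ *: _).
  by rewrite -!natr1 -mul2n natrM; ring.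
elim: k => [|k [IH1 IH2]].
  suff H : f (iter 0.*2.+1 e v) = (a + 0%:R) *: iter 0.*2 e v by split=> //; exact: step.
  by rewrite /= fe hv fv (is_linear0 le) subr0 addr0.
suff H : f (iter k.+1.*2.+1 e v) = (a + k.+1%:R) *: iter k.+1.*2 e v.
  by split=> //; exact: step.
rewrite doubleS iterS fe IH2 (is_linearZ le) (osp_weight_e k.*2.+2 hv) -iterS.
rewrite -scalerBl; congr (_ *: _).
by rewrite -!natr1 -mul2n natrM; ring.
Qed.

(** The first vanishing power of e is odd: for an even power the coefficient k + 1 in [osp_f_iter_e]
    is never zero, whereas for an odd one it is a + k. *)
Lemma osp_lowest_weight a v N : h v = a *: v -> f v = 0 -> v != 0 ->
  iter N e v = 0 -> exists2 k : nat, a = - k%:R & iter k.*2.+1 e v = 0.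
Proof.
move=> hv fv v0; elim: N => [/= vz|N IH]; first by rewrite vz eqxx in v0.
have [z _|nz eN] := eqVneq (iter N e v) 0; first exact: IH.
have [[j jE]|[j jE]] : (exists k, N = k.*2) \/ (exists k, N = k.*2.+1).
- by case oN: (odd N); [right|left]; exists N./2; lia.
- exists j; last by rewrite -jE.
  have [+ _] := osp_f_iter_e j hv fv.
  rewrite -jE eN (is_linear0 lf) => /esym/eqP.
  by rewrite scaler_eq0 (negPf nz) orbF addr_eq0 => /eqP.
- have [_ +] := osp_f_iter_e j hv fv.
  rewrite -jE eN (is_linear0 lf) => /esym/eqP.
  by rewrite scaler_eq0 (negPf nz) orbF pnatr_eq0.
Qed.

End Osp.

(** Along the e-string of [v] the commutator [f, e] is the scalar c, so f e^(k+1) v = (k+1) c e^k v;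
    in characteristic zero the string cannot end unless c = 0. *)
Lemma heisenberg_nilpotent (K : numFieldType) (V : lmodType K) (e f : V -> V)
    (c : K) v N : is_linear e -> is_linear f ->
  (forall k, f (e (iter k e v)) = e (f (iter k e v)) + c *: iter k e v) ->
  f v = 0 -> iter N e v = 0 -> v != 0 -> c = 0.
Proof.
move=> le lf fe fv eN v0.
have H k : f (iter k.+1 e v) = (k.+1%:R * c) *: iter k e v.
  elim: k => [|k IH]; first by have /= -> := fe 0%N; rewrite fv (is_linear0 le) add0r mul1r.
  rewrite iterS fe IH (is_linearZ le) -iterS -scalerDl; congr (_ *: _).
  by rewrite -!natr1; ring.
elim: N eN => [/= vz|N IH eN]; first by rewrite vz eqxx in v0.
have [/IH //|nz] := eqVneq (iter N e v) 0.
have := H N; rewrite eN (is_linear0 lf) => /esym/eqP.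
by rewrite scaler_eq0 (negPf nz) orbF mulf_eq0 pnatr_eq0 => /eqP.
Qed.

(** * Takiff superalgebras *)

Local Arguments smx_part : simpl never.

Section SuperMatrices.
Variables (K : fieldType) (m n : nat).
Implicit Types x y : 'M[K]_(m + n).

Lemma smx_part_linear p : is_linear (@smx_part K m n p).
Proof.
move=> a x y; rewrite /smx_part; case: p; rewrite scale_block_mx add_block_mx.
  by congr block_mx; apply/matrixP=> i j; rewrite !mxE ?mulr0 ?addr0.
by congr block_mx; apply/matrixP=> i j; rewrite !mxE ?mulr0 ?addr0.
Qed.

Lemma supertrace_linear : is_linear (@supertrace K m n : _ -> K^o).
Proof.
move=> a x y; rewrite /supertrace.
have -> : ulsubmx (a *: x + y) = a *: ulsubmx x + ulsubmx y.
  by apply/matrixP=> i j; rewrite !mxE.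
have -> : drsubmx (a *: x + y) = a *: drsubmx x + drsubmx y.
  by apply/matrixP=> i j; rewrite !mxE.
by rewrite !linearP /= scalerBr opprD addrACA.
Qed.

Lemma smx_partK x : smx_part false x + smx_part true x = x.
Proof. by rewrite /smx_part add_block_mx !addr0 !add0r submxK. Qed.

Lemma smx_part_id p x : smx_part p (smx_part p x) = smx_part p x.
Proof.
by case: p; rewrite /smx_part ?block_mxKul ?block_mxKdr ?block_mxKur ?block_mxKdl.
Qed.

Lemma smx_part_opp p x : smx_part p x = x -> smx_part (~~ p) x = 0.
Proof.
move=> <-; case: p; rewrite /smx_part ?block_mxKul ?block_mxKdr ?block_mxKur ?block_mxKdl;
by rewrite -[RHS](@block_mx_const _ m n m n).
Qed.

Lemma smx_part0 p : smx_part p (0 : 'M[K]_(m + n)) = 0.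
Proof. exact: (is_linear0 (smx_part_linear p)). Qed.

Lemma supercomm_par p q x y : smx_part p x = x -> smx_part q y = y ->
  supercomm x y = x *m y - koszul K p q *: (y *m x).
Proof.
move=> px qy; have px' := smx_part_opp px; have qy' := smx_part_opp qy.
rewrite /supercomm !big_bool.
by case: p q px qy px' qy' => [] [] /= -> -> -> ->;
  rewrite ?mulmx0 ?mul0mx ?scaler0 ?subrr ?addr0 ?add0r.
Qed.

Lemma supercomm0l y : supercomm (0 : 'M[K]_(m + n)) y = 0.
Proof.
rewrite /supercomm big1 // => p _; rewrite big1 // => q _.
by rewrite smx_part0 mul0mx mulmx0 scaler0 subrr.
Qed.

Lemma supercomm0r x : supercomm x (0 : 'M[K]_(m + n)) = 0.
Proof.
rewrite /supercomm big1 // => p _; rewrite big1 // => q _.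
by rewrite smx_part0 mul0mx mulmx0 scaler0 subrr.
Qed.

Lemma smx_sign0 : smx_sign (0 : 'M[K]_(m + n)) = 0.
Proof. by rewrite /smx_sign !smx_part0 subrr. Qed.

Lemma smx_part_scalar (a : K) : smx_part false (a%:M : 'M[K]_(m + n)) = a%:M.
Proof.
by rewrite scalar_mx_block /smx_part block_mxKul block_mxKdr.
Qed.

Lemma smx_sign_scalar (a : K) : smx_sign (a%:M : 'M[K]_(m + n)) = a%:M.
Proof.
by rewrite /smx_sign (smx_part_opp (p := false)) smx_part_scalar ?subr0.
Qed.

Lemma supercomm_scalarl (a : K) y : supercomm (a%:M : 'M[K]_(m + n)) y = 0.
Proof.
have a1 := smx_part_opp (smx_part_scalar a).
rewrite /supercomm big1 // => -[] _; rewrite big1 // => q _.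
  by rewrite a1 mul0mx mulmx0 scaler0 subrr.
by rewrite smx_part_scalar /koszul expr0 scale1r scalar_mxC subrr.
Qed.

Lemma supercomm_scalarr (a : K) x : supercomm x (a%:M : 'M[K]_(m + n)) = 0.
Proof.
have a1 := smx_part_opp (smx_part_scalar a).
rewrite /supercomm big1 // => p _; rewrite big1 // => -[] _.
  by rewrite a1 mul0mx mulmx0 scaler0 subrr.
by rewrite smx_part_scalar /koszul andbF expr0 scale1r scalar_mxC subrr.
Qed.

Lemma supertrace0 : supertrace (0 : 'M[K]_(m + n)) = 0.
Proof. exact: (is_linear0 supertrace_linear). Qed.

Lemma supertrace_part p x : supertrace x = 0 -> supertrace (smx_part p x) = 0.
Proof.
case: p; rewrite /supertrace /smx_part ?block_mxKul ?block_mxKdr //.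
by rewrite !linear0 subrr.
Qed.

Lemma takiff_split p (u : takiff_space K m n) : takiff (@sl_super K m n) u ->
  exists u0 u1, [/\ takiff (@sl_super K m n) u0, takiff (@sl_super K m n) u1,
    takiff_par p u0, takiff_par (~~ p) u1 & u = u0 + u1].
Proof.
case: u => -[x y] z [/= sx sy].
(* The coefficient of xi takes the opposite parity because xi is odd; c belongs to the even part. *)
pose P q : takiff_space K m n := (smx_part q x, smx_part (~~ q) y, if q then 0 else z).
have PT q : takiff (@sl_super K m n) (P q).
  by split; rewrite /= /sl_super /=; exact: supertrace_part.
have Pp q : takiff_par q (P q).
  by split; rewrite /P /= ?smx_part_id //; move=> ->.
exists (P p), (P (~~ p)); split=> //.
case: p; congr (_, _, _); rewrite /= ?addr0 ?add0r ?smx_partK //.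
  by rewrite addrC smx_partK.
by rewrite addrC smx_partK.
Qed.

Lemma takiff_br_central a (z : K) (w : takiff_space K m n) :
  takiff_br ((a%:M, 0, z) : takiff_space K m n) w = 0.
Proof.
rewrite /takiff_br /= supercomm_scalarl supercomm_scalarl supercomm0l addr0.
by rewrite mul0mx supertrace0.
Qed.

(** Says that the odd part of ts is at least two-dimensional modulo the centre, a property inherited
    by central quotients. *)
Definition odd_pair (s : set 'M[K]_(m + n)) := exists u1 u2 : takiff_space K m n,
  [/\ takiff s u1, takiff s u2, takiff_par true u1, takiff_par true u2 &
   forall a b, (forall v, takiff s v -> takiff_br (a *: u1 + b *: u2) v = 0) ->
     a = 0 /\ b = 0].

Variables (L : lmodType K) (par : bool -> set L) (br : L -> L -> L) (W : set L).
Hypothesis lieL : is_lie_super par br.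

Lemma central_quotient_odd s F : (forall a u v, s u -> s v -> s (a *: u + v)) ->
  s 0 -> odd_pair s -> is_central_quotient s par br W ->
  (forall x : L, W x -> par true x -> exists a, x = a *: F) -> False.
Proof.
move=> sL s0 [u1 [u2 [t1 t2 p1 p2 ind]]] [phi [lp pp bp im ker]] WF.
have phiF u : takiff s u -> takiff_par true u -> exists a, phi u = a *: F.
  by move=> tu pu; apply: WF; [rewrite -im; exists u|exact: pp].
have [c1 e1] := phiF _ t1 p1; have [c2 e2] := phiF _ t2 p2.
have tk a b : takiff s (a *: u1 + b *: u2).
  case: t1 t2 => t11 t12 [t21 t22]; split=> /=; apply: (sL _ _ _) => //.
    by rewrite -[_ *: _]addr0; exact: (sL _ _ _).
  by rewrite -[_ *: _]addr0; exact: (sL _ _ _).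
have ph a b : phi (a *: u1 + b *: u2) = (a * c1 + b * c2) *: F.
  by rewrite lp (is_linearZ lp) e1 e2 !scalerA -scalerDl.
have z a b : a * c1 + b * c2 = 0 -> a = 0 /\ b = 0.
  by move=> e; apply: ind; apply: ker => //; rewrite ph e scale0r.
(* Since u1 and u2 map to c1 F and c2 F, the combination c2 u1 - c1 u2 maps to zero, whence c1 = c2
   = 0; but then u1 maps to zero as well. *)
have [|c20 c10] := z c2 (- c1); first by rewrite mulrC mulNr subrr.
have [|/eqP] := z 1 0; last by rewrite oner_eq0.
by rewrite mul0r addr0 mul1r; apply/eqP; rewrite -oppr_eq0 c10.
Qed.

Lemma central_quotient_par p (x : L) phi : is_linear phi ->
  (forall p u, takiff (@sl_super K m n) u -> takiff_par p u -> par p (phi u)) ->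
  phi @` takiff (@sl_super K m n) = W -> W x -> par p x ->
  exists u, [/\ takiff (@sl_super K m n) u, takiff_par p u & phi u = x].
Proof.
move=> lp pp im Wx px; have [u tu ux] : (phi @` takiff (@sl_super K m n)) x by rewrite im.
have [u0 [u1 [t0 t1 p0 p1 uE]]] := takiff_split p tu.
exists u0; split=> //; have q0 := pp _ _ t0 p0; have q1 := pp _ _ t1 p1.
move: ux; rewrite uE (is_linearD lp) => e.
have z : phi u1 = 0.
  apply: (par_disj lieL (p := p)) => //.
  have -> : phi u1 = x - phi u0 by rewrite -e addrAC subrr add0r.
  exact: (subspaceB (par_subspace lieL p)).
by rewrite -e z addr0.
Qed.

(** Applied to [E_i, F_i] or [e_i, f_i] acting on g_{alpha_i}, it shows that the corresponding
    diagonal coefficients vanish. *)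
Lemma central_quotient_central p (x y z : L) :
  is_central_quotient (@sl_super K m n) par br W ->
  (forall u v w : takiff_space K m n, takiff (@sl_super K m n) u ->
     takiff (@sl_super K m n) v -> takiff_par p u -> takiff_par p v ->
     takiff (@sl_super K m n) (takiff_br u v) /\ takiff_br (takiff_br u v) w = 0) ->
  W x -> W y -> W z -> par p x -> par p y -> br (br x y) z = 0.
Proof.
move=> cq H Wx Wy; case: (cq) => phi [lp pp bp im ker].
rewrite -{1}im => -[w tw <-] px py.
have [u [tu pu <-]] := central_quotient_par lp pp im Wx px.
have [v [tv pv <-]] := central_quotient_par lp pp im Wy py.
have [tb bz] := H u v w tu tv pu pv.
by rewrite -!bp // bz (is_linear0 lp).
Qed.

End SuperMatrices.

Lemma sl_super_linear (K : fieldType) m n (a : K) u v :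
  sl_super (m := m) (n := n) u -> sl_super v -> sl_super (a *: u + v).
Proof.
rewrite /sl_super /= => u0 v0; have := supertrace_linear a u v.
by rewrite u0 v0 scaler0 addr0.
Qed.

Lemma sl_super0 (K : fieldType) m n : @sl_super K m n 0.
Proof. exact: supertrace0. Qed.

Lemma smx_part_sl2 (K : fieldType) (x : 'M[K]_(2 + 0)) : smx_part true x = 0.
Proof.
by rewrite /smx_part [ursubmx x]thinmx0 [dlsubmx x]flatmx0 -[RHS](@block_mx_const _ 2 0 2 0).
Qed.

Lemma smx_part_sl2F (K : fieldType) (x : 'M[K]_(2 + 0)) : smx_part false x = x.
Proof. by rewrite -[RHS]smx_partK smx_part_sl2 addr0. Qed.

(** Since sl(2) is purely even, odd elements have the form y xi, and their brackets are multiples of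
    c. *)
Lemma takiff_sl2_central (K : fieldType) (u v w : takiff_space K 2 0) :
  takiff (@sl_super K 2 0) u -> takiff (@sl_super K 2 0) v ->
  takiff_par true u -> takiff_par true v ->
  takiff (@sl_super K 2 0) (takiff_br u v) /\ takiff_br (takiff_br u v) w = 0.
Proof.
case: u v => -[x y] z [[x' y'] z'] _ _ [/= e1 _ _] [/= e2 _ _].
rewrite smx_part_sl2 in e1; rewrite smx_part_sl2 in e2; subst x x'; rewrite /takiff_br /= !(supercomm0l, supercomm0r, smx_sign0).
rewrite addr0; split; first by split; exact: sl_super0.
rewrite !(supercomm0l, supercomm0r, smx_sign0) addr0 mul0mx supertrace0 //.
Qed.

Lemma odd_pair_sl2 (K : numFieldType) : odd_pair (@sl_super K 2 0).
Proof.
pose o0 : 'I_(2 + 0) := ord0; pose o1 : 'I_(2 + 0) := ord_max.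
pose e : 'M[K]_(2 + 0) := delta_mx o0 o1; pose f : 'M[K]_(2 + 0) := delta_mx o1 o0.
have tr0 (x : 'M[K]_(2 + 0)) : x o0 o0 = 0 -> x o1 o1 = 0 -> sl_super x.
  move=> x0 x1; rewrite /sl_super /= /supertrace [drsubmx x]flatmx0 linear0 subr0.
  rewrite /mxtrace !big_ord_recl big_ord0 addr0 !mxE.
  by rewrite -[RHS]addr0 -{1}x0 -x1; congr (x _ _ + x _ _); apply: val_inj.
have se : sl_super e by apply: tr0; rewrite !mxE.
have sf : sl_super f by apply: tr0; rewrite !mxE.
exists (0, e, 0), (0, f, 0); split.
- by split=> //; exact: sl_super0.
- by split=> //; exact: sl_super0.
- by split; rewrite /= ?smx_part0 ?smx_part_sl2F.
- by split; rewrite /= ?smx_part0 ?smx_part_sl2F.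
move=> a b H.
have sc (x y : 'M[K]_(2 + 0)) : supercomm x y = x *m y - y *m x.
  by rewrite (supercomm_par (p := false) (q := false)) ?smx_part_sl2F // /koszul expr0 scale1r.
have sg (x : 'M[K]_(2 + 0)) : smx_sign x = x.
  by rewrite /smx_sign smx_part_sl2F smx_part_sl2 subr0.
have H' v : sl_super v -> (a *: e + b *: f) *m v - v *m (a *: e + b *: f) = 0.
  move=> sv; have := congr1 (fun w : takiff_space K 2 0 => w.1.2)
    (H (v, 0, 0) (conj sv (@sl_super0 _ _ _))).
  by rewrite /takiff_br /= !scaler0 !addr0 !supercomm0l add0r sg sc.
split.
  have := H' _ sf; rewrite mulmxDl mulmxDr -!scalemxAl -!scalemxAr.
  rewrite !(mul_delta_mx, mul_delta_mx_0) // => /matrixP/(_ o0 o0).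
  by rewrite !mxE /= !(mulr0, mulr1, addr0, subr0).
have := H' _ se; rewrite mulmxDl mulmxDr -!scalemxAl -!scalemxAr.
rewrite !(mul_delta_mx, mul_delta_mx_0) // => /matrixP/(_ o1 o1).
by rewrite !mxE /= !(mulr0, mulr1, addr0, add0r, subr0).
Qed.

Lemma sl11_scalar (K : fieldType) (x : 'M[K]_(1 + 1)) :
  sl_super x -> smx_part false x = x -> exists a, x = a%:M.
Proof.
rewrite /sl_super /= /supertrace => /subr0_eq tr <-.
exists (\tr (ulsubmx x)); rewrite scalar_mx_block /smx_part.
congr block_mx; first by rewrite trace_mx11 -mx11_scalar.
by rewrite tr trace_mx11 -mx11_scalar.
Qed.

(** The even part of sl(1|1) consists of scalar matrices, which are central; for equal parities the
    bracket has no xi-term and is a scalar matrix plus a multiple of c. *)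
Lemma takiff_sl11_central (K : fieldType) p (u v w : takiff_space K 1 1) :
  takiff (@sl_super K 1 1) u -> takiff (@sl_super K 1 1) v ->
  takiff_par p u -> takiff_par p v ->
  takiff (@sl_super K 1 1) (takiff_br u v) /\ takiff_br (takiff_br u v) w = 0.
Proof.
move=> tu tv pu pv; have [a [z ->]] : exists a z, takiff_br u v = (a%:M, 0, z).
  case: u v tu tv pu pv => -[x y] z [[x' y'] z'] [/= sx sy] [/= sx' sy'].
  case: p => -[/= px py _] [/= px' py' _]; last first.
    have [a ->] := sl11_scalar sx px; have [a' ->] := sl11_scalar sx' px'.
    rewrite /takiff_br /= supercomm_scalarl smx_sign_scalar.
    rewrite supercomm_scalarl supercomm_scalarr addr0.
    by exists 0; eexists; rewrite raddf0.
  have [a ->] := sl11_scalar sy py; have [a' ->] := sl11_scalar sy' py'.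
  rewrite /takiff_br /= supercomm_scalarl supercomm_scalarr addr0.
  rewrite (supercomm_par px px') -px -px' /smx_part /koszul /= expr1 scaleN1r opprK.
  rewrite !mulmx_block !mulmx0 !mul0mx !addr0 !add0r add_block_mx !addr0.
  move: (ursubmx x) (dlsubmx x) (ursubmx x') (dlsubmx x') => r c r' c'.
  exists (r 0 0 * c' 0 0 + r' 0 0 * c 0 0); eexists; congr (_, _, _).
  rewrite scalar_mx_block; congr block_mx; apply/matrixP => i j;
    rewrite !ord1 !mxE !big_ord_recl !big_ord0 !addr0 /= ?mulr1n //.
  by rewrite addrC [c 0 0 * _]mulrC [c' 0 0 * _]mulrC.
rewrite takiff_br_central; split=> //; split; last exact: sl_super0.
rewrite /sl_super /= scalar_mx_block /supertrace block_mxKul block_mxKdr.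
by rewrite subrr.
Qed.

Lemma odd_pair_sl11 (K : numFieldType) : odd_pair (@sl_super K 1 1).
Proof.
pose e : 'M[K]_(1 + 1) := block_mx 0 1%:M 0 0.
pose f : 'M[K]_(1 + 1) := block_mx 0 0 1%:M 0.
have se : sl_super e.
  by rewrite /sl_super /= /supertrace block_mxKul block_mxKdr linear0 subrr.
have sf : sl_super f.
  by rewrite /sl_super /= /supertrace block_mxKul block_mxKdr linear0 subrr.
have pe : smx_part true e = e by rewrite /smx_part block_mxKur block_mxKdl.
have pf : smx_part true f = f by rewrite /smx_part block_mxKur block_mxKdl.
exists (e, 0, 0), (f, 0, 0); split.
- by split=> //; exact: sl_super0.
- by split=> //; exact: sl_super0.
- by split; rewrite /= ?smx_part0.
- by split; rewrite /= ?smx_part0.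
move=> a b H.
have pu : smx_part true (a *: e + b *: f) = a *: e + b *: f.
  by rewrite (smx_part_linear _ _) (is_linearZ (smx_part_linear _)) pe pf.
have H' v : sl_super v -> smx_part true v = v ->
    (a *: e + b *: f) *m v + v *m (a *: e + b *: f) = 0.
  move=> sv pv; have := congr1 (fun w : takiff_space K 1 1 => w.1.1)
    (H (v, 0, 0) (conj sv (@sl_super0 _ _ _))).
  rewrite /takiff_br /= => /eqP; rewrite (supercomm_par pu pv).
  by rewrite /koszul expr1 scaleN1r opprK => /eqP.
have uE : a *: e + b *: f = block_mx 0 a%:M b%:M 0.
  by rewrite !scale_block_mx add_block_mx !scaler0 !addr0 !add0r !scale_scalar_mx !mulr1.
have ce := H' _ se pe; have cf := H' _ sf pf.
move: ce cf; rewrite uE !mulmx_block !mulmx0 !mul0mx !addr0 !add0r !mulmx1 !mul1mx.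
rewrite !add_block_mx => /(congr1 ulsubmx) + /(congr1 ulsubmx).
rewrite !block_mxKul !addr0 !add0r => /matrixP/(_ 0 0) + /matrixP/(_ 0 0).
by rewrite !mxE.
Qed.

(** * Odd elements of osp(1|2) *)

Section Osp.
Variable K : numFieldType.

Let J : 'M[K]_2 :=
  \matrix_(i, j) (if (i < j)%N then 1 else if (j < i)%N then -1 else 0).

Lemma trJ : J^T = - J.
Proof.
apply/matrixP => i j; rewrite !mxE.
by case: ltngtP; rewrite ?oppr0 ?opprK.
Qed.

Lemma JJ : J *m J = - 1%:M.
Proof.
apply/matrixP => i j; rewrite !mxE !big_ord_recl big_ord0 !mxE addr0.
case: (unliftP ord0 i) => [i' ->|->]; case: (unliftP ord0 j) => [j' ->|->] /=;
  rewrite ?ord1 /= ?(mulr0, mul0r, mulr1, mul1r, addr0, add0r, oppr0) //.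
Qed.

(** The odd part of osp(1|2) is parametrized by the lower left column; invariance of the form
    dictates the upper row. *)
Definition osp_odd (c : 'cV[K]_2) : 'M[K]_(1 + 2) :=
  block_mx 0 (- (c^T *m J)) c 0.

Lemma osp_odd_par c : smx_part true (osp_odd c) = osp_odd c.
Proof. by rewrite /smx_part block_mxKur block_mxKdl. Qed.

Lemma osp_odd_in c : osp12 (osp_odd c).
Proof.
move=> p q u v; case: p; last first.
  rewrite (smx_part_opp (p := true)) ?osp_odd_par // !mul0mx trmx0 !mul0mx.
  by rewrite mulmx0 scaler0 addr0.
rewrite osp_odd_par /osp12_form -/J -[v]vsubmxK /koszul.
set v1 := usubmx v; set v2 := dsubmx v; case: q; rewrite /scol_part /= ?expr1 ?expr0.
  rewrite /osp_odd !mul_block_col !mulmx0 !mul0mx !addr0 !add0r.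
  rewrite !tr_col_mx !trmx0 !mul_row_block !mulmx0 !mul0mx !addr0 !add0r.
  rewrite !mul_row_col !mul0mx !addr0 !add0r mulmx1 scaleN1r.
  rewrite trmx_mul linearN /= trmx_mul trmxK trJ mulNmx opprK !mulmxA.
  by rewrite subrr.
rewrite /osp_odd !mul_block_col !mulmx0 !mul0mx !addr0 !add0r.
rewrite !tr_col_mx !trmx0 !mul_row_block !mulmx0 !mul0mx !addr0 !add0r.
rewrite !mul_row_col !mul0mx !addr0 !add0r mulmx1 scale1r.
by rewrite trmx_mul mulNmx mulmxN !mulmxA subrr.
Qed.

Lemma osp12_linear (a : K) u v : osp12 u -> osp12 v -> osp12 (a *: u + v).
Proof.
move=> ou ov p q x y; rewrite (smx_part_linear _ _) !mulmxDl.
rewrite [(_ + _)^T]linearD !mulmxDl mulmxDr scalerDr addrACA.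
rewrite [X in _ + X]ov addr0.
rewrite -!scalemxAl linearZ /= -!scalemxAl -scalemxAr scalerA mulrC -scalerA.
by rewrite -scalerDr ou scaler0.
Qed.

Lemma osp120 : osp12 (0 : 'M[K]_(1 + 2)).
Proof.
move=> p q x y; rewrite smx_part0 !mul0mx trmx0 !mul0mx mulmx0 scaler0.
exact: addr0.
Qed.

(** The bracket with [osp_odd c1] has lower right block -(c c1^T + c1 c^T) J. As J is invertible,
    the symmetric factor vanishes, and its first column is (2a, b). *)
Lemma odd_pair_osp12 : odd_pair (@osp12 K).
Proof.
pose c1 : 'cV[K]_2 := delta_mx 0 0; pose c2 : 'cV[K]_2 := delta_mx 1 0.
exists (osp_odd c1, 0, 0), (osp_odd c2, 0, 0); split.
- by split; [exact: osp_odd_in|exact: osp120].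
- by split; [exact: osp_odd_in|exact: osp120].
- by split; rewrite /= ?smx_part0 ?osp_odd_par.
- by split; rewrite /= ?smx_part0 ?osp_odd_par.
move=> a b H; set c := a *: c1 + b *: c2.
have uE : a *: osp_odd c1 + b *: osp_odd c2 = osp_odd c.
  rewrite /osp_odd !scale_block_mx add_block_mx !scaler0 !addr0; congr block_mx => //.
  by rewrite /c linearD !linearZ /= mulmxDl -!scalemxAl opprD !scalerN.
have := congr1 (fun w : takiff_space K 1 2 => w.1.1)
  (H (osp_odd c1, 0, 0) (conj (osp_odd_in c1) osp120)).
rewrite /takiff_br /= uE => /eqP.
rewrite (supercomm_par (osp_odd_par _) (osp_odd_par _)) /koszul expr1 scaleN1r opprK.
rewrite !mulmx_block !mulmx0 !mul0mx !addr0 !add0r add_block_mx => /eqP/(congr1 drsubmx).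
rewrite block_mxKdr !mulmxN !mulmxA -opprD -mulmxDl => /eqP.
have -> : drsubmx (0 : 'M[K]_(1 + 2)) = 0 by apply/matrixP=> i j; rewrite !mxE.
rewrite oppr_eq0 => /eqP/(congr1 (mulmx^~ J)).
rewrite -mulmxA JJ mul0mx mulmxN mulmx1 => /eqP; rewrite oppr_eq0 => /eqP M0.
have e00 := congr1 (fun M : 'M[K]_2 => M 0 0) M0.
have e10 := congr1 (fun M : 'M[K]_2 => M 1 0) M0.
move: e00 e10; rewrite !mxE !big_ord_recl !big_ord0 !mxE /=.
rewrite !(mulr0, mul0r, mulr1, mul1r, addr0, add0r) => e00 e10; split=> //.
by move/eqP: e00; rewrite -mulr2n mulrn_eq0 /= => /eqP.
Qed.

End Osp.

(** * Modules over quasi-toral algebras of rank two weight *)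

Definition ev (K : fieldType) (h : quasi_toral K) (t : even_part h) : h := (t, 0).
Definition od (K : fieldType) (h : quasi_toral K) (x : odd_part h) : h := (0, x).

Section QuasiToral.
Variables (K : fieldType) (h : quasi_toral K).

Lemma ev_par (t : even_part h) : svpar false (ev t).
Proof. by []. Qed.
Lemma od_par (x : odd_part h) : svpar true (od x).
Proof. by []. Qed.
Lemma od_linear : is_linear (@od K h).
Proof. by move=> a x y; congr (_, _); rewrite /= scaler0 addr0. Qed.
Lemma ev_od (x : h) : x = ev x.1 + od x.2.
Proof. by case: x => a b; congr (_, _); rewrite /= ?addr0 ?add0r. Qed.
Lemma svpar_ev (x : h) : svpar false x -> x = ev x.1.
Proof. by case: x => a b; rewrite /svpar /= => ->. Qed.
Lemma svpar_od (x : h) : svpar true x -> x = od x.2.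
Proof. by case: x => a b; rewrite /svpar /= => ->. Qed.

Lemma svpar_subspace (V : superspace K) p : subspace (@svpar K V p).
Proof.
split; first by rewrite /svpar /=; case: p.
by move=> a u v; rewrite /svpar /=; case: p => /= -> ->; rewrite scaler0 addr0.
Qed.

Lemma qt_ev (x : h) (t : even_part h) : qt_br x (ev t) = 0.
Proof.
have lie := qt_lie h; rewrite (ev_od x) (brDl lie) qt_central // add0r.
rewrite (lie_skew lie (od_par x.2) (ev_par t)) qt_central //.
exact: scaler0.
Qed.

Lemma qt_od (x y : odd_part h) : qt_br (od x) (od y) = ev (qt_br (od x) (od y)).1.
Proof. by apply: svpar_ev; exact: (lie_parity (qt_lie h) (od_par x) (od_par y)). Qed.

Variable M : hmodule h.

Lemma act_linear x : is_linear (@hm_act _ _ M x).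
Proof. by case: (hm_module M) => -[]. Qed.
Lemma act_linearl v : is_linear ((@hm_act _ _ M)^~ v).
Proof. by case: (hm_module M) => -[]. Qed.
Lemma act_par p q (x : h) (v : M) :
  svpar p x -> svpar q v -> svpar (p (+) q) (hm_act x v).
Proof. by case: (hm_module M) => _ + _; exact. Qed.

End QuasiToral.

Section WeightModule.
Variables (K : numClosedFieldType) (h : quasi_toral K) (M : hmodule h).
Variable al : 'Hom(even_part h, K^o).
Hypothesis wt : forall t (v : M), hm_act (ev t) v = (al t : K) *: v.

Definition oform (x y : odd_part h) : K := al (qt_br (od x) (od y)).1.

(** Even elements act by scalars, so this is the Clifford relation: the odd part of h acts on [M]
    through the Clifford algebra of [oform]. *)
Lemma oform_act x y (v : M) :
  hm_act (od x) (hm_act (od y) v) + hm_act (od y) (hm_act (od x) v) = oform x y *: v.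
Proof.
case: (hm_module M) => _ _ /(_ true true (od x) (od y) v (od_par x) (od_par y)).
by rewrite qt_od wt /koszul expr1 scaleN1r opprK => ->.
Qed.

Lemma oform_sq x (v : M) : hm_act (od x) (hm_act (od x) v) = (oform x x / 2) *: v.
Proof.
have := oform_act x x v; rewrite -mulr2n -scaler_nat => e.
by rewrite mulrC -scalerA -e scalerA mulVf ?scale1r // pnatr_eq0.
Qed.

Lemma oform_sym x y : oform x y = oform y x.
Proof.
rewrite /oform (lie_skew (qt_lie h) (od_par x) (od_par y)) /koszul expr1 opprK.
by rewrite scale1r.
Qed.

Lemma oform_linear y : is_linear (oform^~ y : _ -> K^o).
Proof.
move=> a x x'; rewrite /oform od_linear (brDl (qt_lie h)) (brZl (qt_lie h)) /=.
by rewrite linearP.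
Qed.

Hypothesis irr : irreducible_module M.

(** A radical element squares to zero on [M] and anticommutes with every odd element, so its range
    is a submodule. Even if the range were all of [M], squaring to zero would force it to act by
    zero. *)
Lemma oform_radical z : (forall y, oform z y = 0) ->
  forall v : M, hm_act (od z) v = 0.
Proof.
move=> rad; have [[v0 v0N] sub] := irr.
have lz := @act_linear _ _ M (od z).
have zz (v : M) : hm_act (od z) (hm_act (od z) v) = 0.
  by rewrite oform_sq rad mul0r scale0r.
have zy y (v : M) : hm_act (od y) (hm_act (od z) v) = hm_act (od z) (- hm_act (od y) v).
  have /eqP := oform_act z y v; rewrite rad scale0r addrC addr_eq0 => /eqP ->.
  by rewrite (is_linearN lz).
case: (sub (range (hm_act (od z)))).
- split.
    split; first by apply: (subspace_image lz); split.
    move=> _ [v _ <-]; have [w0 [w1 [p0 p1 ->]]] := svpar_split v.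
    exists (hm_act (od z) w1), (hm_act (od z) w0); split.
    + exact: (act_par (od_par z) p1).
    + exact: (act_par (od_par z) p0).
    + by exists w1.
    + by exists w0.
    + by rewrite (is_linearD lz) addrC.
  move=> x _ [v _ <-]; rewrite (ev_od x) (is_linearD (act_linearl _)) wt zy.
  rewrite -(is_linearZ lz) -(is_linearD lz).
  by eexists.
- by move=> H v; apply: H; exists v.
- move=> e v; have : range (@hm_act _ _ M (od z)) v by rewrite e.
  by case=> w _ <-; exact: zz.
Qed.

Hypothesis rk : form_rank al = 2%N.

Let b := vbasis {: odd_part h}.
Let G := \matrix_(i, j) (al (qt_br ((0, tnth b i) : h) ((0, tnth b j) : h)).1 : K).

(** Two rows of the Gram matrix span its row space; subtracting the matching combination from a
    basis vector leaves a radical element, which acts by zero. *)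
Lemma odd_span : exists x1 x2 : odd_part h, forall y, exists c1 c2, forall v : M,
  hm_act (od y) v = c1 *: hm_act (od x1) v + c2 *: hm_act (od x2) v.
Proof.
have rG : \rank G = 2%N by [].
suff [X XP] : exists X : 'I_(\rank G) -> odd_part h, forall y, exists c : 'I_(\rank G) -> K,
    forall v : M, hm_act (od y) v = \sum_j c j *: hm_act (od (X j)) v.
  move: X XP; rewrite rG => X XP; exists (X ord0), (X ord_max) => y.
  have [c cE] := XP y; exists (c ord0), (c ord_max) => v.
  rewrite cE !big_ord_recl big_ord0 addr0; congr (_ + c _ *: hm_act (od (X _)) v);
  exact: val_inj.
pose X j := tnth b (maxrankfun G j); exists X.
have base k : exists c : 'I_(\rank G) -> K, forall v : M,
    hm_act (od (tnth b k)) v = \sum_j c j *: hm_act (od (X j)) v.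
  have : (row k G <= rowsub (maxrankfun G) G)%MS.
    by rewrite eq_maxrowsub row_sub.
  case/submxP=> D DE; exists (fun j => D 0 j) => v.
  pose z := tnth b k - \sum_j D 0 j *: X j.
  have rz : forall y, oform z y = 0.
    move=> y; rewrite (coord_vbasis (memvf y)) oform_sym.
    rewrite (is_linear_sum (@oform_linear z)) big1 // => l _.
    rewrite (is_linearZ (@oform_linear z)) oform_sym (is_linearB (@oform_linear _)).
    rewrite (is_linear_sum (@oform_linear _)).
    have := congr1 (fun m : 'rV_(\dim {: odd_part h}) => m 0 l) DE.
    rewrite !mxE => e.
    have -> : oform (tnth b k) b`_l = \sum_j D 0 j * oform (X j) b`_l.
      rewrite -(tnth_nth 0); rewrite [LHS]e; apply: eq_bigr => j _.
      by rewrite !mxE.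
    rewrite (_ : _ - _ = 0) ?scaler0 //; apply/eqP; rewrite subr_eq0; apply/eqP.
    by apply: eq_bigr => j _; rewrite (is_linearZ (@oform_linear _)).
  have := oform_radical rz v.
  rewrite (is_linearB (@od_linear _ h)) (is_linearB (act_linearl _)) => /eqP.
  rewrite subr_eq0 => /eqP ->.
  rewrite (is_linear_sum (@od_linear _ h)) (is_linear_sum (act_linearl _)).
  apply: eq_bigr => j _.
  by rewrite (is_linearZ (@od_linear _ h)) (is_linearZ (act_linearl _)).
have [C CE] := choice base.
move=> y; exists (fun j => \sum_k coord b k y * C k j) => v.
rewrite {1}(coord_vbasis (memvf y)) (is_linear_sum (@od_linear _ h)).
rewrite (is_linear_sum (act_linearl _)).
under [RHS]eq_bigr do rewrite scaler_suml.
rewrite exchange_big /=; apply: eq_bigr => k _.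
rewrite (is_linearZ (@od_linear _ h)) (is_linearZ (act_linearl _)) -(tnth_nth 0) CE.
by rewrite scaler_sumr; apply: eq_bigr => j _; rewrite scalerA.
Qed.

Lemma odd_span_isotropic : exists x1 x2 : odd_part h, oform x1 x1 = 0 /\
  forall y, exists c1 c2, forall v : M,
  hm_act (od y) v = c1 *: hm_act (od x1) v + c2 *: hm_act (od x2) v.
Proof.
have [x1 [x2 xP]] := odd_span.
have [B0|B0] := eqVneq (oform x1 x1) 0; first by exists x1, x2.
(* The isotropic vector is c x1 + x2: [c] is a root of the quadratic polynomial given by the form on
   such vectors, and [d] is the square root of its reduced discriminant. *)
pose d := sqrtC (oform x1 x2 ^+ 2 - oform x1 x1 * oform x2 x2).
pose c := (d - oform x1 x2) / oform x1 x1.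
exists (c *: x1 + x2), x1; split.
  have lin := oform_linear.
  rewrite lin [oform x1 _]oform_sym [oform x2 _]oform_sym !lin.
  rewrite [oform x2 x1]oform_sym /=.
  have dd : d ^+ 2 = oform x1 x2 ^+ 2 - oform x1 x1 * oform x2 x2 by rewrite sqrtCK.
  rewrite {}/c /GRing.scale /=; move: dd B0; rewrite expr2.
  move: (oform x1 x1) (oform x1 x2) (oform x2 x2) d => p q r d' dd p0.
  apply: (mulfI p0); rewrite mulr0.
  transitivity (d' * d' - (q ^+ 2 - p * r)); last by rewrite dd subrr.
  by field.
move=> y; have [c1 [c2 e]] := xP y.
exists c2, (c1 - c2 * c) => v; rewrite e.
rewrite (od_linear c x1 x2) (is_linearD (act_linearl _)) (is_linearZ (act_linearl _)).
by rewrite scalerDr scalerBl scalerA [RHS]addrC addrA subrK.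
Qed.

(** The isotropic [x1] kills some homogeneous vector [v]; by the Clifford relations the span of [v]
    and of [x2] applied to [v] is then a submodule. *)
Lemma weight_module_11 : exists v w : M, exists p,
  [/\ svpar p v, svpar (~~ p) w & forall u, exists x y, u = x *: v + y *: w].
Proof.
have [x1 [x2 [iso xP]]] := odd_span_isotropic.
have [[m mN] sub] := irr.
have [m' [p [pm' m'N]]] : exists m' p, svpar p m' /\ (m' : M) != 0.
  have [m0 [m1 [p0 p1 mE]]] := svpar_split m.
  have [z0|z0] := eqVneq m0 0; last by exists m0, false.
  exists m1, true; split=> //; apply: contraNneq mN => z1.
  by rewrite mE z0 z1 addr0.
have [v [q [qv vN v1]]] : exists (v : M) q, [/\ svpar q v, v != 0 & hm_act (od x1) v = 0].
  have [z|z] := eqVneq (hm_act (od x1) m') 0; first by exists m', p.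
  exists (hm_act (od x1) m'), (~~ p); split=> //; first exact: (act_par (od_par x1) pm').
  by rewrite oform_sq iso mul0r scale0r.
pose w := hm_act (od x2) v.
have qw : svpar (~~ q) w by exact: (act_par (od_par x2) qv).
exists v, w, q; split=> //.
pose U : set M := [set u | exists x y, u = x *: v + y *: w].
have sU : subspace U.
  split; first by exists 0, 0; rewrite !scale0r addr0.
  move=> a _ _ [x [y ->]] [x' [y' ->]]; exists (a * x + x'), (a * y + y').
  by rewrite scalerDr !scalerA !scalerDl addrACA.
have Uv : U v by exists 1, 0; rewrite scale1r scale0r addr0.
have Uw : U w by exists 0, 1; rewrite scale1r scale0r add0r.
have U1 u : U u -> U (hm_act (od x1) u).
  case=> x [y ->]; rewrite (act_linear _) (is_linearZ (act_linear _)) v1 scaler0 add0r.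
  apply: (subspaceZ _ sU); have := oform_act x1 x2 v.
  by rewrite v1 (is_linear0 (act_linear _)) addr0 => ->; apply: (subspaceZ _ sU).
have U2 u : U u -> U (hm_act (od x2) u).
  case=> x [y ->]; rewrite (act_linear _) (is_linearZ (act_linear _)).
  apply: (subspaceD sU); apply: (subspaceZ _ sU) => //.
  by rewrite /w oform_sq; apply: (subspaceZ _ sU).
case: (sub U).
- split.
    split=> // u [x [y ->]].
    have X : U (x *: v) by apply: (subspaceZ _ sU).
    have Y : U (y *: w) by apply: (subspaceZ _ sU).
    have pX : svpar q (x *: v) by apply: (subspaceZ _ (svpar_subspace _ _)).
    have pY : svpar (~~ q) (y *: w) by apply: (subspaceZ _ (svpar_subspace _ _)).
    case: q qv qw pX pY => qv qw pX pY; last by exists (x *: v), (y *: w).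
    by exists (y *: w), (x *: v); split=> //; rewrite addrC.
  move=> x u Uu; rewrite (ev_od x) (is_linearD (act_linearl _)) wt.
  apply: (subspaceD sU); first exact: (subspaceZ _ sU).
  have [c1 [c2 ->]] := xP x.2.
  by apply: (subspaceD sU); apply: (subspaceZ _ sU); [exact: U1|exact: U2].
- by move=> /(_ _ Uv) v0; rewrite v0 eqxx in vN.
- by move=> UE u; have : U u by rewrite UE.
Qed.

Variables (p : bool) (e E : M).
Hypotheses (pe : svpar p e) (pE : svpar (~~ p) E) (e0 : e != 0) (E0 : E != 0).

Lemma module_basis :
  (forall u : M, svpar p u -> exists c, u = c *: e) /\
  (forall u : M, svpar (~~ p) u -> exists c, u = c *: E).
Proof.
have [v [w [q [pv pw vwP]]]] := weight_module_11.
have disj q' (u : M) : svpar q' u -> svpar (~~ q') u -> u = 0.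
  by case: u => u0 u1; rewrite /svpar /=; case: q' => /= -> ->.
have pZ q' a (u : M) : svpar q' u -> svpar q' (a *: u).
  exact: (subspaceZ _ (svpar_subspace M q')).
have pB q' (u u' : M) : svpar q' u -> svpar q' u' -> svpar q' (u - u').
  exact: (subspaceB (svpar_subspace M q')).
have hq q' (u : M) : svpar q' u -> exists c, u = c *: (if q' == q then v else w).
  have [x [y uE]] := vwP u; move=> pu; have [qq|qq] := eqVneq q' q.
    exists x; subst q'; apply/eqP; rewrite -subr_eq0; apply/eqP.
    apply: (disj q); first by apply: pB => //; exact: pZ.
    by rewrite uE addrAC subrr add0r; exact: pZ.
  have {}qq : q' = ~~ q by case: (q') (q) qq => [] [].
  subst q'; exists y; apply/eqP; rewrite -subr_eq0; apply/eqP.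
  apply: (disj (~~ q)); first by apply: pB => //; exact: pZ.
  by rewrite uE addrK negbK; exact: pZ.
have key q' (f u : M) : svpar q' f -> f != 0 -> svpar q' u -> exists c, u = c *: f.
  move=> /hq [c ->] f0 /hq [c' ->]; exists (c' / c).
  rewrite scalerA divfK //; apply: contraNneq f0 => ->.
  by rewrite scale0r.
by split=> u pu; [exact: key pe e0 pu|exact: key pE E0 pu].
Qed.

Lemma module_functionals : exists r s : odd_part h -> K,
  [/\ forall x, hm_act (od x) e = r x *: E, forall x, hm_act (od x) E = s x *: e,
   is_linear (r : _ -> K^o), is_linear (s : _ -> K^o) &
   forall c d, (forall x, c * s x + d * r x = 0) -> c = 0 /\ d = 0].
Proof.
have [be bE] := module_basis.
have /choice[r rP] : forall x, exists c, hm_act (od x) e = c *: E.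
  by move=> x; apply: bE; exact: (act_par (od_par x) pe).
have /choice[s sP] : forall x, exists c, hm_act (od x) E = c *: e.
  move=> x; apply: be; have := act_par (od_par x) pE.
  by rewrite (_ : true (+) ~~ p = p) //; case: p.
have inj (u : M) c d : u != 0 -> c *: u = d *: u -> c = d.
  move=> u0 /eqP; rewrite -subr_eq0 -scalerBl scaler_eq0 (negPf u0) orbF subr_eq0.
  by move/eqP.
exists r, s; split=> //.
- move=> a x y; apply: (inj _ _ _ E0); rewrite -rP od_linear.
  by rewrite (act_linearl _) !rP scalerA -scalerDl.
- move=> a x y; apply: (inj _ _ _ e0); rewrite -sP od_linear.
  by rewrite (act_linearl _) !sP scalerA -scalerDl.
have oE x y : oform x y = r y * s x + r x * s y.
  apply: (inj _ _ _ e0); rewrite -oform_act !rP !(is_linearZ (act_linear _)) !sP.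
  by rewrite !scalerA -scalerDl.
pose R : 'rV[K]_(\dim {: odd_part h}) := \row_i r (tnth b i).
have GE i j : G i j = r (tnth b j) * s (tnth b i) + r (tnth b i) * s (tnth b j).
  by rewrite mxE -oE.
have rk1 k : G = k *: (R^T *m R) -> False.
  move=> Gk; have : (\rank G <= 1)%N.
    rewrite Gk scalemxAl (leq_trans (mxrankM_maxl _ _)) // rank_leq_col //.
  by rewrite [\rank G]rk.
move=> c d cd; have [c0|c0] := eqVneq c 0.
  split=> //; apply: contrapT => /eqP d0; apply: (rk1 0); apply/matrixP => i j.
  have r0 x : r x = 0.
    by have /eqP := cd x; rewrite c0 mul0r add0r mulf_eq0 (negPf d0) => /eqP.
  by rewrite GE !r0 !mul0r addr0 scale0r mxE.
(* Substituting s = -(d/c) r turns the form into this multiple of r(x) r(y). *)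
exfalso; apply: (rk1 (2 * (- d / c))); apply/matrixP => i j.
have sE x : s x = - d / c * r x.
  apply: (mulfI c0); have /eqP := cd x; rewrite addr_eq0 => /eqP ->.
  by field.
by rewrite GE !mxE big_ord_recl big_ord0 !mxE !sE addr0; ring.
Qed.

End WeightModule.

(** * Generators and coupling relations *)

Section Generators.
Variables (K : numClosedFieldType) (A : cartan_datum K) (G : generators A).
Hypotheses (km3 : KM3 A) (km4 : KM4 A).
Local Notation n := (cd_n A).
Local Notation e := (gen_e G).
Local Notation E := (gen_E G).
Local Notation f := (gen_f G).
Local Notation F := (gen_F G).
Local Notation pi_ i := (e_parity (gen_type G i)).

Lemma cd_weight_pos i t (v : cd_g A false i) :
  hm_act (ev t) v = (cd_root A i t : K) *: v.
Proof. by rewrite /ev cd_weight expr0 mul1r. Qed.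

Lemma gen_functionals i : exists r s : odd_part (cd_h A) -> K,
  [/\ forall x, hm_act (od x) (e i) = r x *: E i,
   forall x, hm_act (od x) (E i) = s x *: e i,
   is_linear (r : _ -> K^o), is_linear (s : _ -> K^o) &
   forall c d, (forall x, c * s x + d * r x = 0) -> c = 0 /\ d = 0].
Proof.
exact: (module_functionals (@cd_weight_pos i) (km4 i).1 (km3 i)
  (gen_e_parity G i) (gen_E_parity G i) (gen_e_neq0 G i) (gen_E_neq0 G i)).
Qed.

Definition gen_r i := projT1 (cid (gen_functionals i)).
Definition gen_s i := projT1 (cid (projT2 (cid (gen_functionals i)))).
Local Notation r := gen_r.
Local Notation s := gen_s.

Lemma gen_rsP i :
  [/\ forall x, hm_act (od x) (e i) = r i x *: E i,
   forall x, hm_act (od x) (E i) = s i x *: e i,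
   is_linear (r i : _ -> K^o), is_linear (s i : _ -> K^o) &
   forall c d, (forall x, c * s i x + d * r i x = 0) -> c = 0 /\ d = 0].
Proof. exact: (projT2 (cid (projT2 (cid (gen_functionals i))))). Qed.

Lemma act_e i x : hm_act (od x) (e i) = r i x *: E i.
Proof. by case: (gen_rsP i). Qed.
Lemma act_E i x : hm_act (od x) (E i) = s i x *: e i.
Proof. by case: (gen_rsP i). Qed.
Lemma gen_rs_ind i c d : (forall x, c * s i x + d * r i x = 0) -> c = 0 /\ d = 0.
Proof. by case: (gen_rsP i) => _ _ _ _; exact. Qed.

Lemma gen_r_neq0 i : exists x, r i x != 0.
Proof.
apply: contrapT => /forallNP H; have [|_ /eqP] := @gen_rs_ind i 0 1.
  by move=> x; have /negP := H x; rewrite negbK => /eqP ->; rewrite mul0r mulr0 addr0.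
by rewrite oner_eq0.
Qed.

Lemma gen_s_neq0 i : exists x, s i x != 0.
Proof.
apply: contrapT => /forallNP H; have [|/eqP] := @gen_rs_ind i 1 0.
  by move=> x; have /negP := H x; rewrite negbK => /eqP ->; rewrite mul0r mulr0 addr0.
by rewrite oner_eq0.
Qed.

Let veeP := gen_veeP G.

Lemma vee_linear i : is_linear (@gen_vee _ _ G i).
Proof. by case: (veeP i). Qed.

Lemma act_vee i x (v : cd_g A false i) :
  hm_act (od x) (gen_vee G v) = - 'i *: gen_vee G (hm_act (od x) v).
Proof.
case: (veeP i) => lv _ _ <-; rewrite /vee_act /omega_inv /od /= oppr0.
rewrite -/(od (- 'i *: x)) (is_linearZ (@od_linear _ _)).
by rewrite (is_linearZ (act_linearl _)) (is_linearZ lv).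
Qed.

(** The factor 'i, placed in exactly one of [f] and [F], compensates the one in [omega_inv]; hence
    odd elements of h act on negative root vectors with coefficients [r] and [s] up to sign. *)
Lemma act_f i x : hm_act (od x) (f i) = (- (-1) ^+ pi_ i * r i x) *: F i.
Proof.
rewrite /gen_f /gen_F /e_scale /E_scale act_vee (is_linearZ (act_linear _)) act_e.
rewrite !(is_linearZ (@vee_linear i)) !scalerA; congr (_ *: _).
case: (pi_ i); last by rewrite expr0; ring.
by rewrite expr1; transitivity (- ('i ^+ 2) * r i x); [ring|rewrite sqrCi; ring].
Qed.

Lemma act_F i x : hm_act (od x) (F i) = ((-1) ^+ pi_ i * s i x) *: f i.
Proof.
rewrite /gen_f /gen_F /e_scale /E_scale act_vee (is_linearZ (act_linear _)) act_E.
rewrite !(is_linearZ (@vee_linear i)) !scalerA; congr (_ *: _).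
case: (pi_ i); first by rewrite expr1; ring.
by rewrite expr0; transitivity (- ('i ^+ 2) * s i x); [ring|rewrite sqrCi; ring].
Qed.

Lemma gen_f_parity i : svpar (pi_ i) (f i).
Proof.
case: (veeP i) => _ _ vp _; apply: vp.
by apply: (subspaceZ _ (svpar_subspace _ _)); exact: gen_e_parity.
Qed.

Lemma gen_F_parity i : svpar (~~ pi_ i) (F i).
Proof.
case: (veeP i) => _ _ vp _; apply: vp.
by apply: (subspaceZ _ (svpar_subspace _ _)); exact: gen_E_parity.
Qed.

Lemma g_pos_basis i p (u : cd_g A false i) : svpar p u ->
  exists c, u = c *: (if p == pi_ i then e i else E i).
Proof.
have [be bE] := module_basis (@cd_weight_pos i) (km4 i).1 (km3 i)
  (gen_e_parity G i) (gen_E_parity G i) (gen_e_neq0 G i) (gen_E_neq0 G i).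
have [->|pp] := eqVneq p (pi_ i); first exact: be.
have -> : p = ~~ pi_ i by case: (p) (pi_ i) pp => [] [].
exact: bE.
Qed.

Lemma g_neg_basis i p (u : cd_g A true i) : svpar p u ->
  exists c, u = c *: (if p == pi_ i then f i else F i).
Proof.
case: (veeP i) => lv [g vg gv] vp _ pu.
have pg : svpar p (g u).
  have [w0 [w1 [p0 p1 wE]]] := svpar_split (g u).
  have uE : u = gen_vee G w0 + gen_vee G w1 by rewrite -(is_linearD lv) -wE gv.
  have z (b : bool) (w : cd_g A false i) : svpar b (gen_vee G w) ->
      svpar (~~ b) (gen_vee G w) -> w = 0.
    move=> pb pb'; rewrite -[w]vg (_ : gen_vee G w = 0).
      by rewrite -(is_linear0 lv) vg.
    by move: pb pb'; case: (gen_vee G w) => a c; rewrite /svpar /=; case: b => /= -> ->.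
  rewrite wE; case: p pu => pu.
    rewrite (z false w0) ?add0r //; first exact: vp.
    rewrite -[gen_vee G w0](addrK (gen_vee G w1)) -uE.
    by apply: (subspaceB (svpar_subspace _ _)) => //; exact: vp.
  rewrite (z true w1) ?addr0 //; first exact: vp.
  rewrite -[gen_vee G w1](addKr (gen_vee G w0)) -uE addrC.
  by apply: (subspaceB (svpar_subspace _ _)) => //; exact: vp.
have [c cE] := g_pos_basis pg; rewrite -[u]gv cE (is_linearZ lv).
have K0 : 'i != 0 :> K by exact: neq0Ci.
have key k (w : cd_g A false i) : k != 0 ->
    exists c', c *: gen_vee G w = c' *: gen_vee G (k *: w).
  by move=> k0; exists (c / k); rewrite (is_linearZ lv) scalerA divfK.
rewrite /gen_f /gen_F /e_scale /E_scale.
by case: eqP => _; apply: key; case: (pi_ i); rewrite ?oner_neq0.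
Qed.

Lemma pairing_linearl i v : is_linear ((@cd_br _ A i)^~ v).
Proof. by case: (@cd_pairing _ A i) => -[]. Qed.
Lemma pairing_linearr i u : is_linear (@cd_br _ A i u).
Proof. by case: (@cd_pairing _ A i) => -[]. Qed.
Lemma pairing_par i p q (u : cd_g A false i) (v : cd_g A true i) :
  svpar p u -> svpar q v -> svpar (p (+) q) (cd_br u v).
Proof. by case: (@cd_pairing _ A i) => _ + _; exact. Qed.
Lemma pairing_od i q x (u : cd_g A false i) (v : cd_g A true i) : svpar q u ->
  qt_br (od x) (cd_br u v) = cd_br (hm_act (od x) u) v
    + (-1) ^+ q *: cd_br u (hm_act (od x) v).
Proof.
move=> qu; case: (@cd_pairing _ A i) => _ _ /(_ _ _ _ _ v (od_par x) qu) ->.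
by rewrite /koszul.
Qed.

Definition gen_t i := (gen_h G i).1.
Definition gen_d i := (gen_c G i).1.
Definition gen_o i := (gen_H G i).2.

Lemma gen_hE i : gen_h G i = ev (gen_t i).
Proof.
apply: svpar_ev; have := pairing_par (gen_e_parity G i) (gen_f_parity i).
by rewrite addbb.
Qed.

Lemma gen_cE i : gen_c G i = ev (gen_d i).
Proof.
apply: svpar_ev; have := pairing_par (gen_E_parity G i) (gen_F_parity i).
by rewrite addbb.
Qed.

Lemma gen_HE i : gen_H G i = od (gen_o i).
Proof.
apply: svpar_od; have := pairing_par (gen_E_parity G i) (gen_f_parity i).
by rewrite addNb addbb.
Qed.

(** Since h_i is central in h, equivariance gives r_i(x)([E_i, f_i] - [e_i, F_i]) = 0, and some [x]
    has r_i(x) <> 0. *)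
Lemma gen_HE2 i : cd_br (e i) (F i) = gen_H G i.
Proof.
have [x x0] := gen_r_neq0 i.
have := pairing_od x (f i) (gen_e_parity G i); rewrite -/(gen_h G i) gen_hE qt_ev.
rewrite act_e act_f (is_linearZ (pairing_linearl _)) (is_linearZ (pairing_linearr _)).
rewrite scalerA mulrA mulrN -signr_addb addbb expr0 mulN1r scaleNr -scalerBr => /esym/eqP.
by rewrite scaler_eq0 (negPf x0) subr_eq0 => /eqP <-.
Qed.

Lemma od_gen_H i x : qt_br (od x) (gen_H G i) = s i x *: gen_h G i + r i x *: gen_c G i.
Proof.
rewrite (pairing_od x (f i) (gen_E_parity G i)) act_E act_f.
rewrite (is_linearZ (pairing_linearl _)) (is_linearZ (pairing_linearr _)) scalerA.
by rewrite mulrA mulrN -signr_addb addNb addbb expr1 opprK mul1r.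
Qed.

Definition cart i j : K := cd_root A j (gen_t i).
Definition cartc i j : K := cd_root A j (gen_d i).
(** With [gen_y], the entries of X and Y, read as values of r_j and s_j at H_i. *)
Definition gen_x i j : K := r j (gen_o i).
Definition gen_y i j : K := s j (gen_o i).
Local Notation a := cart.
Local Notation b := cartc.
Local Notation y := gen_y.

(** Both sides are alpha_j([x, H_i]): the left one by [od_gen_H], the right one by letting the
    anticommutator of [x] and H_i act on e_j. *)
Lemma coupling i j x :
  s i x * a i j + r i x * b i j = s j x * gen_x i j + r j x * y i j.
Proof.
have := oform_act (@cd_weight_pos j) x (gen_o i) (e j).
rewrite /oform -gen_HE od_gen_H /= linearD !linearZ /= gen_HE.
rewrite !act_e !(is_linearZ (act_linear _)) !act_E !scalerA -scalerDl => /eqP.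
rewrite -subr_eq0 -scalerBl scaler_eq0 (negPf (gen_e_neq0 G j)) orbF subr_eq0.
move/eqP => H; rewrite [s j x * _]mulrC; exact: (esym H).
Qed.

Lemma coupling_diag i : gen_x i i = a i i /\ y i i = b i i.
Proof.
have [] := @gen_rs_ind i (gen_x i i - a i i) (y i i - b i i).
  move=> x; have := coupling i i x; move: (gen_x i i) (a i i) (y i i) (b i i).
  move=> p q u v H; have : (s i x * p + r i x * u) - (s i x * q + r i x * v) = 0.
    by rewrite H subrr.
  by move=> <-; ring.
by move=> /subr0_eq -> /subr0_eq ->.
Qed.

(** The space h_{alpha_i} is spanned by h_i, c_i and H_i, because [e_i, F_i] is again H_i; the four
    coefficients describe their action on g_{alpha_j}. *)
Lemma h_root_kills_coef i j : a i j = 0 -> b i j = 0 -> gen_x i j = 0 -> y i j = 0 ->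
  h_root_kills i j.
Proof.
move=> a0 b0 x0 y0.
have actz (z : cd_h A) : (cd_root A j z.1 : K) = 0 -> r j z.2 = 0 -> s j z.2 = 0 ->
    forall v : cd_g A false j, hm_act z v = 0.
  move=> t0 rz sz v; rewrite (ev_od z) (is_linearD (act_linearl _)) cd_weight_pos t0.
  rewrite scale0r add0r; have [v0 [v1 [p0 p1 ->]]] := svpar_split v.
  have [c0 ->] := g_pos_basis p0; have [c1 ->] := g_pos_basis p1.
  rewrite (is_linearD (act_linear _)) !(is_linearZ (act_linear _)).
  by case: eqP => _; case: eqP => _; rewrite ?act_e ?act_E ?rz ?sz !scale0r !scaler0 addr0.
have [_ _ rl sl _] := gen_rsP j.
move=> z v; suff : h_root i `<=` [set z | forall v : cd_g A false j, hm_act z v = 0].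
  by move=> H /H.
apply: lspan_sub.
  split=> [w|c z1 z2 /= h1 h2 w] /=; first exact: (is_linear0 (act_linearl _)).
  by rewrite (act_linearl _) h1 h2 scaler0 addr0.
move=> _ [u [w ->]] /=.
have [u0 [u1 [pu0 pu1 ->]]] := svpar_split u.
have [w0 [w1 [pw0 pw1 ->]]] := svpar_split w.
have hb p q (u' : cd_g A false i) w' : svpar p u' -> svpar q w' ->
    forall v : cd_g A false j, hm_act (cd_br u' w') v = 0.
  move=> /g_pos_basis [c ->] /g_neg_basis [d ->] v'.
  rewrite (is_linearZ (pairing_linearl _)) (is_linearZ (pairing_linearr _)).
  rewrite !(is_linearZ (act_linearl _)).
  have h1 : hm_act (gen_h G i) v' = 0.
    by apply: actz; rewrite gen_hE //= ?(is_linear0 rl) ?(is_linear0 sl).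
  have h2 : hm_act (gen_c G i) v' = 0.
    by apply: actz; rewrite gen_cE //= ?(is_linear0 rl) ?(is_linear0 sl).
  have h3 : hm_act (gen_H G i) v' = 0.
    by apply: actz; rewrite gen_HE //= linear0.
  have h4 : hm_act (cd_br (e i) (F i)) v' = 0 by rewrite gen_HE2.
  by case: eqP => _; case: eqP => _; rewrite ?h1 ?h2 ?h3 ?h4 !scaler0.
rewrite (is_linearD (pairing_linearl _)) !(is_linearD (pairing_linearr _)).
move=> v'; rewrite !(is_linearD (act_linearl _)).
by rewrite (hb _ _ _ _ pu0 pw0) (hb _ _ _ _ pu0 pw1) (hb _ _ _ _ pu1 pw0)
  (hb _ _ _ _ pu1 pw1) !addr0.
Qed.

Hypothesis hX : completely_X_coupled G.

Lemma gen_x_off i j : i != j -> gen_x i j = 0.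
Proof.
move=> ij; case: hX => X XP /(_ _ _ ij) X0.
have := XP i j; rewrite gen_HE act_e X0 scale0r => /eqP.
by rewrite scaler_eq0 (negPf (gen_E_neq0 G j)) orbF => /eqP.
Qed.

Lemma coupling_off i j x : i != j -> s i x * a i j + r i x * b i j = r j x * y i j.
Proof. by move=> ij; rewrite coupling gen_x_off // mulr0 add0r. Qed.

(** Evaluation at H_j, where r_i takes the value x_ji = 0 and r_j the value x_jj = a_jj. *)
Lemma coupling_H i j : i != j -> y j i * a i j = a j j * y i j.
Proof.
move=> ij; have := coupling_off (gen_o j) ij.
rewrite -/(gen_x j i) -/(gen_y j i) gen_x_off 1?eq_sym // mul0r addr0 => ->.
by rewrite -/(gen_x j j) (coupling_diag j).1.
Qed.

(** Evaluation at H_i, where r_j takes the value x_ij = 0, while s_i and r_i take the values b_ii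
    and a_ii. *)
Lemma coupling_self i j : i != j -> b i i * a i j + a i i * b i j = 0.
Proof.
move=> ij; have := coupling_off (gen_o i) ij.
rewrite -/(gen_x i i) -/(gen_y i i) -/(gen_x i j) (coupling_diag i).1 (coupling_diag i).2.
by rewrite (gen_x_off ij) mul0r.
Qed.

(** Independence of r_i and s_i; it makes y_ij the only coefficient to inspect in deciding whether
    h_{alpha_i} kills g_{alpha_j}. *)
Lemma y0_decoupled i j : i != j -> y i j = 0 -> a i j = 0 /\ b i j = 0.
Proof.
move=> ij y0; apply: (@gen_rs_ind i) => x.
by have := coupling_off x ij; rewrite y0 mulr0 => <-; ring.
Qed.

Lemma y0_kills i j : i != j -> y i j = 0 -> h_root_kills i j.
Proof.
move=> ij y0; have [a0 b0] := y0_decoupled ij y0.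
exact: h_root_kills_coef a0 b0 (gen_x_off ij) y0.
Qed.

End Generators.

(** * Pairs of simple roots *)

Section Nilpotent.
Variables (K : fieldType) (V : lmodType K).

Definition nil_set (g : V -> V) : set V := [set v | exists N, iter N g v = 0].

Lemma iter_linear (g : V -> V) N : is_linear g -> is_linear (iter N g).
Proof.
by move=> lg; elim: N => [|N IH] a x y //=; rewrite IH lg.
Qed.

Lemma iter_nil (g : V -> V) N M v : is_linear g -> (N <= M)%N ->
  iter N g v = 0 -> iter M g v = 0.
Proof.
move=> lg NM e; rewrite -(subnK NM) iterD e.
exact: (is_linear0 (iter_linear _ lg)).
Qed.

Lemma nil_set_subspace g : is_linear g -> subspace (nil_set g).
Proof.
move=> lg; split; first by exists 0%N.
move=> a u v [N uN] [M vM]; exists (maxn N M).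
rewrite (iter_linear _ lg) (iter_nil lg (leq_maxl _ _) uN).
by rewrite (iter_nil lg (leq_maxr _ _) vM) scaler0 addr0.
Qed.

End Nilpotent.

(** * Triples of even elements spanning sl(2) *)

Section Sl2Triples.
Variables (K : numFieldType) (L : lmodType K) (par : bool -> set L).
Variable br : L -> L -> L.
Hypothesis lieL : is_lie_super par br.

Definition sl2_triple (x y h : L) : Prop :=
  [/\ par false x, par false y, br x y = h, br h x = 2 *: x & br h y = - 2 *: y].

Lemma sl2_triple_opp x y h : sl2_triple x y h -> sl2_triple y x (- h).
Proof.
move=> [px py xy hx hy]; split=> //.
- by rewrite (skew_even lieL _ py) xy.
- by rewrite (brNl lieL) hy scaleNr opprK.
- by rewrite (brNl lieL) hx scaleNr.
Qed.

Variables x y h : L.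
Hypothesis xyh : sl2_triple x y h.

Lemma sl2_triple_ef v : br x (br y v) = br y (br x v) + br h v.
Proof.
by case: xyh => px _ <- _ _; rewrite (jacobi_even lieL _ _ px) addrC.
Qed.

Let ph : par false h.
Proof. by case: xyh => px py <- _ _; exact: (lie_parity lieL px py). Qed.

Lemma sl2_triple_he c v : br h v = c *: v -> br h (br x v) = (c + 2) *: br x v.
Proof.
case: xyh => _ _ _ hx _ hv; rewrite (jacobi_even lieL _ _ ph) hx hv (brZl lieL) (brZr lieL).
by rewrite -scalerDl addrC.
Qed.

Lemma sl2_triple_hf c v : br h v = c *: v -> br h (br y v) = (c - 2) *: br y v.
Proof.
case: xyh => _ _ _ _ hy hv; rewrite (jacobi_even lieL _ _ ph) hy hv (brZl lieL) (brZr lieL).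
by rewrite -scalerDl addrC.
Qed.

Lemma sl2_triple_inj m k v : br h v = m%:R *: v -> nil_set (br x) v -> (k <= m)%N ->
  iter k (br y) v = 0 -> v = 0.
Proof.
move=> hv [N xN]; exact: (sl2_inj (brr lieL x) (brr lieL y) sl2_triple_ef
  sl2_triple_he sl2_triple_hf hv xN).
Qed.

End Sl2Triples.

Lemma sl2_triple_lowest (K : numFieldType) (L : lmodType K) (par : bool -> set L)
    (br : L -> L -> L) (x y h : L) c v : is_lie_super par br -> sl2_triple par br x y h ->
  br h v = c *: v -> br y v = 0 -> v != 0 -> nil_set (br x) v ->
  exists k : nat, c = - k%:R.
Proof.
move=> lieL xyh hv yv v0 [N xN].
have xyh' := sl2_triple_opp lieL xyh.
have hv' : br (- h) v = - c *: v by rewrite (brNl lieL) hv scaleNr.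
have [k kE _] := sl2_highest_weight (brr lieL y) (brr lieL x) (sl2_triple_ef lieL xyh')
  (sl2_triple_hf lieL xyh') hv' yv v0 xN.
by exists k; rewrite -kE opprK.
Qed.

(** * Constraints on coupled simple roots *)

Section PairAnalysis.
Variables (K : numClosedFieldType) (A : cartan_datum K) (G : generators A).
Hypotheses (km3 : KM3 A) (km4 : KM4 A).
Local Notation n := (cd_n A).
Variables (L : lmodType K) (par : bool -> set L) (br : L -> L -> L).
Variables (ih : cd_h A -> L) (ig : forall s i, cd_g A s i -> L).
Hypothesis rz : realizes par br ih ig.
Hypothesis gen : forall W : set L, subspace W ->
  (forall x y, W x -> W y -> W (br x y)) -> (forall x, W (ih x)) ->
  (forall s i (x : cd_g A s i), W (ig x)) -> forall v, W v.
Hypothesis ideal0 : forall I : set L, is_ideal par br I ->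
  (forall x, I (ih x) -> ih x = 0) -> forall v, I v -> v = 0.
Hypothesis km1 : forall s i s' j, exists N : nat,
  forall (xs : seq (cd_g A s i)) (y : cd_g A s' j), size xs = N ->
    foldr (fun x z => br (ig x) z) (ig y) xs = 0.
Hypothesis typeP : forall i,
  let quot_of m k s := @is_central_quotient K m k s L par br
    (subalgebra_gen br (range (@ig false i) `|` range (@ig true i))) in
  match gen_type G i with
  | Tak_sl2 => quot_of 2 0 (@sl_super K 2 0)
  | Tak_osp12 => quot_of 1 2 (@osp12 K)
  | Tak_sl11 => quot_of 1 1 (@sl_super K 1 1)
  end.
Variable t0 : even_part (cd_h A).
Hypothesis t0P : forall i, cd_root A i t0 = 1.
Let lieL := rz_lie rz.
Local Notation pi_ i := (e_parity (gen_type G i)).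
Local Notation a := (cart G).
Local Notation b := (cartc G).
Local Notation r := (gen_r G km3 km4).
Local Notation s := (gen_s G km3 km4).
Local Notation x_ := (gen_x G km3 km4).
Local Notation y := (gen_y G km3 km4).
Local Notation lf i := (ig (gen_f G i)).
Local Notation lF i := (ig (gen_F G i)).
Local Notation le i := (ig (gen_e G i)).
Local Notation lE i := (ig (gen_E G i)).
Local Notation lh i := (ih (gen_h G i)).
Local Notation lc i := (ih (gen_c G i)).
Local Notation lH i := (ih (gen_H G i)).

Lemma ig_linear s i : is_linear (@ig s i).
Proof. exact: rz_g_linear rz s i. Qed.

Lemma le_par i : par (pi_ i) (le i).
Proof. exact: (rz_g_parity rz (gen_e_parity G i)). Qed.
Lemma lE_par i : par (~~ pi_ i) (lE i).
Proof. exact: (rz_g_parity rz (gen_E_parity G i)). Qed.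
Lemma lf_par i : par (pi_ i) (lf i).
Proof. exact: (rz_g_parity rz (gen_f_parity G i)). Qed.
Lemma lF_par i : par (~~ pi_ i) (lF i).
Proof. exact: (rz_g_parity rz (gen_F_parity G i)). Qed.
Lemma ih_ev_par t : par false (ih (ev t)).
Proof. exact: (rz_h_parity rz (ev_par t)). Qed.
Lemma lh_par i : par false (lh i).
Proof. by rewrite gen_hE; exact: ih_ev_par. Qed.
Lemma lc_par i : par false (lc i).
Proof. by rewrite gen_cE; exact: ih_ev_par. Qed.
Lemma lH_par i : par true (lH i).
Proof. by rewrite gen_HE; exact: (rz_h_parity rz (od_par _)). Qed.

Lemma br_ef i : br (le i) (lf i) = lh i.
Proof. exact: (rz_gg rz). Qed.
Lemma br_EF i : br (lE i) (lF i) = lc i.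
Proof. exact: (rz_gg rz). Qed.
Lemma br_Ef i : br (lE i) (lf i) = lH i.
Proof. exact: (rz_gg rz). Qed.
Lemma br_eF i : br (le i) (lF i) = lH i.
Proof. by rewrite (rz_gg rz) (gen_HE2 G km3 km4). Qed.

Lemma br_ev_pos t i (u : cd_g A false i) : br (ih (ev t)) (ig u) = (cd_root A i t : K) *: ig u.
Proof. by rewrite (rz_hg rz) cd_weight_pos (is_linearZ (@ig_linear _ _)). Qed.

Lemma br_ev_neg t i (u : cd_g A true i) : br (ih (ev t)) (ig u) = - (cd_root A i t : K) *: ig u.
Proof.
by rewrite (rz_hg rz) /ev cd_weight expr1 mulN1r (is_linearZ (@ig_linear _ _)).
Qed.

Lemma br_h_pos i j (u : cd_g A false j) : br (lh i) (ig u) = a i j *: ig u.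
Proof. by rewrite gen_hE br_ev_pos. Qed.
Lemma br_h_neg i j (u : cd_g A true j) : br (lh i) (ig u) = - a i j *: ig u.
Proof. by rewrite gen_hE br_ev_neg. Qed.
Lemma br_c_pos i j (u : cd_g A false j) : br (lc i) (ig u) = b i j *: ig u.
Proof. by rewrite gen_cE br_ev_pos. Qed.

Lemma br_H_e i j : br (lH i) (le j) = x_ i j *: lE j.
Proof. by rewrite (rz_hg rz) gen_HE (act_e G km3 km4) (is_linearZ (@ig_linear _ _)). Qed.
Lemma br_H_E i j : br (lH i) (lE j) = y i j *: le j.
Proof. by rewrite (rz_hg rz) gen_HE (act_E G km3 km4) (is_linearZ (@ig_linear _ _)). Qed.
Lemma br_H_f i j : br (lH i) (lf j) = (- (-1) ^+ pi_ j * x_ i j) *: lF j.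
Proof. by rewrite (rz_hg rz) gen_HE (act_f G km3 km4) (is_linearZ (@ig_linear _ _)). Qed.
Lemma br_H_F i j : br (lH i) (lF j) = ((-1) ^+ pi_ j * y i j) *: lf j.
Proof. by rewrite (rz_hg rz) gen_HE (act_F G km3 km4) (is_linearZ (@ig_linear _ _)). Qed.

Lemma br_neg_pos0 p q i j (u : cd_g A true i) (v : cd_g A false j) :
  svpar p u -> svpar q v -> i != j -> br (ig u) (ig v) = 0.
Proof.
move=> pu qv ij; rewrite (lie_skew lieL (rz_g_parity rz pu) (rz_g_parity rz qv)).
by rewrite (rz_gg0 rz) ?scaler0 // eq_sym.
Qed.

Lemma pos_vanish i : le i = 0 \/ lE i = 0 -> forall u : cd_g A false i, ig u = 0.
Proof.
move=> H; have [e0 E0] : le i = 0 /\ lE i = 0.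
  case: H => z0; split=> //.
    have [x x0] := gen_r_neq0 G km3 km4 i.
    have : br (ih (od x)) (le i) = 0 by rewrite z0 (br0r lieL).
    rewrite (rz_hg rz) (act_e G km3 km4) (is_linearZ (@ig_linear _ _)) => /eqP.
    by rewrite scaler_eq0 (negPf x0) => /eqP.
  have [x x0] := gen_s_neq0 G km3 km4 i.
  have : br (ih (od x)) (lE i) = 0 by rewrite z0 (br0r lieL).
  rewrite (rz_hg rz) (act_E G km3 km4) (is_linearZ (@ig_linear _ _)) => /eqP.
  by rewrite scaler_eq0 (negPf x0) => /eqP.
move=> u; have [u0 [u1 [p0 p1 ->]]] := svpar_split u.
have [c0 ->] := g_pos_basis G km3 km4 p0; have [c1 ->] := g_pos_basis G km3 km4 p1.
rewrite (is_linearD (@ig_linear _ _)) !(is_linearZ (@ig_linear _ _)).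
by case: eqP => _; case: eqP => _; rewrite ?e0 ?E0 !scaler0 addr0.
Qed.

(** If g_{alpha_i} vanished in [L], brackets inside g_{-alpha_i} would be killed by all positive
    generators and hence be zero, so f_i and F_i would span g<alpha_i>. Its odd part would be at
    most one-dimensional, against [odd_pair] in each type. *)
Lemma pos_neq0 i : le i != 0 /\ lE i != 0.
Proof.
have : ~ (le i = 0 \/ lE i = 0); last first.
  by move=> H; split; apply/eqP => z; apply: H; [left|right].
move=> /pos_vanish pv.
have bz p q (u v : cd_g A true i) : svpar p u -> svpar q v -> br (ig u) (ig v) = 0.
  move=> pu qv; apply: (killed_eq0 rz gen ideal0 t0P (s := true)).
    apply: (wspan_word (w := [:: i; i])) => //.
    by apply: wordS pu _; apply: word1 qv.
  move=> j q' w qw; have [ji|ji] := eqVneq j i.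
    by subst j; rewrite pv (br0l lieL).
  rewrite (lie_jacobi lieL _ (rz_g_parity rz qw) (rz_g_parity rz pu)).
  by rewrite !(rz_gg0 rz) // (br0l lieL) (br0r lieL) scaler0 addr0.
(* The odd one among f_i and F_i. *)
pose F0 := if pi_ i then lf i else lF i.
have WF : forall x, subalgebra_gen br (range (@ig false i) `|` range (@ig true i)) x ->
    par true x -> exists c, x = c *: F0.
  move=> x gx px; have [c [d xE]] : exists c d, x = c *: lf i + d *: lF i.
    apply: (gx [set x | exists c d, x = c *: lf i + d *: lF i]).
    - split; first by exists 0, 0; rewrite !scale0r addr0.
      move=> k _ _ [c [d ->]] [c' [d' ->]]; exists (k * c + c'), (k * d + d').
      by rewrite scalerDr !scalerA !scalerDl addrACA.
    - move=> _ _ [c [d ->]] [c' [d' ->]]; exists 0, 0.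
      rewrite !scale0r addr0 !(brDl lieL) !(brDr lieL) !(brZl lieL) !(brZr lieL).
      have pf := gen_f_parity G i; have pF := gen_F_parity G i.
      by rewrite (bz _ _ _ _ pf pf) (bz _ _ _ _ pf pF) (bz _ _ _ _ pF pf)
        (bz _ _ _ _ pF pF) !scaler0 !addr0.
    - move=> _ [[u _ <-]|[u _ <-]]; first by exists 0, 0; rewrite pv !scale0r addr0.
      have [u0 [u1 [p0 p1 ->]]] := svpar_split u.
      have [c0 ->] := g_neg_basis G km3 km4 p0; have [c1 ->] := g_neg_basis G km3 km4 p1.
      rewrite (is_linearD (@ig_linear _ _)) !(is_linearZ (@ig_linear _ _)).
      case: (pi_ i) => /=; first by exists c1, c0; rewrite addrC.
      by exists c0, c1.
  have pfZ : par (pi_ i) (c *: lf i) by apply: (subspaceZ _ (par_subspace lieL _)); exact: lf_par.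
  have pFZ : par (~~ pi_ i) (d *: lF i) by apply: (subspaceZ _ (par_subspace lieL _)); exact: lF_par.
  rewrite /F0; move: pfZ pFZ; case: (pi_ i) => /= pfZ pFZ.
    exists c; have z : d *: lF i = 0.
      apply: (par_disj lieL (p := false)) => //.
      have -> : d *: lF i = x - c *: lf i by rewrite xE addrAC subrr add0r.
      exact: (subspaceB (par_subspace lieL _)).
    by rewrite xE z addr0.
  exists d; have z : c *: lf i = 0.
    apply: (par_disj lieL (p := false)) => //.
    have -> : c *: lf i = x - d *: lF i by rewrite xE addrK.
    exact: (subspaceB (par_subspace lieL _)).
  by rewrite xE z add0r.
have := typeP i; case: (gen_type G i) => cq.
- exact: (central_quotient_odd (@sl_super_linear _ _ _) (@sl_super0 _ _ _) (odd_pair_sl2 K) cq WF).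
- exact: (central_quotient_odd (@osp12_linear _) (@osp120 _) (odd_pair_osp12 K) cq WF).
- exact: (central_quotient_odd (@sl_super_linear _ _ _) (@sl_super0 _ _ _) (odd_pair_sl11 K) cq WF).
Qed.

Lemma le_neq0 i : le i != 0. Proof. by case: (pos_neq0 i). Qed.
Lemma lE_neq0 i : lE i != 0. Proof. by case: (pos_neq0 i). Qed.

Lemma sub_gen s i (u : cd_g A s i) :
  subalgebra_gen br (range (@ig false i) `|` range (@ig true i)) (ig u).
Proof. by move=> W _ _; apply; case: s u => u; [right|left]; exists u. Qed.

Lemma diag_sl2 i : gen_type G i = Tak_sl2 -> a i i = 2 /\ b i i = 0.
Proof.
move=> ty; split; first by have := gen_scaled G i; rewrite /cart /gen_t /gen_h /gen_f ty.
have cq := typeP i; rewrite ty in cq.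
have pE := lE_par i; have pF := lF_par i; rewrite ty in pE pF.
have := central_quotient_central lieL cq (@takiff_sl2_central K)
  (sub_gen (gen_E G i)) (sub_gen (gen_F G i)) (sub_gen (gen_E G i)) pE pF.
rewrite br_EF br_c_pos => /eqP.
by rewrite scaler_eq0 (negPf (lE_neq0 i)) orbF => /eqP.
Qed.

Lemma diag_osp12 i : gen_type G i = Tak_osp12 -> a i i = 1.
Proof. by move=> ty; have := gen_scaled G i; rewrite /cart /gen_t /gen_h /gen_f ty. Qed.

Lemma diag_sl11 i : gen_type G i = Tak_sl11 -> a i i = 0 /\ b i i = 0.
Proof.
move=> ty; have cq := typeP i; rewrite ty in cq.
have pE := lE_par i; have pF := lF_par i; rewrite ty in pE pF.
have pe := le_par i; have pf := lf_par i; rewrite ty in pe pf.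
split.
  have := central_quotient_central lieL cq (@takiff_sl11_central K true)
    (sub_gen (gen_e G i)) (sub_gen (gen_f G i)) (sub_gen (gen_e G i)) pe pf.
  rewrite br_ef br_h_pos => /eqP.
  by rewrite scaler_eq0 (negPf (le_neq0 i)) orbF => /eqP.
have := central_quotient_central lieL cq (@takiff_sl11_central K false)
  (sub_gen (gen_E G i)) (sub_gen (gen_F G i)) (sub_gen (gen_E G i)) pE pF.
rewrite br_EF br_c_pos => /eqP.
by rewrite scaler_eq0 (negPf (lE_neq0 i)) orbF => /eqP.
Qed.

Lemma ad_nil_gen s i (x : cd_g A s i) s' j (z : cd_g A s' j) :
  nil_set (br (ig x)) (ig z).
Proof.
have [N h] := km1 s i s' j; exists N; rewrite -[RHS](h (nseq N x) z (size_nseq _ _)).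
by elim: {h}N => //= N ->.
Qed.

Lemma ad_nil_h s i p (x : cd_g A s i) z : svpar p x -> nil_set (br (ig x)) (ih z).
Proof.
move=> px; have sN := nil_set_subspace (brr lieL (ig x)).
have [z0 [z1 [p0 p1 ->]]] := svpar_split z.
rewrite (is_linearD (rz_h_linear rz)).
have H q t : svpar q t -> nil_set (br (ig x)) (ih t).
  move=> qt; have [N NE] : nil_set (br (ig x)) (br (ig x) (ih t)).
    rewrite (lie_skew lieL (rz_g_parity rz px) (rz_h_parity rz qt)) (rz_hg rz).
    by apply: (subspaceZ _ sN); exact: ad_nil_gen.
  by exists N.+1; rewrite iterSr.
by apply: (subspaceD sN); [exact: H p0|exact: H p1].
Qed.

(** For an even [x] the Leibniz rule makes the vectors killed by a power of ad(x) a subalgebra: if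
    exponents N and M kill [u] and [v], then N + M kills their bracket. *)
Lemma ad_loc_nil (x : L) : par false x ->
  (forall s i (z : cd_g A s i), nil_set (br x) (ig z)) ->
  (forall z, nil_set (br x) (ih z)) -> forall v, nil_set (br x) v.
Proof.
move=> px xg xh; apply: gen => //; first exact: (nil_set_subspace (brr lieL x)).
move=> u v [N uN] [M vM]; exists (N + M)%N.
have l0 k : iter k (br x) 0 = 0 by exact: (is_linear0 (iter_linear k (brr lieL x))).
suff H k : forall N M u v, (N + M)%N = k -> iter N (br x) u = 0 ->
    iter M (br x) v = 0 -> iter k (br x) (br u v) = 0 by exact: H uN vM.
elim: k {N M u v uN vM} => [|k IH] N M u v.
  by case: N => // _ /= -> _; rewrite (br0l lieL).
case: N => [_ /= -> _|N]; first by rewrite (br0l lieL) -iterS l0.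
case: M => [_ _ /= ->|M e uN vM]; first by rewrite (br0r lieL) -iterS l0.
rewrite iterSr (jacobi_even lieL _ _ px) (is_linearD (iter_linear k (brr lieL x))).
by rewrite (IH N M.+1) ?(IH N.+1 M) ?addr0 -?iterSr //; lia.
Qed.

Lemma ad_even_loc_nil s i (x : cd_g A s i) v : svpar false x -> nil_set (br (ig x)) v.
Proof.
move=> px; apply: ad_loc_nil; first exact: (rz_g_parity rz px).
  by move=> s' j z; exact: ad_nil_gen.
by move=> z; exact: (ad_nil_h _ px).
Qed.

(** For an odd [x] the Leibniz rule carries signs, so the argument is run for the even element
    [x, x], whose adjoint action is 2 ad(x)^2. *)
Lemma ad_odd_loc_nil s i (x : cd_g A s i) v : svpar true x -> nil_set (br (ig x)) v.
Proof.
move=> px; have pX := rz_g_parity rz px; set X := ig x in pX *.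
have pXX : par false (br X X) by exact: (lie_parity lieL pX pX).
have sq w : br (br X X) w = 2 *: br X (br X w).
  by rewrite (br_br lieL _ pX pX) /koszul expr1 scaleN1r opprK scaler_nat mulr2n.
have it N w : iter N (br (br X X)) w = 2 ^+ N *: iter N.*2 (br X) w.
  elim: N => [|N IH]; first by rewrite scale1r.
  by rewrite iterS IH (brZr lieL) sq scalerA -exprSr doubleS.
have nil w : nil_set (br X) w -> nil_set (br (br X X)) w.
  case=> N NE; exists N; rewrite it (iter_nil (brr lieL X) _ NE) ?scaler0 //.
  by rewrite -addnn leq_addr.
have [N] : nil_set (br (br X X)) v.
  apply: ad_loc_nil => // [s' j z|z]; apply: nil; first exact: ad_nil_gen.
  exact: (ad_nil_h _ px).
rewrite it => /eqP; rewrite scaler_eq0 expf_eq0 pnatr_eq0 andbF => /eqP.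
by exists N.*2.
Qed.

Hypothesis hX : completely_X_coupled G.
Hypothesis km2 : KM2 A.

Lemma sl2_tripleP i : gen_type G i = Tak_sl2 -> sl2_triple par br (le i) (lf i) (lh i).
Proof.
move=> ty; have [aii _] := diag_sl2 ty.
split; rewrite ?br_h_pos ?br_h_neg ?aii ?br_ef //.
  by have := le_par i; rewrite ty.
by have := lf_par i; rewrite ty.
Qed.

Section Pair.
Variables i j : 'I_n.
Hypothesis ij : i != j.

Let p := br (lE i) (le j).

(** Complete X-coupling is what makes this vanish: [f_i, E_i] is a multiple of H_i, and H_i sends
    e_j to x_ij E_j = 0. *)
Lemma pair_lower_i : br (lf i) p = 0.
Proof.
rewrite /p (lie_jacobi lieL _ (lf_par i) (lE_par i)).
rewrite (br_neg_pos0 (gen_f_parity G i) (gen_e_parity G j) ij) (br0r lieL) scaler0.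
rewrite addr0 (lie_skew lieL (lf_par i) (lE_par i)) br_Ef (brZl lieL) br_H_e.
by rewrite (gen_x_off km3 km4 hX ij) scale0r scaler0.
Qed.

Lemma pair_weight : br (lh i) p = (a i i + a i j) *: p.
Proof.
by rewrite /p (jacobi_even lieL _ _ (lh_par i)) !br_h_pos (brZl lieL) (brZr lieL) -scalerDl.
Qed.

Hypothesis aji : a j i != 0.

Lemma pair_lower_j : exists2 c, c != 0 & br (lf j) p = c *: lE i.
Proof.
rewrite /p (lie_jacobi lieL _ (lf_par j) (lE_par i)).
rewrite (br_neg_pos0 (gen_f_parity G j) (gen_E_parity G i)) 1?eq_sym //.
rewrite (br0l lieL) add0r (lie_skew lieL (lf_par j) (le_par j)) br_ef (brZr lieL).
rewrite -[br (lE i) (lh j)]opprK -(skew_even lieL _ (lh_par j)) br_h_pos.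
rewrite -scaleNr !scalerA; eexists; last by [].
by rewrite !mulf_neq0 ?oppr_eq0 // /koszul signr_eq0.
Qed.

Lemma pair_neq0 : p != 0.
Proof.
have [c c0 e] := pair_lower_j; apply: contraNneq (lE_neq0 i) => p0.
by move/eqP: e; rewrite p0 (br0r lieL) eq_sym scaler_eq0 (negPf c0).
Qed.

(** The lowest weight 2 + a_ij of the vector [E_i, e_j] equals -k for a natural number k. *)
Lemma pair_sl2 : gen_type G i = Tak_sl2 -> exists k : nat, a i j = - (k.+2)%:R.
Proof.
move=> ty; have [aii _] := diag_sl2 ty.
have pe : svpar false (gen_e G i) by have := gen_e_parity G i; rewrite ty.
have [k kE] := sl2_triple_lowest lieL (sl2_tripleP ty) pair_weight pair_lower_i
  pair_neq0 (ad_even_loc_nil p pe).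
exists k; move/eqP: kE; rewrite aii addrC -subr_eq0 opprK => /eqP e.
by apply/eqP; rewrite -subr_eq0 opprK -addn2 natrD -[X in _ == X]e; apply/eqP; ring.
Qed.

Lemma pair_osp12 : gen_type G i = Tak_osp12 ->
  exists2 k : nat, a i j = - (k.+1)%:R & iter k.*2.+1 (br (le i)) p = 0.
Proof.
move=> ty; have aii := diag_osp12 ty.
have pe : svpar true (gen_e G i) by have := gen_e_parity G i; rewrite ty.
have Pe := le_par i; have Pf := lf_par i; rewrite ty /= in Pe Pf.
have [N NE] := ad_odd_loc_nil p pe.
have ef v : br (le i) (br (lf i) v) + br (lf i) (br (le i) v) = br (lh i) v.
  by rewrite -br_ef (br_br lieL _ Pe Pf) /koszul expr1 scaleN1r opprK.
have he c v : br (lh i) v = c *: v -> br (lh i) (br (le i) v) = (c + 1) *: br (le i) v.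
  move=> hv; rewrite (jacobi_even lieL _ _ (lh_par i)) hv br_h_pos aii scale1r (brZr lieL).
  by rewrite scalerDl scale1r addrC.
have [k kE kz] := osp_lowest_weight (brr lieL (le i)) (brr lieL (lf i)) ef he
  pair_weight pair_lower_i pair_neq0 NE.
exists k => //; move/eqP: kE; rewrite aii addrC -subr_eq0 opprK => /eqP e.
by apply/eqP; rewrite -subr_eq0 opprK -addn1 natrD -[X in _ == X]e; apply/eqP; ring.
Qed.

Lemma pair_osp12_neq : gen_type G i = Tak_osp12 -> br (le i) p != 0.
Proof.
move=> ty; have aii := diag_osp12 ty; apply/eqP => ep0.
have Pe := le_par i; have Pf := lf_par i; have PE := lE_par i; rewrite ty /= in Pe Pf PE.
have eE : br (le i) (lE i) = 0.
  have : br (lf j) (br (le i) p) = 0 by rewrite ep0 (br0r lieL).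
  rewrite (lie_jacobi lieL _ (lf_par j) (le_par i)).
  rewrite (br_neg_pos0 (gen_f_parity G j) (gen_e_parity G i)) 1?eq_sym //.
  have [c c0 ->] := pair_lower_j.
  rewrite (br0l lieL) add0r (brZr lieL) scalerA => /eqP.
  by rewrite scaler_eq0 mulf_eq0 (negPf c0) /koszul signr_eq0 => /eqP.
(* This contradicts [f_i, [e_i, E_i]] = (a_ii + x_ii) E_i = 2 E_i. *)
have : br (lf i) (br (le i) (lE i)) = 0 by rewrite eE (br0r lieL).
rewrite (jacobi_odd lieL _ Pf Pe) (skew_odd lieL Pf Pe) br_ef br_h_pos aii.
rewrite -[br (lf i) (lE i)]opprK -(skew_even lieL _ PE) br_Ef (brNr lieL) opprK.
rewrite (skew_odd lieL Pe (lH_par i)) br_H_e (coupling_diag G km3 km4 i).1 aii.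
rewrite -scalerDl => /eqP; rewrite scaler_eq0 (negPf (lE_neq0 i)) orbF.
by rewrite -mulr2n pnatr_eq0.
Qed.

End Pair.

Lemma diag_neq0 i : gen_type G i <> Tak_sl11 -> a i i != 0.
Proof.
case ty: (gen_type G i) => // _; first by rewrite (diag_sl2 ty).1 pnatr_eq0.
by rewrite (diag_osp12 ty) oner_eq0.
Qed.

Lemma y_sym i j : i != j -> gen_type G j <> Tak_sl11 -> y i j != 0 ->
  y j i != 0 /\ a i j != 0.
Proof.
move=> ij /diag_neq0 aj yij.
have : y j i * a i j != 0 by rewrite (coupling_H km3 km4 hX) // mulf_neq0.
by rewrite mulf_eq0 negb_or => /andP[].
Qed.

(** Multiply y_ji a_ij = a_jj y_ij by y_ij a_ji = a_ii y_ji and cancel y_ij y_ji. *)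
Lemma cart_prod i j : i != j -> gen_type G i <> Tak_sl11 -> gen_type G j <> Tak_sl11 ->
  y i j != 0 -> a i j * a j i = a i i * a j j.
Proof.
move=> ij ti tj yij; have [yji aij] := y_sym ij tj yij.
have ji : j != i by rewrite eq_sym.
have e1 := coupling_H km3 km4 hX ij; have e2 := coupling_H km3 km4 hX ji.
apply: (mulfI (mulf_neq0 yij yji)).
transitivity ((y j i * a i j) * (y i j * a j i)); first by ring.
by rewrite e1 e2; ring.
Qed.

Lemma cart_ge i j : i != j -> gen_type G i <> Tak_sl11 -> gen_type G j <> Tak_sl11 ->
  y i j != 0 -> exists k d : nat, [/\ a i j = - (d + k)%:R, a i i = d%:R,
    (0 < d)%N & gen_type G i = Tak_sl2 /\ d = 2%N \/ (0 < k)%N].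
Proof.
move=> ij ti tj yij; have [yji aij] := y_sym ij tj yij.
have ji : j != i by rewrite eq_sym.
have [_ aji] := y_sym ji ti yji.
case ty: (gen_type G i) ti => // _.
  have [k kE] := pair_sl2 ij aji ty; exists k, 2%N; split=> //; last by left.
  by rewrite (diag_sl2 ty).1.
have [k kE kz] := pair_osp12 ij aji ty; exists k, 1%N; split=> //.
  by rewrite (diag_osp12 ty).
right; case: k {kE} kz => // kz.
by have := pair_osp12_neq ij aji ty; rewrite [br _ _]kz eqxx.
Qed.

(** With a_ij = -(d + k) and a_ji = -(d' + k') the product formula reads (d + k)(d' + k') = d d'. So
    k = k' = 0, which [cart_ge] allows only in type Tak(sl(2)). *)
Lemma pair_coupled i j : i != j -> gen_type G i <> Tak_sl11 ->
  gen_type G j <> Tak_sl11 -> y i j != 0 ->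
  [/\ gen_type G i = Tak_sl2, gen_type G j = Tak_sl2, a i j = -2 & a j i = -2].
Proof.
move=> ij ti tj yij; have ji : j != i by rewrite eq_sym.
have [yji _] := y_sym ij tj yij.
have [k [d [ek ed d0 H]]] := cart_ge ij ti tj yij.
have [k' [d' [ek' ed' d0' H']]] := cart_ge ji tj ti yji.
have := cart_prod ij ti tj yij; rewrite ek ek' ed ed' mulrNN -!natrM => /eqP.
rewrite eqr_nat => /eqP e.
case: H => [[t1 d2]|k0]; last nia.
case: H' => [[t2 d2']|k0']; last nia.
subst d d'; have [-> ->] : k = 0%N /\ k' = 0%N by nia.
by [].
Qed.

(** Here E_i and F_i are even, and c_i commutes with E_i because b_ii = 0. So c_i acts by the scalar
    b_ij on the whole E_i-string through E_j, which is finite by (KM1). *)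
Lemma sl11_heisenberg i j : i != j -> gen_type G i = Tak_sl11 -> b i j = 0.
Proof.
move=> ij ty; have [_ bii] := diag_sl11 ty.
have PF := lF_par i; have PE := lE_par i; rewrite ty /= in PF PE.
have [N NE] := ad_nil_gen (gen_E G i) (gen_E G j).
suff : - b i j = 0 by move/eqP; rewrite oppr_eq0 => /eqP.
apply: (heisenberg_nilpotent (brr lieL (lE i)) (brr lieL (lF i)) _ _ NE (lE_neq0 j)).
  move=> k; rewrite (jacobi_even lieL _ _ PF) addrC; congr (_ + _).
  rewrite (skew_even lieL _ PF) br_EF (brNl lieL) scaleNr; congr (- _).
  elim: k => [|k IH] /=; first by rewrite br_c_pos.
  rewrite (jacobi_even lieL _ _ (lc_par i)) br_c_pos bii scale0r (br0l lieL) add0r.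
  by rewrite IH (brZr lieL).
exact: (br_neg_pos0 (gen_F_parity G i) (gen_E_parity G j) ij).
Qed.

(** By (KM2) it is enough that y_ij or y_ji vanishes. If y_ij <> 0, then a_ii = 0 forces a_ji = 0,
    and b_ji = 0 follows from the Heisenberg argument if [j] also has type Tak(sl(1|1)), and
    otherwise from [coupling_self] with a_jj <> 0. The coupling relation now gives y_ji = 0. *)
Lemma sl11_isolated i j : i != j -> gen_type G i = Tak_sl11 ->
  h_root_kills i j /\ h_root_kills j i.
Proof.
move=> ij ty; have ji : j != i by rewrite eq_sym.
have [aii _] := diag_sl11 ty.
suff [h|h] : y i j = 0 \/ y j i = 0.
- have k := y0_kills hX ij h; split=> //; exact: km2.
- have k := y0_kills hX ji h; split=> //; exact: km2.
have [->|yij] := eqVneq (y i j) 0; first by left.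
right; have := coupling_H km3 km4 hX ji; rewrite aii mul0r => /eqP.
rewrite mulf_eq0 (negPf yij) /= => /eqP aji.
have [x x0] := gen_r_neq0 G km3 km4 i.
suff bji : b j i = 0.
  have := coupling_off km3 km4 hX x ji; rewrite aji bji !mulr0 addr0 => /esym/eqP.
  by rewrite mulf_eq0 (negPf x0) => /eqP.
have [tj|tj] := pselect (gen_type G j = Tak_sl11); first exact: sl11_heisenberg.
have := coupling_self km3 km4 hX ji; rewrite aji mulr0 add0r => /eqP.
by rewrite mulf_eq0 (negPf (diag_neq0 tj)) => /eqP.
Qed.

Lemma pair_dichotomy i j : i != j ->
  (h_root_kills i j /\ h_root_kills j i) \/
  [/\ gen_type G i = Tak_sl2, gen_type G j = Tak_sl2, a i j = -2, a j i = -2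
    & y i j != 0 /\ y j i != 0].
Proof.
move=> ij; have ji : j != i by rewrite eq_sym.
have [ti|ti] := pselect (gen_type G i = Tak_sl11); first by left; exact: sl11_isolated.
have [tj|tj] := pselect (gen_type G j = Tak_sl11).
  by left; have [] := sl11_isolated ji tj.
have [y0|y0] := eqVneq (y i j) 0.
  by left; have k := y0_kills hX ij y0; split=> //; exact: km2.
right; have [t1 t2 a1 a2] := pair_coupled ij ti tj y0; split=> //.
by have [] := y_sym ij tj y0.
Qed.

(** Evaluation of the relation for the pair (j, i) at H_k: r_i takes the value x_ki = 0 and the
    b-term is zero, which leaves y_kj a_ji = 0. *)
Lemma no_third_vertex i j k : j != i -> k != i ->
  y k j != 0 -> b j i = 0 -> a j i != 0 -> False.
Proof.
move=> ji ki ykj bji aji.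
have := coupling_off km3 km4 hX (gen_o G k) ji; rewrite bji mulr0 addr0.
rewrite -/(gen_x G km3 km4 k i) (gen_x_off km3 km4 hX ki) mul0r => /eqP.
by rewrite mulf_eq0 (negPf aji) orbF -/(gen_y G km3 km4 k j) (negPf ykj).
Qed.

Lemma cartc_sl2 i j : i != j -> gen_type G i = Tak_sl2 -> b i j = 0.
Proof.
move=> ij ty; have [aii bii] := diag_sl2 ty.
have := coupling_self km3 km4 hX ij; rewrite aii bii mul0r add0r => /eqP.
by rewrite mulf_eq0 pnatr_eq0 => /eqP.
Qed.

Lemma two_vertices : indecomposable A -> (1 < n)%N ->
  exists i j, [/\ i != j, forall k, (k == i) || (k == j),
    gen_type G i = Tak_sl2 /\ gen_type G j = Tak_sl2, a i j = -2 & a j i = -2].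
Proof.
move=> ind n1.
(* Indecomposability as connectedness: a coupled pair leaves every nonempty proper set of vertices.
   It is used for one vertex, and then for the pair so found. *)
have edge (P : pred 'I_n) i0 k0 : P i0 -> ~~ P k0 -> exists i j, [/\ P i, ~~ P j &
    [/\ gen_type G i = Tak_sl2, gen_type G j = Tak_sl2, a i j = -2, a j i = -2
      & y i j != 0 /\ y j i != 0]].
  move=> Pi Pk; apply: contrapT => none; apply: ind; exists [set k | P k]%SET; split.
  - by apply/set0Pn; exists i0; rewrite finset.in_set.
  - by apply/negP => /eqP/setP/(_ k0); rewrite finset.in_set finset.in_setT (negPf Pk).
  move=> i j; rewrite !finset.in_set => iP jP.
  have ij : i != j by apply: contraNneq jP => <-.
  by have [//|cpl] := pair_dichotomy ij; case: none; exists i, j.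
have [i [j [/eqP ii0 ji0 [ti tj aij aji [yij yji]]]]] :=
  edge (pred1 (Ordinal (ltnW n1))) (Ordinal (ltnW n1)) (Ordinal n1) (eqxx _) isT.
have ij : i != j by apply: contraNneq ji0 => <-; rewrite ii0 /=.
have a20 : (-2 : K) != 0 by rewrite oppr_eq0 pnatr_eq0.
exists i, j; split=> // k; apply: contrapT => /negP Pk.
have [|p [q [/orP Pp Pq [tp tq apq aqp [ypq yqp]]]]] :=
  edge (fun k => (k == i) || (k == j)) i k _ Pk; first by rewrite eqxx.
move: Pq; rewrite negb_or => /andP[qi qj].
have ji : j != i by rewrite eq_sym.
case: Pp => /eqP e; subst p.
  by apply: (no_third_vertex (j := i) ij qj yqp); rewrite ?aij // (cartc_sl2 ij).
by apply: (no_third_vertex (j := j) ji qi yqp); rewrite ?aji // (cartc_sl2 ji).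
Qed.

(** * Root modules in the coupled case, uniformly in the sign *)

Section Coupled.
Hypothesis all_sl2 : forall i, gen_type G i = Tak_sl2.
Hypothesis cartE : forall i j, a i j = if i == j then 2 else -2.

Definition gen_R s : forall i, cd_g A s i :=
  if s return forall i, cd_g A s i then gen_f G else gen_e G.
Definition gen_R' s : forall i, cd_g A s i :=
  if s return forall i, cd_g A s i then gen_F G else gen_E G.
Definition gen_hh (s : bool) i : L := if s then - lh i else lh i.

Lemma gen_R_par s i : svpar false (gen_R s i).
Proof.
case: s; first by have := gen_f_parity G i; rewrite all_sl2.
by have := gen_e_parity G i; rewrite all_sl2.
Qed.

Lemma gen_R'_par s i : svpar true (gen_R' s i).
Proof.
case: s; first by have := gen_F_parity G i; rewrite all_sl2.
by have := gen_E_parity G i; rewrite all_sl2.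
Qed.

Lemma gen_R_triple s i :
  sl2_triple par br (ig (gen_R s i)) (ig (gen_R (~~ s) i)) (gen_hh s i).
Proof.
by case: s; [apply: (sl2_triple_opp lieL)|]; exact: sl2_tripleP.
Qed.

Lemma gen_hh_pos s i j (u : cd_g A s j) :
  br (gen_hh s i) (ig u) = (if i == j then 2 else - 2) *: ig u.
Proof.
case: s u => u; rewrite /gen_hh ?br_h_pos ?cartE //.
by rewrite (brNl lieL) br_h_neg cartE scaleNr opprK.
Qed.

Lemma gen_hh_neg s i (u : cd_g A (~~ s) i) :
  br (gen_hh s i) (ig u) = - 2 *: ig u.
Proof.
case: s u => /= u; rewrite /gen_hh ?br_h_neg ?cartE ?eqxx //.
by rewrite (brNl lieL) br_h_pos cartE eqxx scaleNr.
Qed.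

Lemma gen_R_basis s i q (z : cd_g A s i) : svpar q z ->
  exists c, z = c *: gen_R s i \/ z = c *: gen_R' s i.
Proof.
case: s z => z /= qz.
  have [c ->] := g_neg_basis G km3 km4 qz; exists c.
  by case: eqP => _; [left|right].
have [c ->] := g_pos_basis G km3 km4 qz; exists c.
by case: eqP => _; [left|right].
Qed.

(** A bracket inside a simple root module has weight 4 for the sl(2)-triple, so it vanishes once the
    opposite even generator kills it. For brackets with the odd generator this follows from a_ii =
    x_ii = 2 and b_ii = y_ii = 0. *)
Lemma root_double_gen s i : [/\ br (ig (gen_R s i)) (ig (gen_R s i)) = 0,
  br (ig (gen_R s i)) (ig (gen_R' s i)) = 0 & br (ig (gen_R' s i)) (ig (gen_R' s i)) = 0].
Proof.
have [aii bii] := diag_sl2 (all_sl2 i).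
have [xii yii] := coupling_diag G km3 km4 i; rewrite aii in xii; rewrite bii in yii.
have PR s' := rz_g_parity rz (gen_R_par s' i).
have PR' s' := rz_g_parity rz (gen_R'_par s' i).
have PH := lH_par i.
have inj u v p q : svpar p u -> svpar q v ->
    br (ig (gen_R (~~ s) i)) (br (ig (u : cd_g A s i)) (ig (v : cd_g A s i))) = 0 ->
    br (ig u) (ig v) = 0.
  move=> pu qv low; apply: (sl2_triple_inj lieL (gen_R_triple s i) (m := 4) (k := 1)) => //.
    rewrite (jacobi_even lieL); last first.
      by case: (gen_R_triple s i) => h1 h2 <- _ _; exact: (lie_parity lieL h1 h2).
    rewrite !gen_hh_pos eqxx (brZl lieL) (brZr lieL) -scalerDl; congr (_ *: _).
    by rewrite -natrD.
  exact: (ad_even_loc_nil _ (gen_R_par s i)).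
split.
- have := skew_even lieL (ig (gen_R s i)) (PR s) => /eqP.
  by rewrite -addr_eq0 -mulr2n -scaler_nat scaler_eq0 pnatr_eq0 => /eqP.
- apply: (inj _ _ _ _ (gen_R_par s i) (gen_R'_par s i)).
  rewrite (jacobi_even lieL _ _ (PR _)); case: s {inj} => /=.
    rewrite br_ef br_h_neg aii br_eF.
    rewrite [br (lf i) _](skew_even lieL _ (PR true)) br_H_f xii all_sl2 expr0.
    by rewrite -scaleNr -scalerDl (_ : _ + _ = 0) ?scale0r //; ring.
  rewrite [br (lf i) (le i)](skew_even lieL _ (PR true)) br_ef (brNl lieL) br_h_pos aii.
  rewrite [br (lf i) (lE i)](skew_even lieL _ (PR true)) br_Ef (brNr lieL).
  rewrite [br (le i) _](skew_even lieL _ (PR false)) br_H_e xii opprK.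
  by rewrite addNr.
- apply: (inj _ _ _ _ (gen_R'_par s i) (gen_R'_par s i)).
  rewrite (jacobi_even lieL _ _ (PR _)); case: s {inj} => /=.
    rewrite br_eF (skew_odd lieL (PR' true) PH) br_H_F yii.
    by rewrite mulr0 scale0r addr0.
  rewrite [br (lf i) (lE i)](skew_even lieL _ (PR true)) br_Ef (brNr lieL) (brNl lieL).
  rewrite (skew_odd lieL (PR' false) PH) br_H_E yii.
  by rewrite scale0r oppr0 addr0.
Qed.

Lemma root_double s i p q (u v : cd_g A s i) :
  svpar p u -> svpar q v -> br (ig u) (ig v) = 0.
Proof.
have lin := @ig_linear s i; have [d1 d2 d3] := root_double_gen s i.
have d4 : br (ig (gen_R' s i)) (ig (gen_R s i)) = 0.
  rewrite -[LHS]opprK -(skew_even lieL _ (rz_g_parity rz (gen_R_par s i))) d2.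
  exact: oppr0.
move=> /gen_R_basis [c [->|->]] /gen_R_basis [c' [->|->]];
by rewrite !(is_linearZ lin) (brZl lieL) (brZr lieL) ?d1 ?d2 ?d3 ?d4 !scaler0.
Qed.

End Coupled.

End PairAnalysis.

(** * Growth of the coupled rank two algebra *)

Section RankTwoGrowth.
Variables (K : numClosedFieldType) (A : cartan_datum K).
Local Notation n := (cd_n A).
Variables (L : lmodType K) (par : bool -> set L) (br : L -> L -> L).
Variables (ih : cd_h A -> L) (ig : forall s i, cd_g A s i -> L).
Hypothesis rz : realizes par br ih ig.
Hypothesis gen : forall W : set L, subspace W ->
  (forall x y, W x -> W y -> W (br x y)) -> (forall x, W (ih x)) ->
  (forall s i (x : cd_g A s i), W (ig x)) -> forall v, W v.
Hypothesis ideal0 : forall I : set L, is_ideal par br I ->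
  (forall x, I (ih x) -> ih x = 0) -> forall v, I v -> v = 0.
Variable t0 : even_part (cd_h A).
Hypothesis t0P : forall i, cd_root A i t0 = 1.
Let lieL := rz_lie rz.

Hypothesis n2 : forall i j k : 'I_n, i != j -> (k == i) || (k == j).
Variables (R R' : forall s i, cd_g A s i) (hh : bool -> 'I_n -> L).
Hypothesis R_par : forall s i, svpar false (R s i).
Hypothesis R_triple : forall s i,
  sl2_triple par br (ig (R s i)) (ig (R (~~ s) i)) (hh s i).
Hypothesis hh_pos : forall s i j (u : cd_g A s j),
  br (hh s i) (ig u) = (if i == j then 2 else - 2) *: ig u.
Hypothesis hh_neg : forall s i (u : cd_g A (~~ s) i),
  br (hh s i) (ig u) = - 2 *: ig u.
Hypothesis R_nil : forall s i v, nil_set (br (ig (R s i))) v.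
Hypothesis root_double : forall s i p q (u v : cd_g A s i),
  svpar p u -> svpar q v -> br (ig u) (ig v) = 0.
Hypothesis R_basis : forall s i q (y : cd_g A s i), svpar q y ->
  exists c, y = c *: R s i \/ y = c *: R' s i.

Local Notation wsp := (wspan br ig).
Local Notation wrd := (word br ig).

(** The component G(k, l) for the simple roots [i] and [j], or its negative when [s] is true. *)
Definition cspan s i j k l := wsp s (fun w => count_mem i w = k /\ count_mem j w = l).

Lemma cspan_subspace s i j k l : subspace (cspan s i j k l).
Proof. exact: wspan_subspace. Qed.

Lemma cspanC s i j k l : cspan s i j k l `<=` cspan s j i l k.
Proof. by apply: wspan_sub => w []. Qed.

Lemma count2 (i j : 'I_n) w : i != j -> (count_mem i w + count_mem j w)%N = size w.
Proof.
move=> ij; elim: w => //= k w <-.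
have := n2 k ij; case: eqP => [-> _|_ /= /eqP ->].
  by rewrite (negPf ij) add1n add0n addSn.
by rewrite eqxx; lia.
Qed.

Lemma hh_par s i : par false (hh s i).
Proof. by case: (R_triple s i) => px py <- _ _; exact: (lie_parity lieL px py). Qed.

Lemma word_hh s i j w v : i != j -> wrd s w v ->
  br (hh s i) v = (2 * (count_mem i w)%:R - 2 * (count_mem j w)%:R) *: v.
Proof.
move=> ij; have letter k : (if i == k then 2 else - 2) =
    2 * (k == i)%:R - 2 * (k == j)%:R :> K.
  have := n2 k ij; rewrite [k == i]eq_sym; case: (eqVneq i k) => [<-|ik] /=.
    by rewrite (negPf ij) !(mulr1, mulr0, subr0).
  by move=> ->; rewrite !(mulr1, mulr0, sub0r).
elim=> {w v} [p k x px|p k x w v px wv IH]; first by rewrite hh_pos letter /= !addn0.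
rewrite (jacobi_even lieL _ _ (hh_par s i)) IH hh_pos (brZl lieL) (brZr lieL) -scalerDl.
by congr (_ *: _); rewrite letter /= !natrD; ring.
Qed.

Lemma cspan_hh s i j k l v : i != j -> cspan s i j k l v ->
  br (hh s i) v = (2 * k%:R - 2 * l%:R) *: v.
Proof.
move=> ij; apply: (lspan_sub (W := [set v | br (hh s i) v = (2 * k%:R - 2 * l%:R) *: v])).
  split; first by rewrite /= (br0r lieL) scaler0.
  move=> c u w /= hu hw; rewrite (brr lieL) hu hw scalerDr !scalerA.
  by rewrite [c * _]mulrC.
by move=> u [w wu [<- <-]] /=; exact: word_hh.
Qed.

Lemma cspan_lower s i j k l (y : cd_g A (~~ s) i) v : i != j -> (0 < k + l)%N ->
  cspan s i j k.+1 l v -> cspan s i j k l (br (ig y) v).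
Proof.
move=> ij kl; apply: (wspan_lower rz).
  by move=> w [e1 e2]; rewrite -(count2 w ij) e1 e2; lia.
move=> w w' [e1 e2] h; have := h i; have := h j; rewrite e1 e2 eqxx [j == i]eq_sym.
by rewrite (negPf ij) addn0 addn1 => <- [->].
Qed.

Lemma cspan_lower0 s i j l p (y : cd_g A (~~ s) i) v : i != j -> (0 < l)%N ->
  svpar p y -> cspan s i j 0 l v -> br (ig y) v = 0.
Proof.
move=> ij l0 py.
apply: (lspan_sub (W := [set v | br (ig y) v = 0])).
  split; first by rewrite /= (br0r lieL).
  by move=> c u w /= hu hw; rewrite (brr lieL) hu hw scaler0 addr0.
move=> u [w wu [e1 e2]] /=; have sw : size w = l by rewrite -(count2 w ij) e1 e2.
have [s1|s1] := ltnP 1 (size w).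
  have := word_lower rz py wu s1; apply: (lspan_sub (subspace_zero _)) => u' [w' _ h].
  by have := h i; rewrite e1 eqxx addn1.
case: wu e1 s1 {sw} => {w u e2} [q k x qx e1 _|q k x w u qx wu _]; last first.
  by rewrite /= ltnS leqn0; have := word_size wu; case: (size w).
have [z [_ -> z0]] := opp_br rz py qx; rewrite z0 ?(ih0 rz) //.
by move: e1 => /=; rewrite eq_sym; case: eqP.
Qed.

Lemma word_double s i w v : wrd s w v -> (forall k, k \in w -> k = i) ->
  (1 < size w)%N -> v = 0.
Proof.
elim=> {w v} [//|p k x w v px wv IH] wi; rewrite /= ltnS => _.
have ki : k = i by apply: wi; rewrite mem_head.
have wi' : forall k', k' \in w -> k' = i by move=> k' kw; apply: wi; rewrite inE kw orbT.
case: wv IH wi' => {w v wi} [q k' x' qx' _|q k' x' w v qx' wv IH] wi'.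
  have ki' : k' = i by apply: wi'; rewrite mem_head.
  by subst k k'; exact: root_double px qx'.
by rewrite IH ?(br0r lieL) // ltnS; exact: word_size wv.
Qed.

Lemma cspan_double s i j k v : i != j -> (1 < k)%N -> cspan s i j k 0 v -> v = 0.
Proof.
move=> ij k1; apply: (lspan_sub (subspace_zero _)) => u [w wu [e1 e2]].
apply: (word_double wu (i := i)); last by rewrite -(count2 w ij) e1 e2 addn0.
move=> k' kw; have := n2 k' ij; case/orP=> /eqP // kj; subst k'.
by move: kw; rewrite -has_pred1 has_count e2.
Qed.

Lemma cspan_simple s i j : i != j -> spanned (cspan s i j 1 0) 2.
Proof.
move=> ij; exists [:: ig (R s i); ig (R' s i)] => //.
apply: lspan_sub; first exact: lspan_subspace.
move=> u [w wu [e1 e2]].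
have sz : size w = 1%N by rewrite -(count2 w ij) e1 e2.
case: wu e1 sz {e2} => {w u} [q k x qx|q k x w u qx wu _ [/esym/eqP]]; last first.
  by have := word_size wu; case: (size w).
rewrite /= addn0; case: eqP => // ki _ _; subst k.
have sS := lspan_subspace [set` [:: ig (R s i); ig (R' s i)]].
have lin := @rz_g_linear _ _ _ _ _ _ _ rz s i.
have [c [->|->]] := R_basis qx; rewrite (is_linearZ lin); apply: (subspaceZ _ sS);
  by apply: sub_lspan; rewrite /= !inE eqxx ?orbT.
Qed.

Lemma cspan_iter_lower s i j k l t v : i != j -> (0 < l)%N -> (t <= k)%N ->
  cspan s i j k l v -> cspan s i j (k - t) l (iter t (br (ig (R (~~ s) i))) v).
Proof.
move=> ij l0; elim: t => [|t IH] tk kv; first by rewrite subn0.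
rewrite iterS; apply: cspan_lower => //; first lia.
by rewrite -subSn // subSS; apply: IH => //; lia.
Qed.

(* Reflection in the simple root [i]: lowering [2 (k - l)] times is injective on
   a component of weight [2 (k - l)] and lands in the reflected component. *)
Lemma cspan_real s N i j k l : (k + l <= N)%N -> (l < k)%N -> i != j ->
  spanned (cspan s i j k l) 2 /\ ((l.+2 <= k)%N -> forall v, cspan s i j k l v -> v = 0).
Proof.
elim: N i j k l => [|N IH] i j k l kN lk ij; first lia.
have [l0|l0] := posnP l.
  subst l; case: k lk kN => [//|[_ _|k _ _]].
    by split=> //; exact: cspan_simple.
  split=> [|_ v]; last exact: cspan_double.
  apply: (spanned_le (d := 0)) => //; apply: spanned0 => v.
  exact: cspan_double.
pose m := (k - l)%N; pose g := iter (2 * m) (br (ig (R (~~ s) i))).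
have lg : is_linear g by exact: (iter_linear _ (brr lieL _)).
have ginj v : cspan s i j k l v -> g v = 0 -> v = 0.
  move=> kv gv; apply: (sl2_triple_inj lieL (R_triple s i) _ (R_nil s i v) (leqnn _) gv).
  rewrite (cspan_hh ij kv) natrM /m natrB; last exact: ltnW.
  by congr (_ *: _); ring.
(* If k > 2l, the reflected weight has a negative coefficient, and k + 1 <= 2m lowerings already
   give zero. *)
have [ml|lm] := leqP m l; last first.
  have z v : cspan s i j k l v -> v = 0.
    move=> kv; apply: ginj => //.
    apply: (@iter_nil _ _ _ k.+1 _ _ (brr lieL _)); first by rewrite /m in lm *; lia.
    rewrite iterS; apply: (cspan_lower0 ij l0 (R_par _ _)).
    by have := cspan_iter_lower ij l0 (leqnn k) kv; rewrite subnn.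
  by split=> [|_]; [apply: (spanned_le (d := 0)) => //; exact: spanned0|].
have gk v : cspan s i j k l v -> cspan s j i l (l - m) (g v).
  move=> kv; apply: cspanC.
  (* The reflection sends (k, l) to (2l - k, l); with the roots swapped this is (l, l - m), which
     has the same difference m and a smaller sum. *)
  have -> : (l - m = k - 2 * m)%N by rewrite /m in ml *; lia.
  by apply: cspan_iter_lower => //; rewrite /m in ml *; lia.
have ji : j != i by rewrite eq_sym.
have [||sp zr] := IH j i l (l - m)%N _ _ ji; try by rewrite /m in ml *; lia.
split.
  by apply: (spanned_inj lg (cspan_subspace s i j k l) gk) => // v kv; exact: ginj.
move=> lk2 v kv; apply: ginj => //; apply: zr (gk _ kv).
by rewrite /m in ml *; lia.
Qed.

Lemma spanned_cspan_real s i j k l : (l < k)%N -> i != j -> spanned (cspan s i j k l) 2.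
Proof. by move=> lk ij; case: (cspan_real s (leqnn (k + l)) lk ij). Qed.

Lemma cspan_real0 s i j k l v : (l.+2 <= k)%N -> i != j -> cspan s i j k l v -> v = 0.
Proof.
move=> lk ij; have [|_] := cspan_real s (leqnn (k + l)) _ ij; last exact.
exact: ltnW.
Qed.

(** Lowering maps G(k+1, k+1) into G(k, k+1), of dimension at most 2, so passing to the kernel costs
    at most 2. *)
Lemma spanned_lower s i j k (W : set L) c y : i != j -> subspace W ->
  W `<=` cspan s i j k.+1 k.+1 -> spanned [set v | W v /\ br (ig (y : cd_g A (~~ s) i)) v = 0] c ->
  spanned W (2 + c).
Proof.
move=> ij sW Wk; apply: (spanned_rank_nullity (brr lieL (ig y)) sW (W' := cspan s j i k.+1 k)).
  by move=> v /Wk kv; apply: cspanC; apply: cspan_lower => //; lia.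
by apply: spanned_cspan_real => //; rewrite eq_sym.
Qed.

(** The bound 8 is 2 for each of the four lowering operators; their common kernel is zero by
    [killed_eq0]. *)
Lemma spanned_cspan_imag s i j k : i != j -> spanned (cspan s i j k.+1 k.+1) 8.
Proof.
move=> ij; have ji : j != i by rewrite eq_sym.
have ks y : subspace [set v | br y v = 0].
  split; first by rewrite /= (br0r lieL).
  by move=> c u w /= hu hw; rewrite (brr lieL) hu hw scaler0 addr0.
pose W0 := cspan s i j k.+1 k.+1.
have s0 : subspace W0 by exact: cspan_subspace.
apply: (@spanned_lower s i j k W0 6 (R (~~ s) i)) => //.
set W1 := [set v | _]; have s1 : subspace W1 by exact: (subspaceI s0 (ks _)).
apply: (@spanned_lower s i j k W1 4 (R' (~~ s) i)) => //; first by move=> v [].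
set W2 := [set v | _]; have s2 : subspace W2 by exact: (subspaceI s1 (ks _)).
apply: (@spanned_lower s j i k W2 2 (R (~~ s) j)) => //.
  by move=> v [[kv _] _]; exact: cspanC.
set W3 := [set v | _]; have s3 : subspace W3 by exact: (subspaceI s2 (ks _)).
apply: (@spanned_lower s j i k W3 0 (R' (~~ s) j)) => //.
  by move=> v [[[kv _] _] _]; exact: cspanC.
apply: spanned0 => v [[[[kv v1] v2] v3] v4].
apply: (killed_eq0 rz gen ideal0 t0P (s := s)).
  by apply: wspan_sub kv.
move=> i' q y qy; have lin := @rz_g_linear _ _ _ _ _ _ _ rz (~~ s) i'.
have [c yE] := R_basis qy; have := n2 i' ij.
case/orP=> /eqP e; subst i'; case: yE => ->; rewrite (is_linearZ lin) (brZl lieL).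
- by rewrite v1 scaler0.
- by rewrite v2 scaler0.
- by rewrite v3 scaler0.
- by rewrite v4 scaler0.
Qed.

(** Only words whose two letter counts differ by at most one survive: one component of bound 8 in
    even degree, two components of bound 2 in odd degree. *)
Lemma spanned_words s d (i j : 'I_n) : i != j -> (0 < d)%N ->
  spanned (wsp s (fun w => size w = d)) 8.
Proof.
move=> ij d0; have ji : j != i by rewrite eq_sym.
have wz w v : wrd s w v -> ((count_mem i w).+2 <= count_mem j w)%N \/
    ((count_mem j w).+2 <= count_mem i w)%N -> v = 0.
  move=> wv [h|h].
    by apply: (cspan_real0 (s := s) h ji); exact: (wspan_word wv).
  by apply: (cspan_real0 (s := s) h ij); exact: (wspan_word wv).
have [[k dk]|[k dk]] : (exists k, d = k.+1.*2) \/ (exists k, d = k.*2.+1).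
- case od: (odd d); [right|left]; last by exists d./2.-1; lia.
  by exists d./2; lia.
- apply: spanned_sub (spanned_cspan_imag s k ij).
  apply: lspan_sub; first exact: cspan_subspace.
  move=> v [w wv sw]; have cw := count2 w ij.
  have [e|e] := eqVneq (count_mem i w) k.+1.
    by apply: (wspan_word wv); split=> //; move: cw; rewrite sw dk e -addnn; lia.
  rewrite (wz _ _ wv); first exact: (subspace0 (cspan_subspace s i j k.+1 k.+1)).
  by move/eqP: e; move: cw; rewrite sw dk -addnn; lia.
apply: (spanned_le (d := 2 + 2)) => //.
apply: spanned_sub (spanned_lspanU (spanned_cspan_real s (ltnSn k) ij)
   (spanned_cspan_real s (ltnSn k) ji)).
apply: lspan_sub; first exact: lspan_subspace.
move=> v [w wv sw]; have cw := count2 w ij.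
have [e|e] := eqVneq (count_mem i w) k.
  by apply: sub_lspan; right; apply: (wspan_word wv); split=> //; move: cw; rewrite sw dk e -addnn; lia.
have [e'|e'] := eqVneq (count_mem i w) k.+1.
  by apply: sub_lspan; left; apply: (wspan_word wv); split=> //; move: cw; rewrite sw dk e' -addnn; lia.
rewrite (wz _ _ wv); first by apply: subspace0; exact: lspan_subspace.
by move/eqP: e; move/eqP: e'; move: cw; rewrite sw dk -addnn; lia.
Qed.

Lemma words_top_unbalanced s i j w v : i != j -> wrd s w v ->
  br (ig (R s i)) v = 0 -> (count_mem i w < count_mem j w)%N -> v = 0.
Proof.
move=> ij wv Rv lt.
have tr := sl2_triple_opp lieL (R_triple s i).
apply: (sl2_triple_inj lieL tr (m := 2 * (count_mem j w - count_mem i w)) (k := 1)).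
- rewrite (brNl lieL) (word_hh ij wv) -scaleNr natrM natrB; last exact: ltnW.
  by congr (_ *: _); ring.
- exact: R_nil.
- lia.
- exact: Rv.
Qed.

(* A word in the top degree is killed by all raising operators; sl2-theory makes
   its weight balanced and then forces all lowering operators to kill it too. *)
Lemma words_top s (i j : 'I_n) d : i != j -> (0 < d)%N ->
  (forall w v, wrd s w v -> size w = d.+1 -> v = 0) ->
  forall w v, wrd s w v -> size w = d -> v = 0.
Proof.
move=> ij d0 top w v wv sw; have ji : j != i by rewrite eq_sym.
have raise k u : wsp s (fun w => size w = d) u -> br (ig (R s k)) u = 0.
  move=> wu; have : wsp s (fun w => size w = d.+1) (br (ig (R s k)) u).
    by apply: (wspan_raise rz) wu => w' <-.
  by apply: (lspan_sub (subspace_zero _)) => u' [w' wu' sw']; exact: top wu' sw'.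
have wsv : wsp s (fun w => size w = d) v by exact: wspan_word wv sw.
have [lt|gt|eq] := ltngtP (count_mem i w) (count_mem j w).
- exact: words_top_unbalanced ij wv (raise _ _ wsv) lt.
- exact: words_top_unbalanced ji wv (raise _ _ wsv) gt.
apply: (killed_eq0 rz gen ideal0 t0P (s := s)); first exact: wspan_word wv _.
move=> k q y qy.
have [k' kk'] : exists k', k != k'.
  by have [->|ki] := eqVneq k i; [exists j|exists i].
have ek : count_mem k w = count_mem k' w.
  have := n2 k ij; have := n2 k' ij.
  case/orP=> /eqP e1; case/orP=> /eqP e2; subst k k'; rewrite ?eq //;
  by rewrite eqxx in kk'.
(* The lowered vector has weight 2 for the opposite triple, and raising it twice gives zero: after
   one step it is an element of h applied to [v], hence of degree d, and the second step kills that
   degree. *)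
apply: (sl2_triple_inj lieL (sl2_triple_opp lieL (R_triple s k)) (m := 2) (k := 2)) => //.
  rewrite (brNl lieL) (jacobi_even lieL _ _ (hh_par s k)) hh_neg (word_hh kk' wv).
  by rewrite ek subrr scale0r (br0r lieL) addr0 (brZl lieL) scaleNr opprK.
have PR := rz_g_parity rz (R_par s k).
have [z [_ zE _]] := opp_br rz qy (R_par s k).
rewrite /= (jacobi_even lieL _ v PR) (raise _ _ wsv) (br0r lieL) addr0.
rewrite (skew_even lieL (ig y) PR) zE (brNl lieL) (brNr lieL) raise ?oppr0 //.
exact: (wspan_ih rz).
Qed.

(** If degree d vanished, [words_top] would carry the vanishing down to degree 1, which contains
    [R s i]. *)
Lemma words_neq0 s i j d : i != j -> ig (R s i) != 0 -> (0 < d)%N ->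
  exists w v, [/\ wrd s w v, size w = d & v != 0].
Proof.
move=> ij R0; apply: contraPP => /forallNP nw d0.
have {nw} all0 : forall w v, wrd s w v -> size w = d -> v = 0.
  move=> w v wv sw; apply: contrapT => /eqP v0; apply: (nw w); exists v.
  by split.
have step m : (m < d)%N -> forall w v, wrd s w v -> size w = (d - m)%N -> v = 0.
  elim: m => [|m IH] md; first by rewrite subn0.
  apply: (words_top ij); first by rewrite subn_gt0.
  have -> : (d - m.+1).+1 = (d - m)%N by lia.
  by apply: IH; exact: ltnW.
move/eqP: R0; apply; apply: (step d.-1 _ [:: i]); rewrite ?prednK //.
- exact: word1 (R_par s i).
- by rewrite /= -subn1 subKn.
Qed.

End RankTwoGrowth.

(** * Gelfand-Kirillov dimension *)

Lemma log_ratio_cvg1 (R : realType) (S : nat -> nat) (C : nat) :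
  (forall N, N <= S N <= C * (2 * N).+1)%N ->
  (fun N : nat => ln (S N)%:R / ln N%:R : R) @ \oo --> (1 : R).
Proof.
move=> SN; have C0 : (0 < C)%N by have := SN 1%N; case: C {SN} => //; lia.
(* For N >= 1 one has C(2N + 1) <= 3CN, so ln S(N) - ln N stays between 0 and [B]. *)
pose B : R := ln (3 * C)%:R.
apply/cvgrPdist_le => e e0; near=> N.
have N2 : (2 <= N)%N by near: N; exact: nbhs_infty_ge.
have NB : expR (B / e) <= N%:R by near: N; exact: nbhs_infty_ger.
have N0 : 0 < N%:R :> R by rewrite ltr0n; lia.
have lnN : 0 < ln N%:R :> R by rewrite ln_gt0 // ltr1n.
have BN : B / e <= ln N%:R by rewrite -ler_expR lnK // posrE.
have /andP[lo hi] := SN N.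
have S0 : 0 < (S N)%:R :> R by rewrite ltr0n; lia.
have lo' : ln N%:R <= ln (S N)%:R :> R by rewrite ler_ln ?posrE // ler_nat.
have hi' : ln (S N)%:R <= B + ln N%:R.
  rewrite /B -lnM ?posrE //; last by rewrite ltr0n; lia.
  rewrite -natrM ler_ln ?posrE ?ler_nat //; first nia.
  by rewrite ltr0n; nia.
rewrite distrC -[X in _ - X](divff (lt0r_neq0 lnN)) -mulrBl.
rewrite ger0_norm; last by rewrite divr_ge0 ?subr_ge0 // ltW.
rewrite ler_pdivrMr //.
rewrite lerBlDr (le_trans hi') // lerD2r.
by rewrite mulrC -ler_pdivrMr.
Unshelve. all: by end_near.
Qed.

Lemma log_ratio_esup (R : realType) (S : nat -> nat) (C : nat) :
  (forall N, N <= S N <= C * (2 * N).+1)%N ->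
  limn_esup (fun N : nat => (ln (S N)%:R / ln N%:R : R)%:E) = 1%:E.
Proof.
move=> /log_ratio_cvg1 H; apply: (cvg_limn_einf_sup _).2.
by apply: cvg_EFin; [exact: nearW|exact: H].
Qed.

Lemma growth_sum_bounds (d : int -> nat) (C N : nat) :
  (forall j, d j <= C)%N -> (forall j, (0 < j)%R -> 0 < d j)%N ->
  (N <= \sum_(k < (2 * N).+1) d (k%:Z - N%:Z)%R <= C * (2 * N).+1)%N.
Proof.
move=> dC d0; apply/andP; split; last first.
  apply: (@leq_trans (\sum_(k < (2 * N).+1) C)).
    by apply: leq_sum => k _; exact: dC.
  by rewrite sum_nat_const card_ord mulnC.
rewrite -(big_mkord predT (fun k => d (k%:Z - N%:Z)%R)).
(* Index N + 1 is degree 1: the upper part of the sum runs over N positive degrees, each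
   contributing at least 1. *)
rewrite (@big_cat_nat _ _ _ N.+1) //=; last lia.
apply: leq_trans (leq_addl _ _).
apply: (@leq_trans (\sum_(N.+1 <= k < (2 * N).+1) 1)%N).
  by rewrite sum_nat_const_nat muln1; lia.
rewrite big_nat_cond [X in (_ <= X)%N]big_nat_cond; apply: leq_sum => k /andP[/andP[Nk _] _].
apply: d0; lia.
Qed.

(** * Dimensions of the degree parts *)

Section DegreeParts.
Variables (K : numClosedFieldType) (A : cartan_datum K).
Variable t0 : even_part (cd_h A).
Hypothesis t0P : forall i, cd_root A i t0 = 1.
Let rzg := g_realizes A.
Let lieg := rz_lie rzg.
Let D := g_br (A := A) (g_h ((t0, 0) : cd_h A)).
Local Notation gw := (wspan (@g_br K A) (@g_g K A)).

Lemma monomial_degree j (v : galg A) : monomial j v -> D v = j%:~R *: v.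
Proof.
have pt : g_par false (g_h ((t0, 0) : cd_h A)) by exact: (rz_h_parity rzg).
elim=> {j v} [x|s i x|j k x y _ Dx _ Dy].
- by rewrite /D (ih_degree rzg) scale0r.
- rewrite /D (rz_hg rzg) cd_weight t0P mulr1 (is_linearZ (@rz_g_linear _ _ _ _ _ _ _ rzg s i)).
  by case: s x => x; rewrite ?expr0 ?expr1 ?mulr1z ?mulrN1z.
by rewrite intrD; exact: (weightD lieg pt Dx Dy).
Qed.

Lemma degree_part_eigen j v : @degree_part K A j v -> D v = j%:~R *: v.
Proof.
apply: (lspan_sub (eigen_subspace (brr lieg _) _)).
exact: monomial_degree.
Qed.

Lemma word_monomial w v : word (@g_br K A) (@g_g K A) false w v -> monomial (size w) v.
Proof.
elim=> {w v} [p i x px|p i x w v px _ IH]; first exact: (mono_g x).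
by have := mono_br (mono_g x) IH; rewrite expr0 /= -intS.
Qed.

(** A nonzero degree lies in an eigenspace of ad(t0), hence in the span of words of one sign and
    length; degree zero lies in the image of h, whose dimension is therefore added to the bound. *)
Lemma degree_part_spanned C : (forall s d, (0 < d)%N ->
    spanned (gw s (fun w => size w = d)) C) ->
  exists C', forall j, spanned (@degree_part K A j) C'.
Proof.
move=> H; pose m := \dim {: cd_h A}; exists (C + m)%N => j.
have wd s d : (0 < d)%N -> @degree_part K A j `<=` gw s (fun w => size w = d) ->
    spanned (@degree_part K A j) (C + m).
  move=> d0 sub; apply: (spanned_le (leq_addr _ _)); apply: spanned_sub sub _.
  exact: H.
case: j wd => [[|d]|d] wd.
- apply: (spanned_le (leq_addl C m)).
  exists [seq g_h (A := A) x | x <- vbasis {: cd_h A}]; first by rewrite size_map size_tuple.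
  move=> v /degree_part_eigen; rewrite scale0r => /(degree0_h rzg (@galg_gen _ A) t0P)[x ->].
  rewrite (coord_vbasis (memvf x)) (is_linear_sum (rz_h_linear rzg)).
  have sS := lspan_subspace [set` [seq g_h (A := A) x | x <- vbasis {: cd_h A}]].
  apply: (subspace_sum _ sS) => k _; rewrite (is_linearZ (rz_h_linear rzg)).
  apply: (subspaceZ _ sS); apply: sub_lspan => /=; apply: map_f.
  by rewrite mem_nth // size_tuple.
- apply: (wd false d.+1) => // v /degree_part_eigen Dv.
  have Dv' : D v = ((-1) ^+ false * d.+1%:R) *: v by rewrite Dv expr0 mul1r.
  exact: (degree_words rzg (@galg_gen _ A) t0P _ Dv').
- apply: (wd true d.+1) => // v /degree_part_eigen Dv.
  have Dv' : D v = ((-1) ^+ true * d.+1%:R) *: v.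
    by rewrite Dv expr1 mulN1r NegzE mulrNz.
  exact: (degree_words rzg (@galg_gen _ A) t0P _ Dv').
Qed.

Lemma degree_part_dims C : (forall s d, (0 < d)%N ->
    spanned (gw s (fun w => size w = d)) C) ->
  (forall d, (0 < d)%N -> exists w v, [/\ word (@g_br K A) (@g_g K A) false w v,
     size w = d & v != 0]) ->
  exists (C' : nat) (d : int -> nat), [/\ forall j, has_dim (@degree_part K A j) (d j),
    forall j, (d j <= C')%N & forall j, (0 < j)%R -> (0 < d j)%N].
Proof.
move=> /degree_part_spanned [C' HC] nz.
have /choice[d dP] : forall j, exists d, (d <= C')%N /\ has_dim (@degree_part K A j) d.
  move=> j; have [d le hd] := spanned_has_dim (lspan_subspace _) (HC j).
  by exists d.
exists C', d; split=> j; try by case: (dP j).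
case: j => // -[//|m] _; have [w [v [wv sw v0]]] := nz m.+1 isT.
apply: (has_dim_gt0 (dP _).2 _ v0); apply: sub_lspan.
by rewrite -sw; exact: word_monomial.
Qed.

End DegreeParts.

(** * The Dynkin diagram and the theorem *)

Lemma qX_A11_diagram (K : numClosedFieldType) (A : cartan_datum K)
    (G : generators A) (i j : 'I_(cd_n A)) : i != j ->
  (forall k, (k == i) || (k == j)) -> (forall k, gen_type G k = Tak_sl2) ->
  (forall k l, cart G k l = if k == l then 2 else -2) ->
  diagram_iso (dynkin_diagram G) (qX_A11 K).
Proof.
move=> ij kij ty aE; have ji : j != i by rewrite eq_sym.
pose f (k : 'I_(cd_n A)) : 'I_2 := if k == i then ord0 else ord_max.
have fi : injective f.
  move=> k l; rewrite /f; have := kij k; have := kij l.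
  case: (eqVneq k i) => [->|ki] /=; case: (eqVneq l i) => [->|li] //=.
  by move=> /eqP -> /eqP ->.
exists f; split.
- exists (fun o : 'I_2 => if o == ord0 then i else j).
    by move=> k; have := kij k; rewrite /f; case: (eqVneq k i) => [->|ki /= /eqP ->].
  move=> o; rewrite /f; case: (eqVneq o ord0) => [->|o0]; first by rewrite eqxx.
  rewrite (negPf ji); apply: val_inj; case: o o0 => -[|[|]] //.
- by move=> k; rewrite /= ty; case: ifP.
move=> k l /=; rewrite (inj_eq fi) !mxE -!/(cart G _ _) !aE [l == k]eq_sym.
case: (eqVneq k l) => [//|kl] /=.
by rewrite mulrNN -natrM pnatr_eq0 /=; case: ifP.
Qed.

Theorem theorem1p2 (R : realType) (A : cartan_datum R[i]) (G : generators A)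
    (hQKM : QKM A) (hindec : indecomposable A)
    (hX : completely_X_coupled G) (hn : (1 < cd_n A)%N) :
  [/\ finite_growth A,
      has_GK_dim A 1%:E
    & [\/ diagram_iso (dynkin_diagram G) (qX_A11 R[i]),
          diagram_iso (dynkin_diagram G) (qX_A22 R[i])
        | diagram_iso (dynkin_diagram G) (qX_bullet_A22 R[i])]].
Proof.
have [km1 km2 km3 km4 _] := hQKM.
have [t0 t0P] := @roots_separate _ A (fun=> 1).
have rz := g_realizes A; have gen := @galg_gen _ A.
have ideal0 := @galg_ideal_trivial _ A; have tyP := gen_typeP G.
have [i [j [ij kij [ti tj] aij aji]]] :=
  two_vertices km3 km4 rz gen ideal0 km1 tyP t0P hX km2 hindec hn.
have ty k : gen_type G k = Tak_sl2 by have := kij k; case/orP=> /eqP ->.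
have aE k l : cart G k l = if k == l then 2 else -2.
  have diag := fun m => (diag_sl2 km3 km4 rz gen ideal0 tyP t0P (ty m)).1.
  have [->|kl] := eqVneq k l; first exact: diag.
  have := kij k; have := kij l; case/orP=> /eqP e1; case/orP=> /eqP e2; subst k l => //;
  by rewrite eqxx in kl.
have n2 (p q k : 'I_(cd_n A)) : p != q -> (k == p) || (k == q).
  have := kij p; have := kij q; case/orP=> /eqP ->; case/orP=> /eqP -> pq;
  by rewrite ?eqxx in pq * => //; rewrite orbC kij.
have R_nil s k v : nil_set (@g_br _ A (g_g (gen_R G s k))) v.
  exact: (ad_even_loc_nil rz gen km1 _ (gen_R_par ty s k)).
have R_par := gen_R_par ty.
have R_triple := gen_R_triple km3 km4 rz gen ideal0 tyP t0P ty.
have hh_pos := gen_hh_pos rz aE; have hh_neg := gen_hh_neg rz aE.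
have dbl := root_double km3 km4 rz gen ideal0 km1 tyP t0P ty aE.
have R_basis := @gen_R_basis _ _ G km3 km4.
have e_neq0 := le_neq0 km3 km4 rz gen ideal0 tyP t0P i.
have sp s d (d_gt0 : (0 < d)%N) :=
  spanned_words rz gen ideal0 t0P n2 R_par R_triple hh_pos R_nil dbl R_basis s ij d_gt0.
have nz d (d_gt0 : (0 < d)%N) :=
  words_neq0 rz gen ideal0 t0P n2 R_par R_triple hh_pos hh_neg R_nil (s := false)
    ij e_neq0 d_gt0.
have [C [d [dP dC d0]]] := degree_part_dims t0P sp nz.
split.
(* The dimensions are bounded uniformly in the degree, so a constant polynomial suffices. *)
- exists (C%:R)%:P => k; exists (d k) => //; rewrite hornerC ler_nat.
  exact: dC.
- exists d; split=> //; apply: log_ratio_esup => N; exact: growth_sum_bounds.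
- by constructor 1; exact: qX_A11_diagram ij kij ty aE.
Qed.
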